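(* Assume: (i) $\mathcal X\subseteq\mathcal D$; (ii) $F^\star>-\infty$, $\mathbf x_0=\mathbf x_1\in\mathcal X$ and $F(\mathbf x_1)-F^\star\le B_1$; (iii) (mean-squared smoothness and Lipschitzness) $\mathbb E[\|\nabla f(\mathbf x,\boldsymbol\xi)-\nabla f(\mathbf y,\boldsymbol\xi)\|^2]\le L^2\|\mathbf x-\mathbf y\|^2$ and $\mathbb E[|f(\mathbf x,\boldsymbol\xi)-f(\mathbf y,\boldsymbol\xi)|]\le G\|\mathbf x-\mathbf y\|$ for all $\mathbf x,\mathbf y$; (iv) all $h_i$ $(1\le i\le I)$ and all $g_j$ $(1\le j\le J)$ are $L$-smooth and $G$-Lipschitz; (v) $\mathbb E[\|\nabla f(\mathbf x,\boldsymbol\xi)-\nabla U(\mathbf x)\|^2]\le\sigma^2$ for all $\mathbf x\in\mathcal X$; (vi) (parameterized $(\chi,\rho)$-MFCQ) $\chi\ge 0$ and $\rho>0$ are such that for every $\tilde{\mathbf x}\in\mathcal X$ there is $\mathbf d\in\mathbb R^n$ with $\|\mathbf d\|=1$, $\langle\nabla g_j(\tilde{\mathbf x}),\mathbf d\rangle\le-\rho$ for every $j$ with $g_j(\tilde{\mathbf x})\ge-\chi$, and $\langle\nabla h_i(\tilde{\mathbf x}),\mathbf d\rangle\le-\rho$ for every $i$ with $h_i(\tilde{\mathbf x})\ge-\chi$; moreover $\chi\ge\frac{\rho}{L}(G+\rho/2)$; (vii) for each $\mathbf y\in\mathcal X$ and each $\boldsymbol\xi$, the surrogate $\hat f(\cdot,\mathbf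 y,\boldsymbol\xi)$ is $\mu$-strongly convex and $L$-smooth, and $\nabla\hat f(\mathbf x,\mathbf x,\boldsymbol\xi)=\nabla f(\mathbf x,\boldsymbol\xi)$ for all $\mathbf x\in\mathcal X$ (gradient in the first argument); (viii) for each $\mathbf y\in\mathcal X$ and each $j$, the surrogate $\tilde g_j(\cdot,\mathbf y)$ is convex, $L$-smooth and $G$-Lipschitz in $\mathcal X$, $\nabla\tilde g_j(\mathbf y,\mathbf y)=\nabla g_j(\mathbf y)$, and $g_j(\mathbf x)\le\tilde g_j(\mathbf x,\mathbf y)$ for all $\mathbf x\in\mathcal X$ with equality at $\mathbf x=\mathbf y$; (ix) for all $t\ge1$ and all $\mathbf x\in\mathcal X$, $\tilde f(\mathbf x,\mathbf x_t,\mathbf z_t,\boldsymbol\xi_t)+u(\mathbf x)-\min_{\mathbf x'\in\mathcal X(\mathbf x_t)}\big(\tilde f(\mathbf x',\mathbf x_t,\mathbf z_t,\boldsymbol\xi_t)+u(\mathbf x')\big)\le B_U$; (x) $0<\bar k\le w^{1/3}$, $\frac{w^{2/3}}{4\bar k^2}\ge c> 8L^2+\frac{1}{3\bar k^3}$, $\mu>\frac34$ and $w\ge\max\{(\frac{2L\bar k}{4\mu-3})^3,2G^2\}$. Then, for the CoSTA algorithm with the non-adaptive step sizes $\eta_t=\bar k/(w+t)^{1/3}$, $\beta_{t+1}=c\eta_t^2$, for every $\epsilon\in(0,1)$ there exist some $t$ with $1\le t\le\tilde{\mathcal O}(\epsilon^{-3/2})$ and $\hat{\boldsymbol\lambda}_t\in\mathbb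 R^J_+$, $\hat{\boldsymbol\nu}_t\in\mathbb R^I_+$ such that $(\hat{\mathbf x}_t,\hat{\boldsymbol\lambda}_t,\hat{\boldsymbol\nu}_t)$ is $\epsilon$-KKT optimal.
   Context: Problem. $U(\mathbf x)=\mathbb E[f(\mathbf x,\boldsymbol\xi)]$ with $f(\cdot,\boldsymbol\xi)$ differentiable, possibly non-convex, and $\boldsymbol\xi$ a random variable; $u$ is convex (possibly non-smooth); $h_1,\dots,h_I$ are smooth convex functions and $g_1,\dots,g_J$ smooth, possibly non-convex functions on $\mathbb R^n$. Let $F=U+u$, $\mathcal K=\{\mathbf x\in\mathbb R^n: h_i(\mathbf x)\le0\ \forall i\}$, $\mathcal X=\mathcal K\cap\{\mathbf x: g_j(\mathbf x)\le0\ \forall j\}$, $F^\star=\min_{\mathbf x\in\mathcal X}F(\mathbf x)$, and $\mathcal D=\mathrm{dom}(F)\cap\bigcap_j\mathrm{dom}(g_j)\cap\bigcap_i\mathrm{dom}(h_i)$. $L$-smooth means differentiable with $L$-Lipschitz gradient; norms are Euclidean. CoSTA algorithm with non-adaptive step sizes. Parameters $\bar k,w,c>0$; i.i.d. samples $\boldsymbol\xi_1,\boldsymbol\xi_2,\dots$ of $\boldsymbol\xi$; start $\mathbf x_0=\mathbf x_1\in\mathcal X$ and $\mathbf z_1=\nabla f(\mathbf x_0,\boldsymbol\xi_1)$. Put $\eta_t=\bar k/(w+t)^{1/3}$ and $\beta_{t+1}=c\eta_t^2$ for $t\ge 0$. For $t=1,2,\dots$: $\mathbf z_{t+1}=\nabla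 f(\mathbf x_t,\boldsymbol\xi_t)+(1-\beta_t)(\mathbf z_t-\nabla f(\mathbf x_{t-1},\boldsymbol\xi_t))$; $\hat{\mathbf x}_t=\arg\min_{\mathbf x\in\mathcal X(\mathbf x_t)}\tilde f(\mathbf x,\mathbf x_t,\mathbf z_t,\boldsymbol\xi_t)+u(\mathbf x)$, where $\tilde f(\mathbf x,\mathbf x_t,\mathbf z_t,\boldsymbol\xi_t)=\hat f(\mathbf x,\mathbf x_t,\boldsymbol\xi_t)+(1-\beta_t)\langle\mathbf x-\mathbf x_t,\mathbf z_t-\nabla f(\mathbf x_{t-1},\boldsymbol\xi_t)\rangle$ and $\mathcal X(\mathbf y)=\mathcal K\cap\{\mathbf x:\tilde g_j(\mathbf x,\mathbf y)\le0\ \forall j\}$; $\mathbf x_{t+1}=(1-\eta_t)\mathbf x_t+\eta_t\hat{\mathbf x}_t$. Here $\hat f(\cdot,\mathbf y,\boldsymbol\xi)$ and $\tilde g_j(\cdot,\mathbf y)$ are user-chosen surrogates of $f(\cdot,\boldsymbol\xi)$ and $g_j$. The subproblem is a convex problem: $\mathcal X(\mathbf y)$ is a convex set and $\mathcal X(\mathbf y)\subseteq\mathcal X$ for $\mathbf y\in\mathcal X$. $\epsilon$-KKT optimality. A (random) triple $(\tilde{\mathbf x},\tilde{\boldsymbol\lambda},\tilde{\boldsymbol\nu})$ with $\tilde{\mathbf x}\in\mathcal X$, $\tilde{\boldsymbol\lambda}\in\mathbb R^J_+$, $\tilde{\boldsymbol\nu}\in\mathbb R^I_+$ is $\epsilon$-KKT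 optimal if for some $\mathbf v\in\partial u(\tilde{\mathbf x})$: $\mathbb E\big[\|\nabla U(\tilde{\mathbf x})+\sum_j\tilde\lambda_j\nabla g_j(\tilde{\mathbf x})+\sum_i\tilde\nu_i\nabla h_i(\tilde{\mathbf x})+\mathbf v\|\big]\le\sqrt\epsilon$, $\mathbb E[\sum_j\tilde\lambda_jg_j(\tilde{\mathbf x})]\ge-\epsilon$, and $\mathbb E[\sum_i\tilde\nu_ih_i(\tilde{\mathbf x})]\ge-\epsilon$. $t\le\tilde{\mathcal O}(\epsilon^{-3/2})$ means $t\le C\epsilon^{-3/2}(\log(e/\epsilon))^p$ for constants $C,p>0$ not depending on $\epsilon$ (depending only on the problem and algorithm parameters). *)

(* Defs.v *)
From HB Require Import structures.
From mathcomp Require Export all_boot all_order all_algebra.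
From mathcomp Require Export all_classical all_reals all_analysis.
Set Implicit Arguments.
Unset Strict Implicit.
Unset Printing Implicit Defensive.
Export Order.TTheory GRing.Theory Num.Theory.
Export numFieldNormedType.Exports.
#[global] Open Scope classical_set_scope.
#[global] Open Scope ring_scope.

Section Euclidean.
Context {R : realType} {n : nat}.
Local Notation V := 'rV[R]_n.

(* The library's norm on row vectors is the sup norm; enorm is the Euclidean
   one.  Differentiability does not depend on this choice. *)
Definition dotv (x y : V) : R := \sum_i x 0 i * y 0 i.
Definition enorm (x : V) : R := Num.sqrt (dotv x x).

(* The vector of partial derivatives: grad f x is the gradient of f at points
   where f is differentiable. *)
Definition grad (f : V -> R) (x : V) : V :=
  \row_i 'D_(delta_mx 0 i : V) f x.

Definition smooth_on (A : set V) (L : R) (f : V -> R) : Prop :=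
  (forall x, A x -> differentiable f x) /\
  (forall x y, A x -> A y ->
     enorm (grad f x - grad f y) <= L * enorm (x - y)).

Definition lip_on (A : set V) (G : R) (f : V -> R) : Prop :=
  forall x y, A x -> A y -> `|f x - f y| <= G * enorm (x - y).

Definition strongly_convex (mu : R) (f : V -> R) : Prop :=
  forall (x y : V) (s : R), 0 <= s <= 1 ->
    f (s *: x + (1 - s) *: y) <=
      s * f x + (1 - s) * f y - mu / 2 * (s * (1 - s)) * enorm (x - y) ^+ 2.

(* Extended-valued convex functions never take the value -oo; at s = 0 and
   s = 1 the convention 0 * +oo = 0 makes the inequality trivial. *)
Definition econvex (u : V -> \bar R) : Prop :=
  (forall x, u x != -oo%E) /\
  (forall (x y : V) (s : R), 0 <= s <= 1 ->
    (u (s *: x + (1 - s) *: y)%R <= s%:E * u x + (1 - s)%:E * u y)%E).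

Definition subdiff (u : V -> \bar R) (x : V) : set V :=
  [set v | u x \is a fin_num /\
           forall y, (u x + (dotv v (y - x))%:E <= u y)%E].

Definition effdom (phi : V -> \bar R) : set V := [set x | (phi x < +oo)%E].

Definition minval (A : set V) (phi : V -> \bar R) : \bar R :=
  ereal_inf [set phi x | x in A].

Definition is_argmin (A : set V) (phi : V -> \bar R) (x : V) : Prop :=
  A x /\ forall y, A y -> (phi x <= phi y)%E.

End Euclidean.

Section Problem.
Context {R : realType} {n I J : nat}.
Local Notation V := 'rV[R]_n.
Context {d d' : measure_display} {T : measurableType d}
  {Xi : measurableType d'}.
Variable P : probability T R.
Variable xi : {RV P >-> Xi}.
Variables (f : V -> Xi -> R) (u : V -> \bar R).
Variables (h : 'I_I -> V -> R) (g : 'I_J -> V -> R).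

Definition Uobj (x : V) : \bar R := 'E_P[fun w => f x (xi w)].
Definition gradU : V -> V := grad (fun x => fine (Uobj x)).
Definition Fobj (x : V) : \bar R := (Uobj x + u x)%E.

Definition Kset : set V := [set x | forall i, h i x <= 0].
Definition Xset : set V := Kset `&` [set x | forall j, g j x <= 0].
Definition Xsur (gtil : 'I_J -> V -> V -> R) (y : V) : set V :=
  Kset `&` [set x | forall j, gtil j x y <= 0].

Definition Fstar : \bar R := minval Xset Fobj.

Definition Dset : set V :=
  effdom Fobj `&` (\bigcap_j effdom (EFin \o g j))
    `&` (\bigcap_i effdom (EFin \o h i)).

Definition MFCQ (chi rho : R) : Prop :=
  forall x, Xset x -> exists dir : V,
    [/\ enorm dir = 1,
        forall j, - chi <= g j x -> dotv (grad (g j) x) dir <= - rho &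
        forall i, - chi <= h i x -> dotv (grad (h i) x) dir <= - rho].

Definition random_vector {m : nat} (X : T -> 'rV[R]_m) : Prop :=
  forall i, measurable_fun setT (fun w => X w 0 i).

(* The multipliers and the subgradient are random vectors, so that the
   expectations below are those of measurable functions. *)
Definition eps_KKT (eps : R) (xt : T -> V) (lam : T -> 'rV[R]_J)
    (nu : T -> 'rV[R]_I) : Prop :=
  [/\ [/\ random_vector xt, random_vector lam & random_vector nu],
      [/\ forall w, Xset (xt w),
          forall w j, 0 <= lam w 0 j & forall w i, 0 <= nu w 0 i],
      exists v : T -> V,
        [/\ random_vector v, forall w, subdiff u (xt w) (v w) &
          ('E_P[fun w => (enorm (gradU (xt w)
                   + \sum_j lam w 0 j *: grad (g j) (xt w)
                   + \sum_i nu w 0 i *: grad (h i) (xt w) + v w))%R]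
             <= (Num.sqrt eps)%:E)%E],
      ((- eps)%:E <= 'E_P[fun w => (\sum_j lam w 0 j * g j (xt w))%R])%E &
      ((- eps)%:E <= 'E_P[fun w => (\sum_i nu w 0 i * h i (xt w))%R])%E].

(* The samples are xi_1, xi_2, ...; the value at index 0 is not used. *)
Definition iid_samples (xis : nat -> {RV P >-> Xi}) : Prop :=
  (forall t, (1 <= t)%N -> forall B, measurable B ->
     distribution P (xis t) B = distribution P xi B) /\
  (forall (s : seq nat) (B : nat -> set Xi), uniq s -> all (leq 1) s ->
     (forall t, measurable (B t)) ->
     P (\bigcap_(t in [set` s]) (xis t @^-1` B t)) =
       (\prod_(t <- s) P (xis t @^-1` B t))%E).

Definition eta (kbar w : R) (t : nat) : R := kbar / (w + t%:R) `^ 3^-1.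
(* beta_{t+1} = c eta_t^2: meaningful for t >= 1 only. *)
Definition beta (kbar w c : R) (t : nat) : R := c * eta kbar w t.-1 ^+ 2.

Definition subobj (fhat : V -> V -> Xi -> R) (b : R) (xt xprev zt : V)
    (s : Xi) (x : V) : \bar R :=
  ((fhat x xt s
     + (1 - b) * dotv (x - xt) (zt - grad (f ^~ s) xprev))%:E + u x)%E.

(* x t, z t and xh t are the random iterates x_t, z_t and \hat x_t (z and xh
   are used for t >= 1).  The last clause says that \hat x_t is a random vector
   determined by the samples xi_1, ..., xi_t: it is the measurability of
   \hat x_t for the sigma-algebra these samples generate. *)
Definition costa (xis : nat -> {RV P >-> Xi})
    (fhat : V -> V -> Xi -> R) (gtil : 'I_J -> V -> V -> R)
    (kbar w c : R) (x1 : V) (x z xh : nat -> T -> V) : Prop :=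
  [/\ forall om, x 0%N om = x1 /\ x 1%N om = x1,
      forall om, z 1%N om = grad (f ^~ (xis 1%N om)) (x 0%N om),
      forall t om, (1 <= t)%N ->
        [/\ z t.+1 om = grad (f ^~ (xis t om)) (x t om)
              + (1 - beta kbar w c t) *:
                  (z t om - grad (f ^~ (xis t om)) (x t.-1 om)),
            is_argmin (Xsur gtil (x t om))
              (subobj fhat (beta kbar w c t) (x t om) (x t.-1 om) (z t om)
                 (xis t om))
              (xh t om) &
            x t.+1 om = (1 - eta kbar w t) *: x t om
              + eta kbar w t *: xh t om] &
      forall t i, (1 <= t)%N -> forall B : set R, measurable B ->
        g_sigma_preimage (fun k : 'I_t => xis k.+1 : T -> Xi)
          ((fun om => xh t om 0 i) @^-1` B)].

End Problem.

(* Main.v *)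
From HB Require Import structures.
From mathcomp Require Import ring lra measurable_realfun.
Require Import Defs.
Set Implicit Arguments.
Unset Strict Implicit.
Unset Printing Implicit Defensive.

(** Write [e_t = z_(t+1) - grad U (x_t)] and [d_t = xh_t - x_t].  Strong
    convexity of the subproblem and smoothness of [U] give, for every outcome,
    [F (x_(t+1)) <= F (x_t) - eta_t / 2 |d_t|^2 + eta_t |e_t|^2], while
    independence of the samples gives
    [E |e_(t+1)|^2 <= (1 - beta)^2 E |e_t|^2 + 2 beta^2 sigma^2 + 2 L^2 eta_t^2 E |d_t|^2]
    with [beta = c eta_t^2].  Since [c] is large compared with [L^2], the energy
    [E |e_t|^2 / eta_(t-1)] absorbs the errors of the descent inequality, and
    [sum_(t <= T) eta_t (E |e_t|^2 + E |d_t|^2) = O(log T)]; as [eta_t] is of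
    order [t^(-1/3)], some [t = O~(eps^(-3/2))] has both expectations below a
    multiple of [eps].

    For such a [t], MFCQ provides a Slater point of the subproblem with margin
    [rho^2 / (2 L)]; together with (ix) it bounds the multipliers of the
    subproblem by [M = 2 L |BU| / rho^2].  Replacing the surrogate gradients by
    the true ones costs a multiple of [|e_t| + |d_t|] in the KKT residual and
    [L M |d_t|^2] in complementary slackness. *)

(** * Euclidean norm and gradients *)

Section EuclideanFacts.
Context {R : realType} {n : nat}.
Local Notation V := 'rV[R]_n.
Implicit Types x y z v : V.

(** Three obstacles shape the proof. First, the assumptions do not say that [grad U] is the mean of
    the sample gradients, which both the smoothness of [U] and the unbiasedness of the estimator
    rest on. It is derived from mean-squared smoothness: the Taylor remainder of each sample
    function is bounded by the integral of a merely measurable derivative, Tonelli's theorem moves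
    the expectation inside, and the resulting quadratic remainder identifies the gradient. Second,
    [eps_KKT] asks for random multipliers and subgradients, while the pointwise ones come from
    surrogates that may depend on the sample in any way. So triples are selected anew from compact
    sets described by the true gradients and by bounds that are random variables. Third, square
    integrability is not given. That of [d_t] follows from the summed descent inequality, and that
    of [e_(t+1)] from those of [e_t] and [d_t], so the two are obtained alternately. The start is
    special: [z_1] and [z_2] use the same sample, so [e_1] is a pure sampling error, and the energy
    estimate runs from [t = 2] only, the first step being bounded separately. *)

Lemma dotvC x y : dotv x y = dotv y x.
Proof. by apply: eq_bigr => i _; rewrite mulrC. Qed.

Lemma dotvDl x y z : dotv (x + y) z = dotv x z + dotv y z.
Proof. by rewrite -big_split; apply: eq_bigr => i _; rewrite mxE mulrDl. Qed.

Lemma dotvZl a x y : dotv (a *: x) y = a * dotv x y.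
Proof. by rewrite mulr_sumr; apply: eq_bigr => i _; rewrite mxE mulrA. Qed.

Lemma dotvNl x y : dotv (- x) y = - dotv x y.
Proof. by rewrite -scaleN1r dotvZl mulN1r. Qed.

Lemma dotvBl x y z : dotv (x - y) z = dotv x z - dotv y z.
Proof. by rewrite dotvDl dotvNl. Qed.

Lemma dotvDr x y z : dotv z (x + y) = dotv z x + dotv z y.
Proof. by rewrite dotvC dotvDl !(dotvC z). Qed.

Lemma dotvZr a x y : dotv x (a *: y) = a * dotv x y.
Proof. by rewrite dotvC dotvZl dotvC. Qed.

Lemma dotvNr x y : dotv x (- y) = - dotv x y.
Proof. by rewrite dotvC dotvNl dotvC. Qed.

Lemma dotvBr x y z : dotv z (x - y) = dotv z x - dotv z y.
Proof. by rewrite dotvDr dotvNr. Qed.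

Lemma dotv0l x : dotv 0 x = 0.
Proof. by rewrite -(scale0r 0) dotvZl mul0r. Qed.

Lemma dotv0r x : dotv x 0 = 0.
Proof. by rewrite dotvC dotv0l. Qed.

Lemma dotv_suml k (F : 'I_k -> V) x :
  dotv (\sum_i F i) x = \sum_i dotv (F i) x.
Proof.
by rewrite (big_morph (dotv^~ x) (fun a b => dotvDl a b x) (dotv0l x)).
Qed.

Lemma dotv_ge0 x : 0 <= dotv x x.
Proof. by apply: sumr_ge0 => i _; rewrite -expr2 sqr_ge0. Qed.

Lemma enorm_ge0 x : 0 <= enorm x.
Proof. exact: sqrtr_ge0. Qed.

Lemma sqr_enorm x : enorm x ^+ 2 = dotv x x.
Proof. by rewrite sqr_sqrtr ?dotv_ge0. Qed.

Lemma enorm0 : enorm (0 : V) = 0.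
Proof. by rewrite /enorm dotv0l sqrtr0. Qed.

Lemma enormZ a x : enorm (a *: x) = `|a| * enorm x.
Proof.
by rewrite /enorm dotvZl dotvZr mulrA -expr2 sqrtrM ?sqr_ge0// sqrtr_sqr.
Qed.

Lemma enormN x : enorm (- x) = enorm x.
Proof. by rewrite -scaleN1r enormZ normrN1 mul1r. Qed.

Lemma enormC x y : enorm (x - y) = enorm (y - x).
Proof. by rewrite -enormN opprB. Qed.

Lemma sqr_coord_le x i : x 0 i ^+ 2 <= enorm x ^+ 2.
Proof.
rewrite sqr_enorm /dotv (bigD1 i) //= -expr2 lerDl.
by apply: sumr_ge0 => j _; rewrite -expr2 sqr_ge0.
Qed.

Lemma coord_le_enorm x i : `|x 0 i| <= enorm x.
Proof.
by rewrite -(@ler_pXn2r _ 2) ?nnegrE ?enorm_ge0// real_normK ?num_real ?sqr_coord_le.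
Qed.

Lemma enorm_eq0 x : enorm x = 0 -> x = 0.
Proof.
move=> x0; apply/rowP => i; rewrite mxE; apply/eqP.
by rewrite -normr_le0 -x0 coord_le_enorm.
Qed.

(* The discriminant of [s |-> |x + s y|^2]. *)
Lemma cauchy_schwarz x y : `|dotv x y| <= enorm x * enorm y.
Proof.
have [y0|y0] := eqVneq (enorm y) 0.
  by rewrite (enorm_eq0 y0) dotv0r enorm0 mulr0 normr0.
rewrite -(@ler_pXn2r _ 2) ?nnegrE ?mulr_ge0 ?enorm_ge0//.
rewrite real_normK ?num_real// exprMn !sqr_enorm.
have := dotv_ge0 (dotv y y *: x - dotv x y *: y).
rewrite dotvBl !dotvBr !dotvZl !dotvZr (dotvC y x) -subr_ge0.
have yy : 0 < dotv y y by rewrite lt_def -sqr_enorm sqrf_eq0 y0 sqr_ge0.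
move=> H; rewrite -(pmulr_rge0 _ yy); apply: le_trans H _.
by rewrite le_eqVlt; apply/orP; left; apply/eqP; ring.
Qed.

Lemma dotv_le x y : dotv x y <= enorm x * enorm y.
Proof. exact: le_trans (ler_norm _) (cauchy_schwarz x y). Qed.

Lemma enormD x y : enorm (x + y) <= enorm x + enorm y.
Proof.
rewrite -(@ler_pXn2r _ 2) ?nnegrE ?addr_ge0 ?enorm_ge0//.
rewrite sqr_enorm dotvDl !dotvDr sqrrD !sqr_enorm (dotvC y x).
by have := dotv_le x y; lra.
Qed.

Lemma enorm_sum k (F : 'I_k -> V) : enorm (\sum_i F i) <= \sum_i enorm (F i).
Proof.
elim/big_ind2: _ => [|a b c e ab ce|//]; first by rewrite enorm0.
by rewrite (le_trans (enormD _ _))// lerD.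
Qed.

Lemma sqr_enormD_le x y : enorm (x + y) ^+ 2 <= 2 * enorm x ^+ 2 + 2 * enorm y ^+ 2.
Proof.
have /= := sqr_ge0 (enorm (x - y)); rewrite !sqr_enorm.
by rewrite !dotvDl !dotvDr !dotvNl !dotvNr (dotvC y x); lra.
Qed.

Lemma enorm_delta (i : 'I_n) : enorm (delta_mx 0 i : V) = 1.
Proof.
rewrite /enorm /dotv (bigD1 i)//= big1 ?addr0 => [|j ji].
  by rewrite mxE !eqxx mulr1 sqrtr1.
by rewrite mxE eqxx (negbTE ji) mulr0.
Qed.

Lemma dotv_delta x (i : 'I_n) : dotv x (delta_mx 0 i) = x 0 i.
Proof.
rewrite /dotv (bigD1 i)//= big1 ?addr0 => [|j ji].
  by rewrite mxE !eqxx mulr1.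
by rewrite mxE eqxx (negbTE ji) mulr0.
Qed.

End EuclideanFacts.

Section Continuity.
Context {R : realType} {n : nat} {T : topologicalType}.
Local Notation V := 'rV[R]_n.

Lemma continuous_sum (k : nat) (F : 'I_k -> T -> R) (t : T) :
  (forall i, {for t, continuous (F i)}) ->
  {for t, continuous (fun t => \sum_i F i t)}.
Proof.
move=> cF; apply: cvg_big => [|i _]; last exact: cF.
exact: add_continuous.
Qed.

Lemma continuous_dotv (X Y : T -> V) t :
  {for t, continuous X} -> {for t, continuous Y} ->
  {for t, continuous (fun t => dotv (X t) (Y t))}.
Proof.
move=> cX cY; apply: continuous_sum => i.
apply: cvgM.
  exact: (continuous_comp cX (@coord_continuous R 1 n 0 i (X t))).
exact: (continuous_comp cY (@coord_continuous R 1 n 0 i (Y t))).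
Qed.

Lemma continuous_enorm (X : T -> V) t :
  {for t, continuous X} -> {for t, continuous (fun t => enorm (X t))}.
Proof.
move=> cX; have := continuous_dotv cX cX.
by move/continuous_comp; apply; exact: sqrt_continuous.
Qed.

End Continuity.

Section Gradient.
Context {R : realType} {n : nat}.
Local Notation V := 'rV[R]_n.
Implicit Types (x y v : V) (f : V -> R).

Lemma row_sum_dotv v : v = \sum_i v 0 i *: (delta_mx 0 i : V).
Proof. exact: row_sum_delta. Qed.

Lemma derive_grad f x v : differentiable f x -> 'D_v f x = dotv (grad f x) v.
Proof.
move=> df; rewrite deriveE// [in LHS](row_sum_dotv v) linear_sum.
apply: eq_bigr => i _; rewrite linearZ/= mxE deriveE//.
by rewrite mulrC.
Qed.

Lemma is_derive_line f x v s : differentiable f (x + s *: v) ->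
  is_derive s 1 (fun s : R => f (x + s *: v)) (dotv (grad f (x + s *: v)) v).
Proof.
move=> df; rewrite -derive_grad//.
have E : (fun h : R => h^-1 *: ((fun s : R => f (x + s *: v)) (h *: 1 + s)
            - f (x + s *: v)))
       = (fun h : R => h^-1 *: (f (h *: v + (x + s *: v)) - f (x + s *: v))).
  apply/funext => h /=; congr (_ *: (f _ - _)).
  by rewrite scalerDl [h *: 1]mulr1 addrCA.
split; last by rewrite /derive /comp /shift /= E.
rewrite /derivable /comp /shift /= E.
exact: (@diff_derivable _ _ _ f (x + s *: v) v df).
Qed.

(** Once [L / 2 |v|^2 s^2] is subtracted, the derivative along the segment is nonpositive, so the
    mean value theorem suffices; the sign [b] yields both inequalities. The hypotheses concern the
    segment alone because the surrogate constraints are smooth on [X] only. *)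
Lemma quadratic_bound L f x v : 0 <= L ->
  (forall s : R, 0 <= s <= 1 -> differentiable f (x + s *: v)) ->
  (forall s : R, 0 <= s <= 1 ->
     enorm (grad f (x + s *: v) - grad f x) <= L * enorm (s *: v)) ->
  `|f (x + v) - f x - dotv (grad f x) v| <= L / 2 * enorm v ^+ 2.
Proof.
move=> L0 df Lf.
pose D (s : R) : R := dotv (grad f (x + s *: v)) v.
have dv (b s : R) : 0 <= s <= 1 ->
    is_derive s 1 (fun s : R => b * (f (x + s *: v) - s * dotv (grad f x) v)
                     - L / 2 * enorm v ^+ 2 * s ^+ 2)
      (b * (D s - dotv (grad f x) v) - L * enorm v ^+ 2 * s).
  move=> s01; have := is_derive_line (df s s01); rewrite -/(D s) => dl.
  have -> : (fun s : R => b * (f (x + s *: v) - s * dotv (grad f x) v)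
                     - L / 2 * enorm v ^+ 2 * s ^+ 2) =
    b *: ((fun s : R => f (x + s *: v)) - (dotv (grad f x) v) *: id)
      - (L / 2 * enorm v ^+ 2) *: (id ^+ 2).
    by apply/funext => t; rewrite !fctE /= [_ *: t]mulrC.
  apply: is_derive_eq.
  rewrite /GRing.scale /=.
  by field.
have key (b : R) : `|b| = 1 ->
    b * (f (x + v) - f x - dotv (grad f x) v) <= L / 2 * enorm v ^+ 2.
  move=> b1.
  have [| |c] := @MVT R (fun s : R => b * (f (x + s *: v) - s * dotv (grad f x) v)
                     - L / 2 * enorm v ^+ 2 * s ^+ 2) (fun s => b * (D s - dotv (grad f x) v)
                       - L * enorm v ^+ 2 * s) 0 1 ltr01.
  - by move=> s; rewrite in_itv /= => /andP[s0 s1]; apply: dv; rewrite !ltW.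
  - apply: derivable_within_continuous => s; rewrite in_itv /= => s01.
    by have [] := dv b s s01.
  rewrite in_itv /= => /andP[c0 c1] H.
  have : b * (D c - dotv (grad f x) v) - L * enorm v ^+ 2 * c <= 0.
    rewrite subr_le0 /D -dotvBl.
    apply: le_trans (ler_norm _) _; rewrite normrM b1 mul1r.
    apply: le_trans (cauchy_schwarz _ _) _.
    have c01 : 0 <= c <= 1 by rewrite !ltW.
    have := Lf c c01; rewrite enormZ (ger0_norm (ltW c0)) => /(ler_wpM2r (enorm_ge0 v)).
    by move/le_trans; apply; rewrite expr2; rewrite le_eqVlt; apply/orP; left; apply/eqP; ring.
  move: H; rewrite scale1r scale0r addr0; lra.
by rewrite ler_norml; apply/andP; split;
  [have := key (-1) | have := key 1]; rewrite ?normrN1 ?normr1 => /(_ erefl); lra.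
Qed.

Lemma smooth_quadratic_bound A L f x v : 0 <= L -> smooth_on A L f ->
  (forall s : R, 0 <= s <= 1 -> A (x + s *: v)) ->
  `|f (x + v) - f x - dotv (grad f x) v| <= L / 2 * enorm v ^+ 2.
Proof.
move=> L0 [df Lf] Av; apply: quadratic_bound => // s s01; first exact/df/Av.
have := Lf _ x (Av s s01); rewrite addrAC subrr add0r; apply.
by have := Av 0; rewrite lexx ler01 scale0r addr0; exact.
Qed.

Lemma first_order f x v (e : R) : differentiable f x -> 0 < e ->
  exists2 r : R, 0 < r & forall s : R, 0 < s < r ->
    `|f (x + s *: v) - f x - s * dotv (grad f x) v| <= e * s.
Proof.
move=> df e0; rewrite -derive_grad//.
have [r /= r0 H] : \forall h \near (0 : R)^',
    `|'D_v f x - h^-1 *: (f (h *: v + x) - f x)| < e.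
  by have /cvgrPdist_lt := @diff_derivable _ _ _ f x v df; apply.
exists r => // s /andP[s0 sr].
have := H s; rewrite /= sub0r normrN gtr0_norm// => /(_ sr (lt0r_neq0 s0)) /ltW.
rewrite distrC => K.
have -> : f (x + s *: v) - f x - s * 'D_v f x =
    s * (s^-1 *: (f (s *: v + x) - f x) - 'D_v f x).
  rewrite [s *: v + x]addrC; set p := f (x + _).
  rewrite mulrBr; congr (_ - _).
  by rewrite [RHS](mulVKf (lt0r_neq0 s0)).
by rewrite normrM gtr0_norm// mulrC ler_wpM2r// ltW.
Qed.

(** The slack is rescaled by [|k| + 1], so [k] may have any sign and need not be known in
    advance. *)
Lemma ler_addgt0_scale (a b k : R) : (forall e : R, 0 < e -> a <= b + e * k) -> a <= b.
Proof.
move=> H; apply/ler_addgt0Pr => e e0.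
have k1 : 0 < `|k| + 1 by rewrite ltr_wpDl.
apply: le_trans (H (e / (`|k| + 1)) _) _; first by rewrite divr_gt0.
rewrite lerD2l mulrAC ler_pdivrMr// ler_pM2l//.
by rewrite (le_trans (ler_norm _))// lerDl.
Qed.

Lemma strongly_convex_grad mu f x y : strongly_convex mu f ->
  differentiable f x ->
  f x + dotv (grad f x) (y - x) + mu / 2 * enorm (y - x) ^+ 2 <= f y.
Proof.
move=> sc df; apply: (@ler_addgt0_scale _ _ (1 + `|mu / 2 * enorm (y - x) ^+ 2|)) => e e0.
have [r r0 H] := first_order (y - x) df e0.
(* Below [r] the first-order expansion holds, below [1] the weight is admissible, and below [e] the
   second-order term [s * q'] left after division by [s] is absorbed in the slack. *)
pose s := Num.min (r / 2) (Num.min 1 e / 2).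
have s0 : 0 < s by rewrite !lt_min !divr_gt0// lt_min ltr01.
have sr : s < r by rewrite gt_min; apply/orP; left; lra.
have s1 : s <= 1 / 2.
  rewrite ge_min; apply/orP; right.
  have : Num.min 1 e <= 1 by rewrite ge_min lexx.
  lra.
have se : s <= e.
  rewrite ge_min; apply/orP; right.
  have : Num.min 1 e <= e by rewrite ge_min lexx orbT.
  lra.
have := H s; rewrite s0 sr => /(_ isT); rewrite ler_norml => /andP[H1 _].
have := sc y x s; rewrite (ltW s0) (le_trans s1) ?ler_pdivrMr ?mul1r ?ler1n// => /(_ isT).
have -> : s *: y + (1 - s) *: x = x + s *: (y - x).
  by rewrite scalerBl scalerBr scale1r addrCA.
move=> H2; set q := mu / 2 * _ in H2 *; set q' := mu / 2 * _.
have {}H2 : f (x + s *: (y - x)) <= s * f y + (1 - s) * f x - s * (1 - s) * q'.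
  by apply: le_trans H2 _; rewrite /q /q' le_eqVlt; apply/orP; left; apply/eqP; ring.
have {q H1 H2} H3 : s * (dotv (grad f x) (y - x) + f x + q') <= s * (f y + e + s * q') by lra.
have := H3; rewrite ler_pM2l// => {}H3.
have : s * q' <= e * `|q'|.
  rewrite (le_trans (ler_norm _))// normrM gtr0_norm// ler_wpM2r//.
lra.
Qed.

(** Adding the strong convexity inequalities at [x] and at [y] gives [mu |x - y|^2 <= <grad f x -
    grad f y, x - y>]. It serves to exclude [L <= 0] in the final theorem, where the sign of [L] is
    not stated. *)
Lemma strongly_convex_smooth L mu f x y : strongly_convex mu f ->
  smooth_on setT L f -> 0 < enorm (x - y) -> mu <= L.
Proof.
move=> sc [df Lf] xy.
have H1 := strongly_convex_grad y sc (df x I).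
have H2 := strongly_convex_grad x sc (df y I).
have H3 := dotv_le (grad f x - grad f y) (x - y).
have := Lf x y I I; rewrite -(ler_pM2r xy) => H4.
move: H1 H2 H3; rewrite -(opprB x y) dotvNr enormN dotvBl => H1 H2 H3.
have : mu * enorm (x - y) ^+ 2 <= L * enorm (x - y) ^+ 2 by lra.
by rewrite ler_pM2r// exprn_gt0.
Qed.

End Gradient.

(** * Convex multipliers *)

Section Multipliers.
Context {R : realType} {V : lmodType R}.
Implicit Types (C : set V) (psi l : V -> R).

Definition cvx_set C := forall (x y : V) (s : R), 0 <= s <= 1 -> C x -> C y ->
  C (s *: x + (1 - s) *: y).

Definition cvx_on C psi := forall (x y : V) (s : R), 0 <= s <= 1 -> C x -> C y ->
  psi (s *: x + (1 - s) *: y) <= s * psi x + (1 - s) * psi y.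

Lemma cvx_onS C C' psi : C' `<=` C -> cvx_on C psi -> cvx_on C' psi.
Proof. by move=> CC cp x y s s01 /CC Cx /CC Cy; exact: cp. Qed.

Lemma cvx_onD C psi l a : 0 <= a -> cvx_on C psi -> cvx_on C l ->
  cvx_on C (fun y => psi y + a * l y).
Proof.
move=> a0 cp cl x y s s01 Cx Cy; have := cp x y s s01 Cx Cy.
have := ler_wpM2l a0 (cl x y s s01 Cx Cy); lra.
Qed.

Lemma cvx_set_sublevel C psi a : cvx_set C -> cvx_on C psi ->
  cvx_set (C `&` [set x | psi x < a]).
Proof.
move=> cC cp x y s s01 [Cx xa] [Cy ya]; split; first exact: cC.
have /= := cp x y s s01 Cx Cy; case/andP: s01 => s0 s1.
move=> H; apply: le_lt_trans H _.
have [->|sn0] := eqVneq s 0; first by rewrite mul0r add0r subr0 mul1r.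
have sp : 0 < s by rewrite lt_def sn0.
have := xa; rewrite /= -(ltr_pM2l sp).
have : (1 - s) * psi y <= (1 - s) * a by rewrite ler_wpM2l ?subr_ge0// ltW.
lra.
Qed.

(* The multiplier is the supremum of [- psi / l] over [l > 0]. *)
Lemma multiplier1 C psi l (z : V) : cvx_set C -> cvx_on C psi -> cvx_on C l ->
  C z -> l z < 0 -> (forall y, C y -> l y < 0 -> 0 <= psi y) ->
  exists2 a, 0 <= a & forall y, C y -> 0 <= psi y + a * l y.
Proof.
move=> cC cp cl Cz lz H.
(* Moving [y] slightly towards the strictly feasible [z] makes [l] negative; letting the weight of
   [z] shrink extends the assumption to the boundary [l y = 0]. *)
have H0 y : C y -> l y <= 0 -> 0 <= psi y.
  move=> Cy ly; apply/(@ler_addgt0_scale _ _ _ (`|psi z| + `|psi y|)) => e e0.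
  pose s := Num.min e 1.
  have s01 : 0 < s <= 1 by rewrite lt_min e0 ltr01 ge_min lexx orbT.
  have se : s <= e by rewrite ge_min lexx.
  have s01' : 0 <= s <= 1 by case/andP: s01 => /ltW -> ->.
  have lt0 : l (s *: z + (1 - s) *: y) < 0.
    apply: le_lt_trans (cl _ _ _ s01' Cz Cy) _; case/andP: s01 => s0 s1.
    have : s * l z < 0 by rewrite pmulr_rlt0.
    have : (1 - s) * l y <= 0 by rewrite mulr_ge0_le0// subr_ge0.
    lra.
  have := H _ (cC _ _ _ s01' Cz Cy) lt0.
  have := cp _ _ _ s01' Cz Cy.
  have : s * (psi z - psi y) <= e * (`|psi z| + `|psi y|).
    rewrite (le_trans (ler_norm _))// normrM ger0_norm; last by case/andP: s01'.
    by rewrite ler_pM ?ler_normB//; case/andP: s01'.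
  lra.
(* The weight [s] is where the chord of [l] between [x] and [y] vanishes. By convexity [l] is
   nonpositive at that point, so [psi] is nonnegative there. *)
have cross y x : C y -> C x -> 0 < l y -> l x < 0 -> - psi y * - l x <= psi x * l y.
  move=> Cy Cx ly lx.
  pose s := - l x / (l y - l x).
  have d0 : 0 < l y - l x by lra.
  have s01 : 0 <= s <= 1.
    by rewrite divr_ge0 ?ler_pdivrMr// ?mul1r; lra.
  have := H0 _ (cC _ _ _ s01 Cy Cx).
  have := cl _ _ _ s01 Cy Cx.
  have -> : s * l y + (1 - s) * l x = 0 by rewrite /s; field; rewrite gt_eqF.
  move=> l0 /(_ l0) p0; have := le_trans p0 (cp _ _ _ s01 Cy Cx).
  rewrite -(ler_pM2l d0) mulr0.
  have -> : (l y - l x) * (s * psi y + (1 - s) * psi x) = - l x * psi y + l y * psi x.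
    by rewrite /s; field; rewrite gt_eqF.
  lra.
(* The value [0] is put in [A] so that the supremum is nonnegative and exists even when [l] is
   nowhere positive. *)
pose A := [set a : R | a = 0 \/ exists y, [/\ C y, 0 < l y & a = - psi y / l y]].
have Aub x : C x -> l x < 0 -> ubound A (psi x / - l x).
  move=> Cx lx a [->|[y [Cy ly ->]]].
    by rewrite divr_ge0// ?H// oppr_ge0 ltW.
  by rewrite ler_pdivrMr// mulrAC ler_pdivlMr ?oppr_gt0//; exact: cross.
have A0 : A 0 by left.
have hA : has_sup A by split; [exists 0 | exists (psi z / - l z); exact: Aub].
exists (sup A); first by exact: sup_upper_bound hA _ A0.
move=> y Cy; have [ly|ly|ly] := ltgtP (l y) 0.
- have : sup A <= psi y / - l y by apply: ge_sup; [exists 0|exact: Aub].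
  by rewrite ler_pdivlMr ?oppr_gt0//; lra.
- have : - psi y / l y <= sup A by apply: sup_upper_bound => //; right; exists y.
  by rewrite ler_pdivrMr//; lra.
- by rewrite ly mulr0 addr0; apply: H0 => //; rewrite ly.
Qed.

(** Induction on the number of constraints: [multiplier1] is applied to the first one on the set
    where the others hold strictly, and the product of that constraint with its multiplier is then
    absorbed in the objective. *)
Lemma multipliers m C psi (l : 'I_m -> V -> R) (z : V) : cvx_set C ->
  cvx_on C psi -> (forall i, cvx_on C (l i)) ->
  C z -> (forall i, l i z < 0) ->
  (forall y, C y -> (forall i, l i y < 0) -> 0 <= psi y) ->
  exists2 a : 'I_m -> R, (forall i, 0 <= a i) &
    forall y, C y -> 0 <= psi y + \sum_i a i * l i y.
Proof.
elim: m psi l => [|m IH] psi l cC cp cl Cz lz H.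
  exists (fun=> 0) => // y Cy; rewrite big_ord0 addr0.
  by apply: H => // -[].
pose l' i := l (lift ord0 i).
pose C' := C `&` [set y | forall i, l' i y < 0].
have [| | | | |y [Cy ly] ly0|a a0 Ha] := @multiplier1 C' psi (l ord0) z.
- move=> x y s s01 [Cx lx] [Cy ly]; split; first exact: cC.
  by move=> i; have [] := cvx_set_sublevel cC (cl (lift ord0 i)) s01 (conj Cx (lx i)) (conj Cy (ly i)).
- by apply: cvx_onS cp => ? [].
- by apply: cvx_onS (cl ord0) => ? [].
- by split => // i; exact: lz.
- exact: lz.
- apply: H => // i; case: (unliftP ord0 i) => [j|] -> //; exact: ly.
have [| | | | |b b0 Hb] := IH (fun y => psi y + a * l ord0 y) l' cC.
- exact: cvx_onD.
- by move=> i; exact: cl.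
- by [].
- by move=> i; exact: lz.
- by move=> y Cy ly; exact: Ha.
exists (fun i => if unlift ord0 i is Some j then b j else a) => [i|y Cy].
  by case: unliftP.
rewrite big_ord_recl unlift_none addrA.
under eq_bigr do rewrite liftK.
exact: Hb.
Qed.

Lemma multipliers2 m1 m2 C psi (l1 : 'I_m1 -> V -> R) (l2 : 'I_m2 -> V -> R)
    (z : V) : cvx_set C ->
  cvx_on C psi -> (forall i, cvx_on C (l1 i)) -> (forall i, cvx_on C (l2 i)) ->
  C z -> (forall i, l1 i z < 0) -> (forall i, l2 i z < 0) ->
  (forall y, C y -> (forall i, l1 i y < 0) -> (forall i, l2 i y < 0) ->
     0 <= psi y) ->
  exists a1 : 'I_m1 -> R, exists a2 : 'I_m2 -> R,
    [/\ forall i, 0 <= a1 i, forall i, 0 <= a2 i &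
    forall y, C y -> 0 <= psi y + \sum_i a1 i * l1 i y + \sum_i a2 i * l2 i y].
Proof.
move=> cC cp cl1 cl2 Cz lz1 lz2 H.
pose l i := match fintype.split i with inl j => l1 j | inr j => l2 j end.
have [| |y Cy ly|a a0 Ha] := @multipliers (m1 + m2) C psi l z cC cp _ Cz.
- by move=> i; rewrite /l; case: fintype.split.
- by move=> i; rewrite /l; case: fintype.split.
- apply: H => // i; [have := ly (lshift m2 i)|have := ly (rshift m1 i)];
    by rewrite /l ?(unsplitK (inl _)) ?(unsplitK (inr _)).
exists (a \o lshift m2), (a \o @rshift m1 m2); split => [i|i|y Cy] //=.
have := Ha y Cy; rewrite big_split_ord /= addrA.
rewrite (eq_bigr (fun i => a (lshift m2 i) * l1 i y)) => [|i _]; last first.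
  by rewrite /l (unsplitK (inl _)).
rewrite [X in _ + _ + X](eq_bigr (fun i => a (rshift m1 i) * l2 i y))// => i _.
by rewrite /l (unsplitK (inr _)).
Qed.

End Multipliers.

(** * Multipliers of the convex subproblem and its Slater points *)

Section KKT.
Context {R : realType} {n : nat}.
Local Notation V := 'rV[R]_n.
Implicit Types (u : V -> \bar R) (phi : V -> R).

Lemma first_order_near (f : V -> R) (x v : V) (e : R) : differentiable f x -> 0 < e ->
  \forall s \near (0 : R)^'+, f (x + s *: v) <= f x + s * dotv (grad f x) v + e * s.
Proof.
move=> df e0; have [r r0 H] := first_order v df e0.
near=> s; have : 0 < s < r by apply/andP; split; near: s; [exact: nbhs_right_gt|exact: nbhs_right_lt].
by move=> /H; rewrite ler_norml => /andP[_]; lra.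
Unshelve. all: by end_near.
Qed.

Lemma econvex_fine u x : econvex u -> (u x < +oo)%E -> u x = (fine (u x))%:E.
Proof. by move=> [up _] ux; rewrite fineK// fin_real// ux ltNye up. Qed.

Lemma econvex_combo u (x y : V) (s : R) : econvex u -> 0 <= s <= 1 ->
  (u x < +oo)%E -> (u y < +oo)%E ->
  (u (s *: x + (1 - s) *: y)%R <= (s * fine (u x) + (1 - s) * fine (u y))%R%:E)%E.
Proof.
move=> cu s01 ux uy; have := cu.2 x y s s01.
by rewrite {1}(econvex_fine cu ux) {1}(econvex_fine cu uy) -!EFinM -EFinD.
Qed.

Lemma econvex_dom u : econvex u -> cvx_set (effdom u).
Proof.
move=> cu x y s s01 ux uy; rewrite /effdom /=.
by apply: le_lt_trans (econvex_combo cu s01 ux uy) _; rewrite ltry.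
Qed.

Lemma econvex_on u : econvex u -> cvx_on (effdom u) (fine \o u).
Proof.
move=> cu x y s s01 ux uy; have := econvex_combo cu s01 ux uy.
by rewrite (econvex_fine cu (econvex_dom cu s01 ux uy)) lee_fin.
Qed.

(** Only [phi] and the constraints are linearized at [xh]; [u] is kept, so the separating inequality
    at an arbitrary point is a subgradient inequality. The same inequality at [xh] gives
    complementary slackness, and at the Slater point [xs] the bound on the multipliers. *)
Lemma kkt_multipliers (J I : nat) u phi (q1 : 'I_J -> V -> R) (q2 : 'I_I -> V -> R)
    (xh xs : V) (kappa : R) : 0 < kappa -> econvex u ->
  (u xh < +oo)%E -> (u xs < +oo)%E ->
  differentiable phi xh ->
  (forall j, differentiable (q1 j) xh) -> (forall i, differentiable (q2 i) xh) ->
  (forall j, q1 j xh <= 0) -> (forall i, q2 i xh <= 0) ->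
  (forall j, q1 j xh + dotv (grad (q1 j) xh) (xs - xh) <= - kappa) ->
  (forall i, q2 i xh + dotv (grad (q2 i) xh) (xs - xh) <= - kappa) ->
  (forall y, (forall j, q1 j y <= 0) -> (forall i, q2 i y <= 0) ->
     ((phi xh)%:E + u xh <= (phi y)%:E + u y)%E) ->
  exists a1 : 'I_J -> R, exists a2 : 'I_I -> R,
  [/\ (forall j, 0 <= a1 j) /\ (forall i, 0 <= a2 i),
      (forall j, a1 j * q1 j xh = 0) /\ (forall i, a2 i * q2 i xh = 0),
      (\sum_j a1 j + \sum_i a2 i) * kappa <=
        fine (u xs) - fine (u xh) + dotv (grad phi xh) (xs - xh) &
      subdiff u xh (- (grad phi xh + \sum_j a1 j *: grad (q1 j) xh
                      + \sum_i a2 i *: grad (q2 i) xh))].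
Proof.
move=> kappa0 cu uxh uxs dphi dq1 dq2 q1h q2h sl1 sl2 opt.
pose psi y := fine (u y) - fine (u xh) + dotv (grad phi xh) (y - xh).
pose l (q : V -> R) y := q xh + dotv (grad q xh) (y - xh).
have dlin (p : V) (x y : V) (s : R) :
    dotv p (s *: x + (1 - s) *: y - xh) = s * dotv p (x - xh) + (1 - s) * dotv p (y - xh).
  by rewrite !dotvBr dotvDr !dotvZr; ring.
have cl q : cvx_on (effdom u) (l q).
  by move=> x y s _ _ _; rewrite /l dlin le_eqVlt; apply/orP; left; apply/eqP; ring.
have cp : cvx_on (effdom u) psi.
  move=> x y s s01 ux uy; rewrite /psi dlin.
  by have := econvex_on cu s01 ux uy; rewrite /=; lra.
have [| |y uy ly1 ly2|a1 [a2 [a10 a20 H]]] := multipliers2 (econvex_dom cu) cp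
  (fun j => cl (q1 j)) (fun i => cl (q2 i)) (z := xs) uxs.
- by move=> j; apply: le_lt_trans (sl1 j) _; rewrite oppr_lt0.
- by move=> i; apply: le_lt_trans (sl2 i) _; rewrite oppr_lt0.
(* If [psi] were negative at a strictly feasible [y] of the linearized problem, a short step from
   [xh] towards [y] would be feasible for the original constraints and would improve on [xh]. *)
- rewrite leNgt; apply/negP => psi0.
  have feas (q : V -> R) : differentiable q xh -> q xh <= 0 -> l q y < 0 ->
      \forall s \near (0 : R)^'+, q (xh + s *: (y - xh)) <= 0.
    move=> dq qh lq; have e0 : 0 < - l q y by rewrite oppr_gt0.
    near=> s; have s0 : 0 < s by near: s; exact: nbhs_right_gt.
    have s1 : s < 1 by near: s; exact: nbhs_right_lt.
    have : q (xh + s *: (y - xh)) <= q xh + s * dotv (grad q xh) (y - xh) + - l q y * s.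
      by near: s; exact: first_order_near.
    move/le_trans; apply; rewrite /l.
    have : (1 - s) * q xh <= 0 by rewrite mulr_ge0_le0// subr_ge0 ltW.
    lra.
  have f1 : \forall s \near (0 : R)^'+, forall j, q1 j (xh + s *: (y - xh)) <= 0.
    by apply: filter_forall => j; apply: feas.
  have f2 : \forall s \near (0 : R)^'+, forall i, q2 i (xh + s *: (y - xh)) <= 0.
    by apply: filter_forall => i; apply: feas.
  have [s [s0 s1 g1 g2 fs]] : exists s : R, [/\ 0 < s, s < 1,
      forall j, q1 j (xh + s *: (y - xh)) <= 0,
      forall i, q2 i (xh + s *: (y - xh)) <= 0 &
      phi (xh + s *: (y - xh)) <= phi xh + s * dotv (grad phi xh) (y - xh) + (- psi y / 2) * s].
    apply: (@filter_ex _ (0 : R)^'+).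
    near=> s; split; near: s.
    + exact: nbhs_right_gt.
    + exact: nbhs_right_lt.
    + exact: f1.
    + exact: f2.
    + by apply: first_order_near => //; lra.
  have := opt _ g1 g2; apply/negP; rewrite -ltNge.
  have s01 : 0 <= s <= 1 by rewrite !ltW.
  have E : xh + s *: (y - xh) = s *: y + (1 - s) *: xh.
    by rewrite scalerBl scalerBr scale1r addrCA.
  have Hu := econvex_combo cu s01 uy uxh.
  rewrite (econvex_fine cu uxh) -EFinD.
  apply: (@le_lt_trans _ _ ((phi xh + s * dotv (grad phi xh) (y - xh) + (- psi y / 2) * s)%:E
     + (s * fine (u y) + (1 - s) * fine (u xh))%:E)%E).
    by rewrite leeD// ?lee_fin// {1}E.
  rewrite -EFinD lte_fin.
  have : s * psi y < 0 by rewrite pmulr_rlt0.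
  rewrite /psi; lra.
exists a1, a2.
have psih : psi xh = 0 by rewrite /psi !subrr dotv0r addr0.
have lh q : l q xh = q xh by rewrite /l subrr dotv0r addr0.
have Hh := H xh uxh; rewrite psih add0r in Hh.
have n1 j : a1 j * l (q1 j) xh <= 0 by rewrite lh mulr_ge0_le0.
have n2 i : a2 i * l (q2 i) xh <= 0 by rewrite lh mulr_ge0_le0.
have S1 : \sum_j a1 j * l (q1 j) xh <= 0 by exact: sumr_le0.
have S2 : \sum_i a2 i * l (q2 i) xh <= 0 by exact: sumr_le0.
have Z k (F : 'I_k -> R) : (forall i, F i <= 0) -> 0 <= \sum_i F i -> forall i, F i = 0.
  move=> F0 SF i; apply/eqP; rewrite eq_le F0 /=; apply: le_trans SF _.
  by rewrite (bigD1 i)//= gerDl sumr_le0.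
have z1 j : a1 j * q1 j xh = 0.
  by have := Z _ _ n1 _ j; rewrite lh; apply; move: Hh S1 S2; lra.
have z2 i : a2 i * q2 i xh = 0.
  by have := Z _ _ n2 _ i; rewrite lh; apply; move: Hh S1 S2; lra.
split => //.
  have Hs := H xs uxs.
  have K1 : \sum_j a1 j * l (q1 j) xs <= - (\sum_j a1 j * kappa).
    by rewrite -sumrN; apply: ler_sum => j _; rewrite -mulrN ler_wpM2l// sl1.
  have K2 : \sum_i a2 i * l (q2 i) xs <= - (\sum_i a2 i * kappa).
    by rewrite -sumrN; apply: ler_sum => j _; rewrite -mulrN ler_wpM2l// sl2.
  rewrite mulrDl !mulr_suml -/(psi xs); move: Hs K1 K2; lra.
split => [|y]; first by rewrite (econvex_fine cu uxh).
have [uy|] := ltP (u y) +oo%E; last by rewrite leye_eq => /eqP ->; rewrite leey.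
rewrite (econvex_fine cu uxh) (econvex_fine cu uy) -EFinD lee_fin.
have := H y uy.
have E k (a : 'I_k -> R) (q : 'I_k -> V -> R) : (forall i, a i * q i xh = 0) ->
    \sum_i a i * l (q i) y = dotv (\sum_i a i *: grad (q i) xh) (y - xh).
  move=> z; rewrite dotv_suml; apply: eq_bigr => i _.
  by rewrite /l mulrDr z add0r dotvZl.
rewrite !E// /psi dotvNl !dotvDl; lra.
Unshelve. all: by end_near.
Qed.

(** The step length [rho / L] minimizes [- rho s + L s^2 / 2], with value [- rho^2 / (2 L)]. Active
    constraints decrease by smoothness; inactive ones have slack [chi], and the assumption on [chi]
    is what leaves the same margin after a Lipschitz increase. Activity is tested on the true
    constraint [q], while the bound is for [p], either [q] itself or its surrogate. The fraction [t]
    covers the whole segment, not only its end. *)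
Lemma slater_point L G rho chi (y d : V) (q p : V -> R) (A : set V) :
  0 < L -> 0 < rho -> 0 <= G -> enorm d = 1 ->
  rho / L * (G + rho / 2) <= chi ->
  (- chi <= q y -> dotv (grad q y) d <= - rho) -> q y <= 0 ->
  smooth_on A L p -> lip_on A G p -> p y = q y -> grad p y = grad q y ->
  forall t : R, 0 <= t <= 1 ->
  (forall s : R, 0 <= s <= 1 -> A (y + s *: ((t * (rho / L)) *: d))) ->
  p (y + (t * (rho / L)) *: d) <= - (t * (rho ^+ 2 / (2 * L))).
Proof.
move=> L0 rho0 G0 d1 chiP act qy sp lp py gp t /andP[t0 t1] At.
set v := (t * (rho / L)) *: d.
have rL : 0 <= rho / L by rewrite divr_ge0 ?ltW.
have nv : enorm v = t * (rho / L) by rewrite enormZ d1 mulr1 ger0_norm// mulr_ge0.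
have [na|na] := leP (- chi) (q y).
  have := smooth_quadratic_bound (ltW L0) sp At; rewrite ler_norml => /andP[_].
  rewrite -/v nv py gp /v dotvZr => H.
  have := ler_wpM2l (mulr_ge0 t0 rL) (act na).
  have -> : t * (rho ^+ 2 / (2 * L)) = t * (rho / L) * rho / 2 by field; rewrite gt_eqF.
  have : L / 2 * (t * (rho / L)) ^+ 2 = t * (t * (rho / L) * rho / 2) by field; rewrite gt_eqF.
  have : t * (t * (rho / L) * rho / 2) <= 1 * (t * (rho / L) * rho / 2).
    by rewrite ler_wpM2r// divr_ge0// mulr_ge0 ?(ltW rho0)// mulr_ge0.
  lra.
have Ay : A y by have := At 0; rewrite scale0r addr0; apply; rewrite lexx ler01.
have Av : A (y + v) by have := At 1; rewrite scale1r; apply; rewrite lexx ler01.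
have := lp _ _ Av Ay; rewrite ler_norml => /andP[_].
rewrite addrAC subrr add0r nv py.
have -> : t * (rho ^+ 2 / (2 * L)) = t * (rho / L * (rho / 2)) by field; rewrite gt_eqF.
have : t * (rho / L * G) <= 1 * (rho / L * G) by rewrite ler_wpM2r// mulr_ge0.
have : t * (rho / L * (rho / 2)) <= 1 * (rho / L * (rho / 2)).
  by rewrite ler_wpM2r// mulr_ge0// divr_ge0// ltW.
lra.
Qed.

Lemma cvx_gradient_le (A : set V) (f : V -> R) (x y : V) : cvx_on A f -> A x -> A y ->
  differentiable f x -> f x + dotv (grad f x) (y - x) <= f y.
Proof.
move=> cf Ax Ay df; apply/(@ler_addgt0_scale _ _ _ 1) => e e0; rewrite mulr1.
have [r r0 H] := first_order (y - x) df e0.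
pose s := Num.min (r / 2) 1.
have s0 : 0 < s by rewrite lt_min divr_gt0 ?ltr01.
have sr : s < r by rewrite gt_min; apply/orP; left; lra.
have s1 : s <= 1 by rewrite ge_min lexx orbT.
have := H s; rewrite s0 sr => /(_ isT); rewrite ler_norml => /andP[H1 _].
have := cf y x s; rewrite (ltW s0) s1 => /(_ isT Ay Ax).
have -> : s *: y + (1 - s) *: x = x + s *: (y - x).
  by rewrite scalerBl scalerBr scale1r addrCA.
move=> H2; rewrite -(ler_pM2l s0); lra.
Qed.

Lemma convex_functionE (A : set V) (f : V -> R) : convex_function A f -> cvx_on A f.
Proof.
move=> cf x y s s01 Ax Ay.
have := cf (Itv01 (proj1 (andP s01)) (proj2 (andP s01))) x y.
by rewrite !inE => /(_ Ax Ay).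
Qed.

Lemma convex_setE (A : set V) : convex_set A -> cvx_set A.
Proof.
move=> cf x y s s01 Ax Ay.
have := cf x y (Itv01 (proj1 (andP s01)) (proj2 (andP s01))).
by rewrite !inE => /(_ Ax Ay).
Qed.

End KKT.

(** * Measurability of random vectors *)

Section Caratheodory.
Context {R : realType} {d : measure_display} {T : measurableType d}.

Lemma measurable_floor_eq (Y : T -> R) (a : int) : measurable_fun setT Y ->
  measurable [set w | Num.floor (Y w) = a].
Proof.
move=> mY.
have -> : [set w | Num.floor (Y w) = a] = Y @^-1` `[a%:~R, (a + 1)%:~R[%classic.
  apply/seteqP; split => w /=; rewrite in_itv /=.
    by move=> <-; rewrite floor_le floorD1_gt.
  by move=> H; exact: floor_def.
by rewrite -[X in measurable X]setTI; apply: mY => //; exact: measurable_itv.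
Qed.

(** With [cell], rounds coordinates down to multiples of [1 / (k + 1)]. Cells are integer vectors,
    hence countably many, which turns statements about random vectors into countable unions. *)
Definition grid m (k : nat) (a : 'rV[int]_m) : 'rV[R]_m :=
  \row_i ((a 0 i)%:~R / k.+1%:R).

Definition cell m (k : nat) (x : 'rV[R]_m) : 'rV[int]_m :=
  \row_i Num.floor (x 0 i * k.+1%:R).

Lemma measurable_cell m k (X : T -> 'rV[R]_m) a : random_vector X ->
  measurable [set w | cell k (X w) = a].
Proof.
move=> mX.
have -> : [set w | cell k (X w) = a] =
    \bigcap_(i in [set: 'I_m]) [set w | Num.floor (X w 0 i * k.+1%:R) = a 0 i].
  apply/seteqP; split => w /=.
    by move=> <- i _; rewrite /cell mxE.
  by move=> H; apply/rowP => i; rewrite mxE; exact: H.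
apply: fin_bigcap_measurable; first exact: finite_finset.
move=> i _; apply: measurable_floor_eq.
exact: (measurable_funM (mX i) (measurable_cst _)).
Qed.

Lemma cell_dist m k (x : 'rV[R]_m) i : `|grid k (cell k x) 0 i - x 0 i| <= k.+1%:R^-1.
Proof.
rewrite !mxE.
have k0 : 0 < k.+1%:R :> R by [].
set K := k.+1%:R in k0 *; set y := (Num.floor _)%:~R.
have -> : y / K - x 0 i = (y - x 0 i * K) / K by field; rewrite gt_eqF.
rewrite normrM normfV [X in _ / X]gtr0_norm// ler_pdivrMr// mulVf ?gt_eqF//.
rewrite ler_norml.
have := floor_le (x 0 i * K).
have := floorD1_gt (x 0 i * K); rewrite intrD -/y; lra.
Qed.

Lemma rV_norm_le m (x : 'rV[R]_m) e : 0 <= e -> (forall i, `|x 0 i| <= e) -> `|x| <= e.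
Proof.
move=> e0 H; rewrite [leLHS]/Num.Def.normr /= mx_normrE; apply/bigmax_leP; split => //.
by move=> [i j] _ /=; rewrite ord1.
Qed.

Lemma cvg_grid m (x : 'rV[R]_m) : (fun k => grid k (cell k x)) @ \oo --> x.
Proof.
apply/cvgrPdist_le => e e0; near=> k; rewrite distrC.
apply: rV_norm_le => [|i]; first exact: ltW.
have := cell_dist k x i; rewrite !mxE => /le_trans; apply.
by apply/ltW; near: k; exact: (near_infty_natSinv_lt (PosNum e0)).
Unshelve. all: by end_near.
Qed.

Lemma measurable_countable_comp (A : countType) (c : T -> A) (G : A -> T -> R) :
  (forall a, measurable [set w | c w = a]) ->
  (forall a, measurable_fun setT (G a)) -> measurable_fun setT (fun w => G (c w) w).
Proof.
move=> mc mG _ B mB; rewrite setTI.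
have -> : (fun w => G (c w) w) @^-1` B =
    \bigcup_a ([set w | c w = a] `&` (G a @^-1` B)).
  apply/seteqP; split => w /=; first by move=> H; exists (c w).
  by move=> [a _ [<-]].
apply: countable_bigcupT_measurable => // a; apply: measurableI => //.
by rewrite -[X in measurable X]setTI; exact: mG.
Qed.

(* [F] is only separately measurable and continuous: approximate [X] by the
   countably many grid points. *)
Lemma caratheodory m (F : 'rV[R]_m -> T -> R) (X : T -> 'rV[R]_m) :
  (forall x, measurable_fun setT (F x)) -> (forall w, continuous (F ^~ w)) ->
  random_vector X -> measurable_fun setT (fun w => F (X w) w).
Proof.
move=> mF cF mX.
apply: (measurable_fun_cvg (h := fun k w => F (grid k (cell k (X w))) w)) => //.
  move=> k; apply: (measurable_countable_comp (G := fun a => F (grid k a))) => // a.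
  exact: measurable_cell.
by move=> w _; exact: (cvg_comp _ _ (@cvg_grid _ (X w)) (cF w (X w))).
Qed.

Lemma measurable_continuous_rV m (F : 'rV[R]_m -> R) (X : T -> 'rV[R]_m) :
  continuous F -> random_vector X -> measurable_fun setT (F \o X).
Proof.
by move=> cF; apply: (caratheodory (F := fun x _ => F x)) => [x|w]; [exact: measurable_cst|].
Qed.

Lemma random_vector_cst m (x : 'rV[R]_m) : random_vector (fun _ : T => x).
Proof. by move=> i; exact: measurable_cst. Qed.

Lemma random_vectorD m (X Y : T -> 'rV[R]_m) : random_vector X -> random_vector Y ->
  random_vector (fun w => X w + Y w).
Proof.
move=> mX mY i; apply: (eq_measurable_fun (fun w => X w 0 i + Y w 0 i)).
  by move=> w _; rewrite mxE.
exact: measurable_funD.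
Qed.

Lemma random_vectorZ m a (X : T -> 'rV[R]_m) : random_vector X ->
  random_vector (fun w => a *: X w).
Proof.
move=> mX i; apply: (eq_measurable_fun (fun w => a * X w 0 i)).
  by move=> w _; rewrite mxE.
exact: (measurable_funM (measurable_cst _) (mX i)).
Qed.

Lemma random_vectorB m (X Y : T -> 'rV[R]_m) : random_vector X -> random_vector Y ->
  random_vector (fun w => X w - Y w).
Proof.
move=> mX mY i; apply: (eq_measurable_fun (fun w => X w 0 i - Y w 0 i)).
  by move=> w _; rewrite !mxE.
exact: measurable_funB.
Qed.

Lemma measurable_dotv m (X Y : T -> 'rV[R]_m) : random_vector X -> random_vector Y ->
  measurable_fun setT (fun w => dotv (X w) (Y w)).
Proof.
by move=> mX mY; apply: measurable_sum => i; exact: measurable_funM.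
Qed.

Lemma measurable_enorm m (X : T -> 'rV[R]_m) : random_vector X ->
  measurable_fun setT (fun w => enorm (X w)).
Proof.
move=> mX; apply: (measurable_continuous_rV (F := @enorm R m)) => //.
move=> x; apply: (@continuous_enorm R m _ id); exact: cvg_id.
Qed.

(** The derivative is the limit of the difference quotients with step [1 / (k + 1)], and each of
    these is measurable by [caratheodory]. *)
Lemma measurable_directional m (F : 'rV[R]_m -> T -> R) (X : T -> 'rV[R]_m) v :
  (forall x, measurable_fun setT (F x)) -> (forall w x, differentiable (F ^~ w) x) ->
  random_vector X -> measurable_fun setT (fun w => 'D_v (F ^~ w) (X w)).
Proof.
move=> mF dF mX.
have cF w : continuous (F ^~ w) by move=> x; exact: differentiable_continuous.
apply: (measurable_fun_cvg (h := fun k w => k.+1%:R * (F (k.+1%:R^-1 *: v + X w) w - F (X w) w))) => //.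
  move=> k; apply: measurable_funM; first exact: measurable_cst.
  apply: measurable_funB; apply: caratheodory => //.
  by apply: random_vectorD => //; exact: random_vector_cst.
move=> w _.
pose q (h : R) : R := h^-1 * (F (h *: v + X w) w - F (X w) w).
have D : q h @[h --> 0^'] --> 'D_v (F ^~ w) (X w).
  exact: (@diff_derivable _ _ _ (F ^~ w) (X w) v (dF w (X w))).
have h0 : (forall k, k.+1%:R^-1 != 0 :> R) /\ k.+1%:R^-1 @[k --> \oo] --> (0 : R).
  by split => //; exact: cvg_harmonic.
have := (cvgr_dnbhsP q 0 _).1 D (fun k => k.+1%:R^-1) h0.
by rewrite /q; under eq_fun do rewrite invrK.
Qed.

Lemma random_vector_grad m (F : 'rV[R]_m -> T -> R) (X : T -> 'rV[R]_m) :
  (forall x, measurable_fun setT (F x)) -> (forall w x, differentiable (F ^~ w) x) ->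
  random_vector X -> random_vector (fun w => grad (F ^~ w) (X w)).
Proof.
move=> mF dF mX i.
apply: (eq_measurable_fun (fun w => 'D_(delta_mx 0 i) (F ^~ w) (X w))).
  by move=> w _; rewrite mxE.
exact: measurable_directional.
Qed.

End Caratheodory.

(** * Measurable selection *)

Section Selection.
Context {R : realType} {d : measure_display} {T : measurableType d}.

Lemma cell_nbhs p (N : set 'rV[R]_p) (x : 'rV[R]_p) : nbhs x N ->
  exists k, forall y, cell k y = cell k x -> N y.
Proof.
move=> /nbhs_ballP[e /= e0 xN].
have [k ke] : exists k, 2 * k.+1%:R^-1 < e.
  have : 2 * k.+1%:R^-1 @[k --> \oo] --> (2 * 0 : R).
    by apply: cvgM; [exact: cvg_cst|exact: cvg_harmonic].
  rewrite mulr0 => /cvgrPdist_lt/(_ e e0) /(@filter_ex _ \oo)[k].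
  by rewrite sub0r normrN ger0_norm ?mulr_ge0// => ?; exists k.
exists k => y yx; apply: xN; rewrite -ball_normE /ball_ /=.
apply: le_lt_trans ke; apply: rV_norm_le => [|i]; first by rewrite mulr_ge0.
have := cell_dist k x i; have := cell_dist k y i; rewrite yx !mxE.
rewrite [X in X <= _ -> _]distrC => H1 H2.
set a := (_ / _) in H1 H2.
have -> : x 0 i - y 0 i = - (a - x 0 i) + - (y 0 i - a) by ring.
by apply: le_trans (ler_normD _ _) _; rewrite !normrN mulr_natl mulr2n lerD// distrC.
Qed.

(** An event that is an open condition on the parameter [theta] is the union of the countably many
    grid cells of [theta] that force it. *)
Lemma measurable_nbhs p (theta : T -> 'rV[R]_p) (A : set T) : random_vector theta ->
  (forall w, A w -> \forall x \near theta w, forall w', theta w' = x -> A w') ->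
  measurable A.
Proof.
move=> mt nA.
pose good (ka : nat * 'rV[int]_p) := forall w, cell ka.1 (theta w) = ka.2 -> A w.
have -> : A = \bigcup_(ka in good) [set w | cell ka.1 (theta w) = ka.2].
  apply/seteqP; split => w; last by move=> [ka gka] /gka.
  move=> Aw; have [k kP] := cell_nbhs (nA w Aw).
  exists (k, cell k (theta w)) => // w' /= /kP; exact.
rewrite bigcup_mkcond; apply: countable_bigcupT_measurable => // ka.
by case: ifP => // _; exact: measurable_cell.
Qed.

Variable m : nat.
Implicit Types S : T -> set 'rV[R]_m.

Definition hits S (K : set 'rV[R]_m) := [set w | S w `&` K !=set0].

(** Measurability of a set-valued map through its hitting sets. Compact test sets are the ones that
    closedness of the graph can handle; closed ones follow in [hits_closed], the space being a
    countable union of compact boxes. *)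
Definition measurable_multifun S := forall K, compact K -> measurable (hits S K).

Definition compact_multifun S := forall w, compact (S w) /\ S w !=set0.

(** The second hypothesis says that the graph is closed as a function of the parameter [theta]. By
    compactness of [K], the parameters at which [K] is missed then form an open condition. *)
Lemma closed_graph_measurable p (theta : T -> 'rV[R]_p) S : random_vector theta ->
  (forall w y, ~ S w y -> \forall y' \near y & x' \near theta w,
     forall w', theta w' = x' -> ~ S w' y') ->
  measurable_multifun S.
Proof.
move=> mt H K cK; rewrite -[hits S K]setCK; apply: measurableC.
apply: (measurable_nbhs mt) => w Sw.
have nS y : K y -> \forall y' \near y & x' \near theta w,
     forall w', theta w' = x' -> ~ S w' y'.
  by move=> Ky; apply: H => Sy; apply: Sw; exists y.
have := (compact_near_coveringP K).1 cK _ (nbhs (theta w))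
  (fun x' y' => forall w', theta w' = x' -> ~ S w' y')
  (nbhs_filter (theta w)) nS.
apply: filterS => x Hx w' tw' [y [Sy Ky]].
exact: (Hx y Ky w' tw' Sy).
Qed.

Lemma closed_coord_le (i : 'I_m) (a : R) : closed [set y : 'rV[R]_m | y 0 i <= a].
Proof.
have /continuous_closedP := @coord_continuous R 1 m 0 i.
by move=> /(_ _ (@closed_le R a)).
Qed.

Definition boxN (N : nat) : set 'rV[R]_m := [set y | forall i, `[- N%:R, N%:R]%classic (y 0 i)].

Lemma compact_boxN N : compact (boxN N).
Proof.
apply: (@rV_compact R m (fun=> `[- N%:R, N%:R]%classic)) => i.
exact: segment_compact.
Qed.

Lemma boxN_cover (y : 'rV[R]_m) : exists N, boxN N y.
Proof.
exists (Num.bound `|y|) => i; rewrite /= in_itv /= -ler_norml.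
apply: le_trans (ltW (archi_boundP (normr_ge0 y))).
rewrite [leRHS]/Num.Def.normr /= mx_normrE; apply/bigmax_geP; right => /=.
by exists (0, i).
Qed.

Lemma hits_closed S (C : set 'rV[R]_m) : measurable_multifun S -> closed C ->
  measurable (hits S C).
Proof.
move=> mS cC.
have -> : hits S C = \bigcup_N hits S (boxN N `&` C).
  apply/seteqP; split => w.
    by move=> [y [Sy Cy]]; have [N yN] := boxN_cover y; exists N => //; exists y.
  by move=> [N _ [y [Sy [_ Cy]]]]; exists y.
apply: bigcupT_measurable => N; apply: mS.
apply: compact_closedI => //; exact: compact_boxN.
Qed.

Definition argmin_coord S (i : 'I_m) w : set 'rV[R]_m :=
  S w `&` [set y | forall y', S w y' -> y 0 i <= y' 0 i].

Lemma argmin_coord_compact S i : compact_multifun S ->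
  compact_multifun (argmin_coord S i).
Proof.
move=> cS w; have [cw nw] := cS w; split.
  apply: compact_closedI => //.
  suff : closed (\bigcap_(y' in S w) [set y : 'rV[R]_m | y 0 i <= y' 0 i]) by [].
  by apply: closed_bigI => y' _; exact: closed_coord_le.
have [|c cS' Hc] := compact_EVT_min (f := fun y : 'rV[R]_m => y 0 i) nw cw.
  by apply: continuous_subspaceT => y; exact: coord_continuous.
by exists c; split; [exact: set_mem|move=> y' /mem_set; exact: Hc].
Qed.

(** The minimizers miss [K] exactly when the minimum over [S w] is below the minimum over the part
    of [S w] in [K]. A rational [q] between the two witnesses this: [S w] meets the half-space
    [H q], but not within [K]. *)
Lemma argmin_coord_measurable S i : compact_multifun S -> measurable_multifun S ->
  measurable_multifun (argmin_coord S i).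
Proof.
move=> cS mS K cK; rewrite -[hits _ K]setCK; apply: measurableC.
pose H q := [set y : 'rV[R]_m | y 0 i <= ratr q].
have -> : ~` hits (argmin_coord S i) K =
    \bigcup_(q : rat) (hits S (H q) `&` ~` hits S (K `&` H q)).
  apply/seteqP; split => w.
    move=> nh; have [_ [a [Sa ma]]] := argmin_coord_compact i cS w.
    have [SK0|SK0] := eqVneq (S w `&` K) set0.
      have [q aq] : exists q : rat, a 0 i <= ratr q.
        exists (Num.floor (a 0 i) + 1)%:~R; rewrite ratr_int ltW//.
        exact: floorD1_gt.
      exists q => //; split; first by exists a.
      move=> [y [Sy [Ky _]]]; have : (S w `&` K) y by [].
      by rewrite SK0.
    have [|b bSK Hb] := compact_EVT_min (f := fun y : 'rV[R]_m => y 0 i)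
        ((set0P _).1 SK0) (compact_closedI (cS w).1 (compact_closed (@norm_hausdorff _ _) cK)).
      by apply: continuous_subspaceT => y; exact: coord_continuous.
    have [Sb Kb] := set_mem bSK.
    have ab : a 0 i < b 0 i.
      rewrite ltNge; apply/negP => ba; apply: nh; exists b; split => //; split => //.
      by move=> y' Sy'; apply: le_trans ba _; exact: ma.
    have [q] := rat_in_itvoo ab; rewrite in_itv /= => /andP[aq qb].
    exists q => //; split; first by exists a; split => //; exact: ltW.
    move=> [y [Sy [Ky yq]]].
    have : b 0 i <= y 0 i by apply: Hb; apply/mem_set.
    by rewrite leNgt (le_lt_trans yq qb).
  move=> [q _ [[a [Sa aq]] nh]] [y [[Sy my] Ky]]; apply: nh; exists y; split => //.
  by split => //; apply: le_trans (my a Sa) aq.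
apply: bigcupT_measurable_rat => q; apply: measurableI.
  by apply: hits_closed => //; exact: closed_coord_le.
apply: measurableC; apply: mS; apply: compact_closedI => //; exact: closed_coord_le.
Qed.

(* The lexicographic minimum is a measurable selection. *)
Lemma measurable_selection S : compact_multifun S -> measurable_multifun S ->
  exists2 s : T -> 'rV[R]_m, random_vector s & forall w, S w (s w).
Proof.
move=> cS mS.
have [S' [cS' mS' SS' uS']] : exists S', [/\ compact_multifun S', measurable_multifun S',
    forall w, S' w `<=` S w &
    forall w y y', S' w y -> S' w y' -> forall i, i \in enum 'I_m -> y 0 i = y' 0 i].
  elim: (enum 'I_m) => [|i l [S' [cS' mS' SS' uS']]]; first by exists S; split => // w y.
  exists (argmin_coord S' i); split.
  - exact: argmin_coord_compact.
  - exact: argmin_coord_measurable.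
  - by move=> w y [Sy _]; exact: SS'.
  - move=> w y y' [Sy my] [Sy' my'] j; rewrite inE => /orP[/eqP ->|jl].
      by apply/eqP; rewrite eq_le my// my'.
    exact: (uS' w y y' Sy Sy' j jl).
have /choice[s sS'] : forall w, exists y, S' w y by move=> w; have [_] := cS' w.
exists s => [i|w]; last exact/SS'/sS'.
apply: (measurability _ (RGenOInfty.measurableE R)) => _ [_] [a] -> <-; rewrite setTI.
(* After minimization in all coordinates [S' w] is a single point, so its coordinate exceeds [a]
   exactly when [S' w] misses a closed half-space. *)
have -> : (fun w => s w 0 i) @^-1` `]a, +oo[%classic = ~` hits S' [set y | y 0 i <= a].
  apply/seteqP; split => w /=; rewrite in_itv /= andbT.
    move=> sa [y [Sy ya]]; move: sa; rewrite (uS' w (s w) y) ?mem_enum//.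
    by rewrite ltNge ya.
  by move=> nh; rewrite ltNge; apply/negP => sa; apply: nh; exists (s w).
apply: measurableC; apply: hits_closed => //; exact: closed_coord_le.
Qed.

End Selection.

(** * Increments and integrals of derivatives *)

Section Increment.
Context {R : realType}.
Local Notation mu := (@lebesgue_measure R).

Lemma lebesgue_measure_cc (a b : R) : a <= b -> mu `[a, b]%classic = (b - a)%:E.
Proof.
move=> ab; rewrite lebesgue_measure_itv /= lte_fin.
case: ltP => [//|ba]; by rewrite (@le_anti _ _ a b) ?ab ?ba// subrr.
Qed.

Lemma lebesgue_measure_oc (a b : R) : a <= b -> mu `]a, b]%classic = (b - a)%:E.
Proof.
move=> ab; rewrite lebesgue_measure_itv /= lte_fin.
case: ltP => [//|ba]; by rewrite (@le_anti _ _ a b) ?ab ?ba// subrr.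
Qed.

(** Continuous induction on the interval. The last hypothesis is what lower semicontinuity of [g]
    would give: near each [x], the majorant stays above the derivative at [x]. The slack [eta] pays
    for the error of the difference quotients, and the supremum of the points reached so far cannot
    stop before [b]. *)
Lemma increment_le_majorant (phi : R -> R) (g : R -> \bar R) (a b : R) : a <= b ->
  (forall x, derivable phi x 1) -> measurable_fun setT g -> (forall x, 0 <= g x)%E ->
  (forall x, a <= x <= b -> \forall y \near x, ((derive1 phi x)%:E <= g y)%E) ->
  ((phi b - phi a)%:E <= \int[mu]_(x in `[a, b]) g x)%E.
Proof.
move=> ab dphi mg g0 gphi.
have cphi : continuous phi.
  by move=> x; apply/differentiable_continuous/derivable1_diffP.
pose J x := (\int[mu]_(y in `[a, x]) g y)%E.
suff key eta : 0 < eta -> ((phi b - phi a)%:E <= J b + (eta * (b - a))%:E)%E.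
  apply/lee_addgt0Pr => e e0.
  have ba : 0 < b - a + 1 by rewrite ltr_wpDl// subr_ge0.
  apply: le_trans (key (e / (b - a + 1)) _) _; first exact: divr_gt0.
  rewrite leeD2l// lee_fin mulrAC ler_pdivrMr// ler_pM2l//; lra.
move=> eta0.
pose H x := ((phi x - phi a)%:E <= J x + (eta * (x - a))%:E)%E.
pose S := [set x | a <= x <= b /\ H x].
have Ja : 0%E = J a by rewrite /J set_itv1 integral_set1.
have Sa : S a by split; rewrite ?lexx//= /H -Ja !subrr mulr0 adde0.
have Sb : has_sup S by split; [exists a|exists b => x [/andP[]]].
pose s := sup S.
have sa : a <= s by exact: sup_upper_bound.
have sb : s <= b by apply: ge_sup; [exists a|move=> x [/andP[]]].
have Jle x y : x <= y -> (J x <= J y)%E.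
  move=> xy; apply: ge0_subset_integral => //.
  - exact: measurable_funTS.
  - by move=> z /=; rewrite !in_itv /= => /andP[-> /le_trans]; exact.
(* The supremum is itself reached: [phi] is continuous and the integral is monotone in its upper
   bound. *)
have Hs : H s.
  apply/lee_addgt0Pr => e e0.
  have /cvgrPdist_le/(_ e e0) [r /= r0 Hr] := cphi s.
  have [x [xab Hx] sx] := sup_adherent r0 Sb.
  have xs : x <= s by apply: sup_upper_bound.
  have : `|phi s - phi x| <= e by apply: Hr => /=; rewrite ger0_norm ?subr_ge0//; rewrite -/s in sx; lra.
  rewrite ler_norml => /andP[_ sxe].
  apply: (@le_trans _ _ ((phi x - phi a)%:E + e%:E)%E).
    by rewrite -EFinD lee_fin; lra.
  rewrite leeD2r//; apply: le_trans Hx _.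
  by rewrite leeD ?Jle// lee_fin ler_pM2l//; lra.
have [<-//|sNb] := eqVneq s b.
have {sNb}sltb : s < b by rewrite lt_neqAle sNb.
have s01 : a <= s <= b by rewrite sa ltW.
have [r /= r0 Hr] : \forall h \near (0 : R)^',
    `|'D_1 phi s - h^-1 *: (phi (h *: 1 + s) - phi s)| < eta.
  by have /cvgrPdist_lt := dphi s; apply.
have [r' /= r'0 Hr'] := gphi s s01.
pose y := s + Num.min (Num.min r r') (b - s) / 2.
have [ys yr yr' yb] : [/\ s < y, y - s < r, y - s < r' & y <= b].
  have : 0 < Num.min (Num.min r r') (b - s) by rewrite !lt_min r0 r'0 subr_gt0.
  have : Num.min (Num.min r r') (b - s) <= Num.min r r' by rewrite ge_min lexx.
  have : Num.min r r' <= r by rewrite ge_min lexx.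
  have : Num.min r r' <= r' by rewrite ge_min lexx orbT.
  have : Num.min (Num.min r r') (b - s) <= b - s by rewrite ge_min lexx orbT.
  rewrite /y; set q := Num.min _ (b - s) => *; split; lra.
have ys0 : 0 < y - s by rewrite subr_gt0.
suff : S y by move/(sup_upper_bound Sb); rewrite leNgt ys.
split; first by rewrite yb andbT (le_trans sa (ltW ys)).
have incr : phi y - phi s <= (derive1 phi s + eta) * (y - s).
  have := Hr (y - s); rewrite /= sub0r normrN gtr0_norm// => /(_ yr (lt0r_neq0 ys0)).
  have -> : (y - s) *: 1 + s = y by rewrite [(y - s) *: 1]mulr1 subrK.
  rewrite -derive1E distrC => /ltW; rewrite ler_norml => /andP[_].
  rewrite lerBlDl -(ler_pM2l ys0) => H1; apply: le_trans (_ : _ <= _) _; last first.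
    by rewrite mulrC; exact: H1.
  by rewrite [_ *: _]mulrC mulrCA divff ?mulr1 ?gt_eqF.
have JJ : J y = (J s + \int[mu]_(x in `]s, y]) g x)%E.
  rewrite /J -ge0_integral_setU //=.
  - by congr (integral _ _ _); rewrite -itv_bndbnd_setU// bnd_simp ?ltW.
  - exact: measurable_funTS.
  - apply/disj_setPS => x [] /=; rewrite !in_itv /= => /andP[_ xs] /andP[sx _].
    by move: sx; rewrite ltNge xs.
(* A nonpositive derivative is dominated by [g >= 0]; a positive one is integrated as a constant
   below [g]. *)
have step : ((derive1 phi s * (y - s))%:E <= \int[mu]_(x in `]s, y]) g x)%E.
  have [d0|d0] := leP (derive1 phi s) 0.
    apply: (@le_trans _ _ 0%E); last exact: integral_ge0.
    by rewrite lee_fin mulr_le0_ge0 // ltW.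
  rewrite EFinM -(lebesgue_measure_oc (ltW ys)) -integral_cst//=.
  apply: ge0_le_integral => //=.
  - by move=> x _; rewrite lee_fin ltW.
  - exact: measurable_funTS.
  - move=> x; rewrite in_itv /= => /andP[sx xy]; apply: Hr' => /=.
    by rewrite distrC gtr0_norm ?subr_gt0//; lra.
rewrite /H JJ; apply: (@le_trans _ _ ((phi s - phi a)%:E + ((derive1 phi s + eta) * (y - s))%:E)%E).
  by rewrite -EFinD lee_fin; lra.
rewrite (_ : (eta * (y - a))%:E = ((eta * (s - a))%:E + (eta * (y - s))%:E)%E); last first.
  by rewrite -EFinD -mulrDr; congr (_ * _)%:E; ring.
by rewrite mulrDl [X in (_ + X <= _)%E]EFinD [leRHS]addeACA; apply: leeD => //; rewrite leeD2r.
Qed.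

(** A lower layer-cake sum with layers of height [delta]. The second bound [n * delta] is there for
    the induction: a new layer is counted only if [p] exceeds the total height of all of them. *)
Lemma level_sum_le (p delta : R) n : 0 <= p -> 0 < delta ->
  \sum_(0 <= k < n) delta * (if k.+1%:R * delta < p then 1 else 0) <= Num.min p (n%:R * delta).
Proof.
move=> p0 d0; elim: n => [|n IH].
  by rewrite big_geq// mul0r le_min p0 lexx.
rewrite big_nat_recr//= le_min; move: IH; rewrite le_min => /andP[IH1 IH2].
have E : n.+1%:R * delta = n%:R * delta + delta by rewrite -natr1 mulrDl mul1r.
by case: ltP; rewrite E => H; apply/andP; split; lra.
Qed.

(** Layer-cake construction: [p] is at most [delta] plus [delta] times the number of levels it
    exceeds. Each level set [A k] is enlarged to an open [W k] of excess measure below [2^-(k+1)],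
    so the enlargements cost [delta] in total and the rounding costs [delta * (b - a)]. *)
Lemma lsc_majorant (p : R -> R) (a b delta : R) : a <= b -> measurable_fun setT p ->
  (forall x, 0 <= p x) -> (\int[mu]_(x in `[a, b]) (p x)%:E < +oo)%E -> 0 < delta ->
  exists g : R -> \bar R, [/\ measurable_fun setT g, forall x, (0 <= g x)%E,
    forall x, a <= x <= b -> \forall y \near x, ((p x)%:E <= g y)%E &
    (\int[mu]_(x in `[a, b]) g x <=
       \int[mu]_(x in `[a, b]) (p x)%:E + (delta * (b - a) + delta)%:E)%E].
Proof.
move=> ab mp p0 pfin d0.
pose A k := `[a, b]%classic `&` [set x | k.+1%:R * delta < p x].
have mA k : measurable (A k).
  apply: measurableI => //.
  rewrite -[X in measurable X]setTI.
  have -> : [set x | k.+1%:R * delta < p x] = p @^-1` `]k.+1%:R * delta, +oo[%classic.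
    by apply/seteqP; split => x /=; rewrite in_itv /= andbT.
  exact: mp.
have Afin k : (mu (A k) < +oo)%E.
  apply: (@le_lt_trans _ _ (mu `[a, b]%classic)).
    apply: le_measure; rewrite ?inE; [exact: mA|exact: measurable_itv|by move=> x []].
  by rewrite lebesgue_measure_cc// ltry.
have /choice[W HW] : forall k, exists U : set R,
    [/\ open U, A k `<=` U & (mu (U `\` A k) < (1 / (2 ^ k.+1)%:R)%:E)%E].
  move=> k; apply: (lebesgue_regularity_outer (mA k) (Afin k)).
  by apply: divr_gt0; rewrite ?ltr0n ?expn_gt0.
have mO k : measurable (W k) by apply: open_measurable; have [] := HW k.
pose g x := (delta%:E + \sum_(0 <= k <oo) (delta * \1_(W k) x)%:E)%E.
have g0 x : (0 <= \sum_(0 <= k <oo) (delta * \1_(W k) x)%:E)%E.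
  by apply: nneseries_ge0 => k _ _; rewrite lee_fin mulr_ge0// ltW.
have mind (U : set R) : measurable U ->
    measurable_fun setT (fun x => (delta * \1_U x)%:E).
  move=> mU; apply/measurable_EFinP; apply: measurable_funM; first exact: measurable_cst.
  exact: measurable_indic.
have mser : measurable_fun setT (fun x => \sum_(0 <= k <oo) (delta * \1_(W k) x)%:E)%E.
  apply: ge0_emeasurable_sum => [k x _ _|k _]; last exact: mind.
  by rewrite lee_fin mulr_ge0// ltW.
have iind (U : set R) : measurable U ->
    (\int[mu]_(x in `[a, b]) (delta * \1_U x)%:E = delta%:E * mu (U `&` `[a, b]%classic))%E.
  move=> mU; under eq_integral do rewrite EFinM.
  rewrite ge0_integralZl_EFin ?integral_indic ?(ltW d0)//.
    by apply/measurable_EFinP; apply: measurable_funTS; exact: measurable_indic.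
exists g; split.
- by apply: emeasurable_funD => //; exact: measurable_cst.
- by move=> x; rewrite adde_ge0// lee_fin ltW.
- move=> x xab.
  have exK : exists K, p x <= K.+1%:R * delta.
    exists (Num.bound (p x / delta)).
    have := archi_boundP (divr_ge0 (p0 x) (ltW d0)).
    by rewrite ltr_pdivrMr// => /ltW/le_trans; apply; rewrite ler_pM2r// ler_nat.
  (* By minimality [x] lies in the level sets [A k] for [k < K], hence in finitely many open [W k],
     and a whole neighbourhood of [x] stays in all of them. *)
  have [K pK Kmin] := ex_minnP exK.
  have inO k : (k < K)%N -> W k x.
    move=> kK; have [_ AO _] := HW k; apply: AO; split => //=.
    by rewrite ltNge; apply/negP => /Kmin; rewrite leqNgt kK.
  have nO : \forall y \near x, forall k : 'I_K, W k y.
    apply: (@filter_forall _ 'I_K (fun k y => W k y) (nbhs x) _) => k; have [oO _ _] := HW k.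
    by apply: open_nbhs_nbhs; split => //; exact: inO.
  apply: filterS nO => y Oy.
  apply: (@le_trans _ _ (delta%:E + \sum_(0 <= k < K) (delta * \1_(W k) y)%:E)%E).
    rewrite big_mkord sumEFin -EFinD lee_fin (le_trans pK)// -natr1 mulrDl mul1r addrC lerD2l.
    rewrite (eq_bigr (fun=> delta)) => [|k _].
      by rewrite sumr_const card_ord mulr_natl.
    by rewrite indicE mem_set ?mulr1//; exact: Oy.
  rewrite leeD2l//; apply: nneseries_lim_ge => k _ _.
  by rewrite lee_fin mulr_ge0// ltW.
rewrite ge0_integralD//=; last 2 first.
- by move=> x _; rewrite lee_fin ltW.
- exact: measurable_funTS.
rewrite integral_cst// [X in (delta%:E * X)%E](lebesgue_measure_cc ab) -EFinM.
rewrite integral_nneseries//; last 2 first.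
- by move=> k; apply: measurable_funTS; exact: mind.
- by move=> k x _; rewrite lee_fin mulr_ge0// ltW.
rewrite EFinD addeCA leeD2l//.
apply: (@le_trans _ _ (\sum_(0 <= k <oo) (delta%:E * mu (A k) + (delta / (2 ^ k.+1)%:R)%:E))%E).
  apply: lee_nneseries => [k _ _|k _].
    by apply: integral_ge0 => x _; rewrite lee_fin mulr_ge0// ltW.
  rewrite iind// EFinM -muleDr; last 2 first.
  - by [].
  - by rewrite ge0_adde_def ?inE// lee_fin.
  rewrite lee_pmul2l//.
  have [oO AO OA] := HW k.
  apply: (@le_trans _ _ (mu (W k))); first by
    apply: le_measure; [apply: mem_set; apply: measurableI; [exact: mO|exact: measurable_itv]|by apply: mem_set; exact: mO|by move=> x []].
  rewrite -(setDUK AO) measureU//; last 2 first.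
  - by apply: measurableD; [exact: mO|exact: mA].
  - exact: setDIK.
  by rewrite div1r in OA; rewrite leeD2l// ltW.
  exact: mA.
apply: le_trans (@epsilon_trick R (fun k => delta%:E * mu (A k))%E delta xpredT _ (ltW d0)) _.

  by move=> k; rewrite mule_ge0// lee_fin ltW.
rewrite leeD2r//.
(* The measures of the level sets are turned back into an integral, where [level_sum_le] bounds the
   partial sums of the layers by [p x]. *)
under eq_eseriesr => k _.
  have <- : A k `&` `[a, b]%classic = A k by apply/setIidl; exact: subIsetl.
  rewrite -iind//; over.
rewrite -integral_nneseries//; last 2 first.
- by move=> k; apply: measurable_funTS; exact: mind.
- by move=> k x _; rewrite lee_fin mulr_ge0// ltW.
apply: ge0_le_integral => //=.
- by move=> x _; apply: nneseries_ge0 => k _ _; rewrite lee_fin mulr_ge0// ltW.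
- apply: measurable_funTS; apply: ge0_emeasurable_sum => [k x _ _|k _]; last exact: mind.
  by rewrite lee_fin mulr_ge0// ltW.
- by apply: measurable_funTS; apply/measurable_EFinP.
move=> x xab; apply: lime_le.
  by apply: is_cvg_nneseries => k _ _; rewrite lee_fin mulr_ge0// ltW.
apply: nearW => n; rewrite sumEFin lee_fin.
apply: (@le_trans _ _ (Num.min (p x) (n%:R * delta))); last by rewrite ge_min lexx.
apply: le_trans (level_sum_le n (p0 x) d0); rewrite le_eqVlt; apply/orP; left; apply/eqP.
apply: eq_bigr => k _; rewrite indicE; congr (delta * _).
case: ltP => H; first by rewrite mem_set.
by rewrite memNset// => -[_] /=; rewrite ltNge H.
Qed.

(* The derivative is only known to be measurable, not continuous, so it is
   majorized by lower semicontinuous functions, as in the Vitali-Caratheodory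
   theorem. *)
Lemma increment_le_integral (phi : R -> R) (a b : R) : a <= b ->
  (forall x, derivable phi x 1) ->
  ((phi b - phi a)%:E <= \int[mu]_(x in `[a, b]) `|derive1 phi x|%:E)%E.
Proof.
move=> ab dphi.
have md : measurable_fun setT (derive1 phi : R -> R).
  apply: (@measurable_fun_cvg _ _ R setT (fun k (x : R) => k.+1%:R * (phi (k.+1%:R^-1 + x) - phi x))) => //=.
    have mphi : measurable_fun setT phi.
      apply: continuous_measurable_fun => x.
      by apply/differentiable_continuous/derivable1_diffP.
    move=> k; apply: measurable_funM; first exact: measurable_cst.
    apply: measurable_funB => //; apply: (measurableT_comp mphi).
    by apply: measurable_funD => //; exact: measurable_cst.
  move=> x _; pose q (h : R) : R := h^-1 * (phi (h + x) - phi x).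
  have D : q h @[h --> 0^'] --> derive1 phi x.
    rewrite derive1E; have := dphi x; rewrite /derivable /derive /q.
    rewrite (_ : (fun h => _) = (fun h : R => h^-1 * (phi (h + x) - phi x))) //.
    by apply/funext => h /=; rewrite [h *: 1]mulr1.
  have h0 : (forall k, k.+1%:R^-1 != 0 :> R) /\ k.+1%:R^-1 @[k --> \oo] --> (0 : R).
    by split => //; exact: cvg_harmonic.
  have := (cvgr_dnbhsP q 0 _).1 D (fun k => k.+1%:R^-1) h0.
  by rewrite /q; under eq_fun do rewrite invrK.
have mp : measurable_fun setT (fun x => `|derive1 phi x|) by exact: measurableT_comp.
have [fin|] := ltP (\int[mu]_(x in `[a, b]) `|derive1 phi x|%:E)%E +oo%E; last first.
  by rewrite leye_eq => /eqP ->; rewrite leey.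
apply/lee_addgt0Pr => e e0.
have ba : 0 < b - a + 1 by rewrite ltr_wpDl// subr_ge0.
have d0 : 0 < e / (b - a + 1) by exact: divr_gt0.
have [g [mg g0 gp gint]] := lsc_majorant ab mp (fun x => normr_ge0 _) fin d0.
have -> : e = e / (b - a + 1) * (b - a) + e / (b - a + 1) by field; rewrite gt_eqF.
apply: le_trans gint; apply: increment_le_majorant => // x xab.
apply: filterS (gp x xab) => y; apply: le_trans.
by rewrite lee_fin ler_norm.
Qed.

End Increment.

(** * Expectations *)

Section Expectation.
Context {R : realType} {d : measure_display} {T : measurableType d}.
Variable P : probability T R.
Implicit Types X Y : T -> R.

Definition Lone X := P.-integrable setT (EFin \o X).

Definition Ex X : R := Rintegral P setT X.

Lemma Lone_measurable X : Lone X -> measurable_fun setT X.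
Proof. by move=> /integrableP[/measurable_EFinP]. Qed.

Lemma expectationE X : Lone X -> 'E_P[X]%E = (Ex X)%:E.
Proof.
by move=> iX; rewrite unlock /Ex /Rintegral fineK//; exact: integrable_fin_num.
Qed.

Lemma LoneD X Y : Lone X -> Lone Y -> Lone (fun w => X w + Y w).
Proof. by move=> iX iY; exact: (integrableD measurableT iX iY). Qed.

Lemma LoneB X Y : Lone X -> Lone Y -> Lone (fun w => X w - Y w).
Proof. by move=> iX iY; exact: (integrableB measurableT iX iY). Qed.

Lemma LoneZ a X : Lone X -> Lone (fun w => a * X w).
Proof. by move=> iX; exact: (integrableZl measurableT a iX). Qed.

Lemma Lone_cst a : Lone (fun=> a).
Proof. exact: finite_measure_integrable_cst. Qed.

Lemma ExD X Y : Lone X -> Lone Y -> Ex (fun w => X w + Y w) = Ex X + Ex Y.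
Proof. by move=> iX iY; exact: RintegralD. Qed.

Lemma ExB X Y : Lone X -> Lone Y -> Ex (fun w => X w - Y w) = Ex X - Ex Y.
Proof. by move=> iX iY; exact: RintegralB. Qed.

Lemma ExZ a X : Lone X -> Ex (fun w => a * X w) = a * Ex X.
Proof. by move=> iX; exact: RintegralZl. Qed.

Lemma Ex_cst a : Ex (fun=> a) = a.
Proof. by rewrite /Ex Rintegral_cst// [X in fine X](@probability_setT _ _ _ P) mulr1. Qed.

Lemma Ex_ge0 X : (forall w, 0 <= X w) -> 0 <= Ex X.
Proof. by move=> X0; exact: Rintegral_ge0. Qed.

Lemma Ex_le X Y : Lone X -> Lone Y -> (forall w, X w <= Y w) -> Ex X <= Ex Y.
Proof. by move=> iX iY XY; apply: le_Rintegral. Qed.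

Lemma Lone_sum k (F : 'I_k -> T -> R) : (forall i, Lone (F i)) ->
  Lone (fun w => \sum_i F i w).
Proof.
elim: k F => [|k IH] F iF.
  by rewrite (_ : (fun _ => _) = (fun=> 0)) ; [exact: Lone_cst|apply/funext => w; rewrite big_ord0].
rewrite (_ : (fun _ => _) = (fun w => F ord0 w + \sum_(i < k) F (lift ord0 i) w)).
  by apply: LoneD => //; exact: IH.
by apply/funext => w; rewrite big_ord_recl.
Qed.

Lemma Ex_sum k (F : 'I_k -> T -> R) : (forall i, Lone (F i)) ->
  Ex (fun w => \sum_i F i w) = \sum_i Ex (F i).
Proof.
elim: k F => [|k IH] F iF.
  by rewrite big_ord0 (_ : (fun _ => _) = (fun=> 0)) ?Ex_cst//; apply/funext => w; rewrite big_ord0.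
rewrite big_ord_recl -IH// -ExD//; last exact: Lone_sum.
by congr Ex; apply/funext => w; rewrite big_ord_recl.
Qed.

Lemma Lone_le X Y : measurable_fun setT X -> Lone Y -> (forall w, `|X w| <= Y w) ->
  Lone X.
Proof.
move=> mX iY XY; apply: le_integrable iY => //; first exact/measurable_EFinP.
move=> w _; rewrite /= lee_fin; apply: le_trans (XY w) (ler_norm _).
Qed.

(** The hypotheses of the theorem bound extended-real expectations. For nonnegative variables a
    finite bound already contains integrability, so the argument can continue with real numbers. *)
Lemma Lone_expectation X c : measurable_fun setT X -> (forall w, 0 <= X w) ->
  ('E_P[X] <= c%:E)%E -> Lone X /\ Ex X <= c.
Proof.
move=> mX X0 Ec.
have iX : Lone X.
  apply/integrableP; split; first exact/measurable_EFinP.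
  rewrite (eq_integral (EFin \o X)) => [|w _]; last by rewrite /= ger0_norm.
  by move: Ec; rewrite unlock => /le_lt_trans; apply; rewrite ltry.
by split => //; move: Ec; rewrite expectationE.
Qed.

Lemma Ex_jensen X a : measurable_fun setT X -> (forall w, 0 <= X w) -> 0 <= a ->
  Lone (fun w => X w ^+ 2) -> Ex (fun w => X w ^+ 2) <= a ^+ 2 -> Lone X /\ Ex X <= a.
Proof.
move=> mX X0 a0 iX2 X2a.
have iX : Lone X.
  apply: (@Lone_le _ (fun w => 1 + X w ^+ 2)) => //.
    by apply: LoneD => //; exact: Lone_cst.
  move=> w; rewrite ger0_norm//; have := sqr_ge0 (X w - 1/2); rewrite sqrrB; lra.
split=> //.
(* AM-GM: [X <= X^2 / (2 b) + b / 2] for every [b > a]. *)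
apply/ler_addgt0Pr => e e0; set b := a + e.
have b0 : 0 < b by rewrite ltr_wpDl.
apply: (@le_trans _ _ (Ex (fun w => (2 * b)^-1 * X w ^+ 2 + b / 2))).
  apply: Ex_le => // [|w]; first by apply: LoneD; [exact: LoneZ|exact: Lone_cst].
  rewrite -(ler_pM2l (_ : 0 < 2 * b)) ?mulr_gt0//.
  have -> : 2 * b * ((2 * b)^-1 * X w ^+ 2 + b / 2) = X w ^+ 2 + b ^+ 2.
    by field; rewrite gt_eqF.
  by have := sqr_ge0 (X w - b); rewrite sqrrB; lra.
rewrite ExD; [|exact: LoneZ|exact: Lone_cst]; rewrite ExZ// Ex_cst.
rewrite -(ler_pM2l (_ : 0 < 2 * b)) ?mulr_gt0//.
have -> : 2 * b * ((2 * b)^-1 * Ex (fun w => X w ^+ 2) + b / 2) =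
    Ex (fun w => X w ^+ 2) + b ^+ 2 by field; rewrite gt_eqF.
have : a ^+ 2 <= b ^+ 2 by rewrite ler_pXn2r ?nnegrE ?(ltW b0)// /b; lra.
lra.
Qed.

Section Vectors.
Context {n : nat}.
Implicit Types (Z W : T -> 'rV[R]_n) (v a : 'rV[R]_n).

Definition Ltwo Z := random_vector Z /\ Lone (fun w => enorm (Z w) ^+ 2).

Definition mean Z : 'rV[R]_n := \row_i Ex (fun w => Z w 0 i).

Lemma Lone_coord Z i : Ltwo Z -> Lone (fun w => Z w 0 i).
Proof.
move=> [mZ iZ]; apply: (@Lone_le _ (fun w => 1 + enorm (Z w) ^+ 2)) => //.
  by apply: LoneD => //; exact: Lone_cst.
move=> w; apply: le_trans (coord_le_enorm _ _) _.
have := sqr_ge0 (enorm (Z w) - 1/2); rewrite sqrrB; lra.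
Qed.

Lemma Lone_dotv v Z : Ltwo Z -> Lone (fun w => dotv v (Z w)).
Proof. by move=> LZ; apply: Lone_sum => i; apply: LoneZ; exact: Lone_coord. Qed.

Lemma Ex_dotv v Z : Ltwo Z -> Ex (fun w => dotv v (Z w)) = dotv v (mean Z).
Proof.
move=> LZ; rewrite Ex_sum => [|i]; last by apply: LoneZ; exact: Lone_coord.
by apply: eq_bigr => i _; rewrite ExZ ?mxE//; exact: Lone_coord.
Qed.

Lemma LtwoD Z W : Ltwo Z -> Ltwo W -> Ltwo (fun w => Z w + W w).
Proof.
move=> [mZ iZ] [mW iW]; split; first exact: random_vectorD.
apply: (@Lone_le _ (fun w => 2 * enorm (Z w) ^+ 2 + 2 * enorm (W w) ^+ 2)).
- by apply: measurable_funX; apply: measurable_enorm; exact: random_vectorD.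
- by apply: LoneD; exact: LoneZ.
- by move=> w; rewrite ger0_norm ?sqr_ge0// sqr_enormD_le.
Qed.

Lemma LtwoZ b Z : Ltwo Z -> Ltwo (fun w => b *: Z w).
Proof.
move=> [mZ iZ]; split; first exact: random_vectorZ.
rewrite (_ : (fun w => _) = (fun w => b ^+ 2 * enorm (Z w) ^+ 2)); first exact: LoneZ.
by apply/funext => w; rewrite enormZ exprMn real_normK ?num_real.
Qed.

Lemma Ltwo_cst v : Ltwo (fun=> v).
Proof. by split; [exact: random_vector_cst|exact: Lone_cst]. Qed.

Lemma LtwoB Z W : Ltwo Z -> Ltwo W -> Ltwo (fun w => Z w - W w).
Proof.
move=> LZ LW; rewrite (_ : (fun w => _) = (fun w => Z w + (-1) *: W w)).
  by apply: LtwoD => //; exact: LtwoZ.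
by apply/funext => w; rewrite scaleN1r.
Qed.

Lemma Ltwo_cstB Z v : random_vector Z -> Ltwo (fun w => Z w - v) -> Ltwo Z.
Proof.
move=> mZ LZ; rewrite (_ : Z = (fun w => (Z w - v) + v)).
  by apply: LtwoD => //; exact: Ltwo_cst.
by apply/funext => w; rewrite subrK.
Qed.

Lemma meanD Z W : Ltwo Z -> Ltwo W -> mean (fun w => Z w + W w) = mean Z + mean W.
Proof.
move=> LZ LW; apply/rowP => i; rewrite !mxE -ExD; [|exact: Lone_coord|exact: Lone_coord].
by congr Ex; apply/funext => w; rewrite mxE.
Qed.

Lemma meanZ b Z : Ltwo Z -> mean (fun w => b *: Z w) = b *: mean Z.
Proof.
move=> LZ; apply/rowP => i; rewrite !mxE -ExZ; last exact: Lone_coord.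
by congr Ex; apply/funext => w; rewrite mxE.
Qed.

Lemma mean_cst v : mean (fun=> v) = v.
Proof. by apply/rowP => i; rewrite !mxE Ex_cst. Qed.

Lemma meanB Z W : Ltwo Z -> Ltwo W -> mean (fun w => Z w - W w) = mean Z - mean W.
Proof.
move=> LZ LW; rewrite (_ : (fun w => _) = (fun w => Z w + (-1) *: W w)).
  by rewrite meanD ?meanZ ?scaleN1r//; exact: LtwoZ.
by apply/funext => w; rewrite scaleN1r.
Qed.

Lemma Ex_sqr_shift a Z : Ltwo Z ->
  Ex (fun w => enorm (a + Z w) ^+ 2) =
    enorm a ^+ 2 + 2 * dotv a (mean Z) + Ex (fun w => enorm (Z w) ^+ 2).
Proof.
move=> LZ; have [mZ iZ] := LZ.
rewrite (_ : (fun w => _) = (fun w => enorm a ^+ 2 + 2 * dotv a (Z w) + enorm (Z w) ^+ 2)).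
  have i2 : Lone (fun w => 2 * dotv a (Z w)) by apply: LoneZ; exact: Lone_dotv.
  have i1 : Lone (fun=> enorm a ^+ 2) by exact: Lone_cst.
  by rewrite (ExD (LoneD i1 i2) iZ) (ExD i1 i2) Ex_cst (ExZ 2 (Lone_dotv a LZ)) Ex_dotv.
apply/funext => w; rewrite !sqr_enorm dotvDl !dotvDr (dotvC (Z w) a); ring.
Qed.

Lemma sqr_mean_le Z : Ltwo Z -> enorm (mean Z) ^+ 2 <= Ex (fun w => enorm (Z w) ^+ 2).
Proof.
move=> LZ; have := Ex_sqr_shift (- mean Z) LZ.
have : 0 <= Ex (fun w => enorm (- mean Z + Z w) ^+ 2) by apply: Ex_ge0 => w; rewrite sqr_ge0.
by rewrite enormN dotvNl -sqr_enorm; lra.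
Qed.

(** The centred variable is orthogonal to the constant [a], and subtracting the mean can only
    decrease the second moment. *)
Lemma Ex_sqr_centered a Z : Ltwo Z ->
  Ex (fun w => enorm (a + (Z w - mean Z)) ^+ 2) <=
    enorm a ^+ 2 + Ex (fun w => enorm (Z w) ^+ 2).
Proof.
move=> LZ; rewrite (_ : (fun w => _) = (fun w => enorm ((a - mean Z) + Z w) ^+ 2)).
  rewrite Ex_sqr_shift// lerD2r !sqr_enorm dotvBl !dotvBr (dotvC (mean Z) a).
  rewrite dotvBl; have := dotv_ge0 (mean Z); lra.
by apply/funext => w; rewrite addrA addrAC.
Qed.

End Vectors.

End Expectation.

Lemma integral_id01 (R : realType) (a : R) : 0 <= a ->
  (\int[@lebesgue_measure R]_(s in `[0%R, 1%R]) (a * s)%:E)%E = (a / 2)%:E.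
Proof.
move=> a0.
have dF (x : R) : is_derive x 1 ((a / 2) *: (id ^+ 2 : R -> R)) (a * x).
  apply: is_derive_eq.
  by rewrite /GRing.scale /= expr1 mulr1; field.
have cF (x : R) : {for x, continuous ((a / 2) *: (id ^+ 2 : R -> R))}.
  by apply/differentiable_continuous/derivable1_diffP; have [] := dF x.
rewrite (@continuous_FTC2 _ (fun s => a * s) ((a / 2) *: (id ^+ 2 : R -> R)))//.
- by rewrite /= !fctE /= -EFinB; congr EFin; rewrite /GRing.scale /=; ring.
- apply: continuous_subspaceT => x; apply: cvgM; [exact: cvg_cst|exact: cvg_id].
- split => [x _||].
  + by have [] := dF x.
  + exact/cvg_at_right_filter/cF.
  + exact/cvg_at_left_filter/cF.
- by move=> x _; rewrite derive1E; have [_ ->] := dF x.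
Qed.

(** * Differentiation under the expectation *)

Section GradientOfExpectation.
Context {R : realType} {n : nat} {d : measure_display} {T : measurableType d}.
Local Notation V := 'rV[R]_n.
Variable P : probability T R.
Variables (F : V -> T -> R) (L : R).
Hypothesis mF : forall x, measurable_fun setT (F x).
Hypothesis dF : forall w x, differentiable (F ^~ w) x.
Hypothesis L0 : 0 <= L.
Hypothesis lipF : forall x y, ('E_P[fun w => (enorm (grad (F ^~ w) x - grad (F ^~ w) y) ^+ 2)%R]
   <= (L ^+ 2 * enorm (x - y) ^+ 2)%:E)%E.

Lemma random_vector_gradF x : random_vector (fun w => grad (F ^~ w) x).
Proof. exact: (random_vector_grad mF dF (random_vector_cst x)). Qed.

Lemma expectation_grad_diff x y :
  Ltwo P (fun w => grad (F ^~ w) x - grad (F ^~ w) y) /\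
  Ex P (fun w => enorm (grad (F ^~ w) x - grad (F ^~ w) y) ^+ 2) <= L ^+ 2 * enorm (x - y) ^+ 2.
Proof.
have mZ : random_vector (fun w => grad (F ^~ w) x - grad (F ^~ w) y).
  by apply: random_vectorB; exact: random_vector_gradF.
have [||iZ leZ] := Lone_expectation _ _ (lipF x y).
- by apply: measurable_funX; exact: measurable_enorm.
- by move=> w; exact: sqr_ge0.
by [].
Qed.

Lemma expectation_dotv_grad_diff x v (s : R) : 0 <= s ->
  ('E_P[fun w => `|dotv (grad (F ^~ w) (x + s *: v) - grad (F ^~ w) x) v|%R] <=
    (L * enorm v ^+ 2 * s)%:E)%E.
Proof.
move=> s0; have [[mZ iZ] leZ] := expectation_grad_diff (x + s *: v) x.
set Z := fun w => _ in mZ iZ leZ.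
have [] := @Ex_jensen _ _ _ P (fun w => enorm (Z w)) (L * (s * enorm v)) _ _ _ iZ _.
- exact: measurable_enorm.
- by move=> w; exact: enorm_ge0.
- by rewrite !mulr_ge0 ?enorm_ge0.
- by rewrite (le_trans leZ)// addrAC subrr add0r enormZ (ger0_norm s0) -exprMn.
move=> iN leN.
have mD : measurable_fun setT (fun w => `|dotv (Z w) v|).
  by apply: measurableT_comp => //; apply: measurable_dotv => //; exact: random_vector_cst.
have le1 w : `|dotv (Z w) v| <= enorm v * enorm (Z w).
  by rewrite mulrC; exact: cauchy_schwarz.
have iD : Lone P (fun w => `|dotv (Z w) v|).
  by apply: (Lone_le mD (LoneZ (enorm v) iN)) => w; rewrite normr_id.
rewrite expectationE// lee_fin.
apply: le_trans (Ex_le iD (LoneZ (enorm v) iN) le1) _.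
rewrite ExZ// (_ : L * enorm v ^+ 2 * s = enorm v * (L * (s * enorm v))); last by ring.
by rewrite ler_wpM2l ?enorm_ge0.
Qed.

Local Notation mu := (@lebesgue_measure R).

(** For each outcome the remainder is at most the integral over [s] in [[0, 1]] of [|D w s|]. After
    exchanging the integrals, the expectation at a fixed [s] is at most [L |v|^2 s], and the
    integral of [s] gives the factor [1 / 2]. *)
Lemma taylor_expectation x v :
  ('E_P[fun w => `|F (x + v) w - F x w - dotv (grad (F ^~ w) x) v|%R] <=
    (L / 2 * enorm v ^+ 2)%:E)%E.
Proof.
pose D (w : T) (s : R) := dotv (grad (F ^~ w) (x + s *: v) - grad (F ^~ w) x) v.
have pointwise w : (`|F (x + v) w - F x w - dotv (grad (F ^~ w) x) v|%:E <=
    \int[mu]_(s in `[0%R, 1%R]) `|D w s|%:E)%E.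
  pose q (b s : R) : R := b * (F (x + s *: v) w - s * dotv (grad (F ^~ w) x) v).
  have dq (b s : R) : is_derive s 1 (q b) (b * D w s).
    have dl := is_derive_line (dF w (x + s *: v)).
    have -> : q b = b *: ((fun s : R => F (x + s *: v) w) - (dotv (grad (F ^~ w) x) v) *: id).
      by apply/funext => t; rewrite /q !fctE /= [_ *: t]mulrC.
    by apply: is_derive_eq; rewrite /D dotvBl /GRing.scale /= mulr1.
  have key b : `|b| = 1 -> ((b * (F (x + v) w - F x w - dotv (grad (F ^~ w) x) v))%:E <=
      \int[mu]_(s in `[0%R, 1%R]) `|D w s|%:E)%E.
    move=> b1; have := @increment_le_integral R (q b) 0 1 ler01.
    have -> : q b 1 - q b 0 = b * (F (x + v) w - F x w - dotv (grad (F ^~ w) x) v).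
      by rewrite /q scale1r scale0r addr0 mul1r mul0r subr0; ring.
    have -> : (\int[mu]_(s in `[0%R, 1%R]) `|derive1 (q b) s|%:E =
        \int[mu]_(s in `[0%R, 1%R]) `|D w s|%:E)%E.
      apply: eq_integral => s _; rewrite derive1E; have [_ ->] := dq b s.
      by rewrite normrM b1 mul1r.
    by apply => s; have [] := dq b s.
  have [h|h] := leP 0 (F (x + v) w - F x w - dotv (grad (F ^~ w) x) v).
    by rewrite ger0_norm//; have := key 1; rewrite mul1r; apply; rewrite normr1.
  by rewrite ltr0_norm//; have := key (-1); rewrite mulN1r; apply; rewrite normrN1.
pose H (ws : T * R) : \bar R := (`|D ws.1 ws.2| * \1_(`[0%R, 1%R]%classic : set R) ws.2)%:E.
(* Tonelli's theorem needs joint measurability in the outcome and [s]; it comes from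
   [random_vector_grad] on the product space, with [x + s *: v] as the random point. *)
have mD : measurable_fun setT (fun ws : T * R => `|D ws.1 ws.2|).
  apply: measurableT_comp => //; apply: measurable_dotv; last exact: random_vector_cst.
  apply: random_vectorB.
    apply: (@random_vector_grad R _ (T * R)%type n (fun y ws => F y ws.1)
                   (fun ws => x + ws.2 *: v)) => //.
    - by move=> y; apply: measurableT_comp => //; exact: mF.
    - move=> i; apply: (eq_measurable_fun (fun ws : T * R => x 0 i + ws.2 * v 0 i)).
        by move=> ws _; rewrite !mxE.
      apply: measurable_funD; first exact: measurable_cst.
      by apply: measurable_funM; [exact: measurable_snd|exact: measurable_cst].
  move=> i; have := @random_vector_gradF x i.
  by move=> m1; apply: (measurableT_comp m1); exact: measurable_fst.
have mH : measurable_fun setT H.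
  apply/measurable_EFinP; apply: measurable_funM => //.
  by apply: measurableT_comp; [exact: measurable_indic|exact: measurable_snd].
have H0 ws : (0 <= H ws)%E by rewrite lee_fin mulr_ge0.
have inner w : (\int[mu]_(s in `[0%R, 1%R]) `|D w s|%:E = \int[mu]_s H (w, s))%E.
  rewrite integral_mkcond; apply: eq_integral => s _.
  rewrite /H /= patchE indicE; case: ifP => _; by rewrite ?mulr1 ?mulr0.
rewrite unlock.
apply: (@le_trans _ _ (\int[P]_w \int[mu]_s H (w, s))%E).
  apply: ge0_le_integral => //.
  - apply/measurable_EFinP; apply: measurableT_comp => //.
    apply: measurable_funB; first by apply: measurable_funB; exact: mF.
    by apply: measurable_dotv; [exact: random_vector_gradF|exact: random_vector_cst].
  - exact: measurable_fun_fubini_tonelli_F.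
  - by move=> w _; rewrite -inner; exact: pointwise.
rewrite (@fubini_tonelli _ _ _ _ _ P mu H mH H0).
have -> : L / 2 * enorm v ^+ 2 = L * enorm v ^+ 2 / 2 by field.
rewrite -integral_id01; last by rewrite mulr_ge0// sqr_ge0.
rewrite [leRHS]integral_mkcond; apply: ge0_le_integral => //.
- by move=> s _; exact: integral_ge0.
- exact: measurable_fun_fubini_tonelli_G.
- apply/(measurable_restrictT _ _).1 => //.
  by apply/measurable_EFinP; apply: measurable_funM; [exact: measurable_cst|exact: measurable_id].
move=> s _; rewrite patchE; case: ifPn => [s01|s01]; last first.
  rewrite integral0_eq// => w _; rewrite /H /= indicE (negbTE s01) mulr0//.
have /andP[s0 s1] : 0 <= s <= 1 by move: s01; rewrite inE /= in_itv.
rewrite (eq_integral (fun w => `|D w s|%:E)) => [|w _]; last first.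
  by rewrite /H /= indicE s01 mulr1.
by have := expectation_dotv_grad_diff x v s0; rewrite unlock.
Qed.

Hypothesis iF : forall x, Lone P (F x).
Hypothesis LgF : forall x, Ltwo P (fun w => grad (F ^~ w) x).

Let U x := Ex P (F x).
Let m x := mean P (fun w => grad (F ^~ w) x).

Lemma expectation_taylor x v :
  `|U (x + v) - U x - dotv (m x) v| <= L / 2 * enorm v ^+ 2.
Proof.
have mX : measurable_fun setT (fun w => F (x + v) w - F x w - dotv (grad (F ^~ w) x) v).
  apply: measurable_funB; first by apply: measurable_funB; exact: mF.
  by apply: measurable_dotv; [exact: random_vector_gradF|exact: random_vector_cst].
have [||_ H] := Lone_expectation _ _ (taylor_expectation x v).
- exact: measurableT_comp.
- by [].
apply: le_trans H; rewrite dotvC -(Ex_dotv v (LgF x)).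
have iD := Lone_dotv v (LgF x).
rewrite /U -ExB// -ExB//; last exact: LoneB.
apply: le_trans (le_normr_Rintegral _ _) _ => //.
  by apply: LoneB => //; exact: LoneB.
rewrite le_eqVlt; apply/orP; left; apply/eqP.
by congr (Ex P _); apply/funext => w; rewrite (dotvC v).
Qed.

Lemma grad_of_taylor (f : V -> R) x g C : 
  (forall v, `|f (x + v) - f x - dotv g v| <= C * enorm v ^+ 2) -> grad f x = g.
Proof.
move=> H; apply/rowP => i; rewrite mxE; apply: cvg_lim => //.
apply/cvgrPdist_le => e e0.
near=> h.
have h0 : h != 0 by near: h; exact: nbhs_dnbhs_neq.
have := H (h *: delta_mx 0 i).
rewrite dotvZr dotv_delta enormZ enorm_delta mulr1 => Hh.
have -> : g 0 i - h^-1 *: ((f \o shift x) (h *: delta_mx 0 i) - f x) =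
   - (h^-1 * (f (x + h *: delta_mx 0 i) - f x - h * g 0 i)).
  rewrite /= [h *: _ + x]addrC; set z := f (x + _).
  by rewrite [h^-1 *: _](_ : _ = h^-1 * (z - f x))//; field.
rewrite normrN normrM normfV ler_pdivrMl ?normr_gt0//.
apply: le_trans Hh _; rewrite expr2 mulrA [leRHS]mulrC ler_wpM2r//.
have : `|h| <= e / (`|C| + 1).
  near: h; apply: dnbhs0_le; exact: divr_gt0.
rewrite ler_pdivlMr ?ltr_wpDl// => he.
have := ler_norm (C * `|h|); rewrite normrM normr_id => /le_trans; apply.
by have := normr_ge0 h; lra.
Unshelve. all: by end_near.
Qed.

(** The remainder of [U] around [x], with candidate gradient [m x], is quadratic in the increment,
    which leaves only one possible value for each partial derivative. *)
Lemma grad_expectation x : grad U x = m x.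
Proof. by apply: grad_of_taylor => v; exact: expectation_taylor. Qed.

Lemma mean_grad_lip x y : enorm (m x - m y) <= L * enorm (x - y).
Proof.
have [L2 le2] := expectation_grad_diff x y.
rewrite -(@ler_pXn2r _ 2) ?nnegrE ?mulr_ge0 ?enorm_ge0// exprMn.
by rewrite /m -meanB//; apply: le_trans (sqr_mean_le L2) le2.
Qed.

End GradientOfExpectation.

(** * Independence of the samples *)

Section Independence.
Context {R : realType} {d d' : measure_display} {T : measurableType d}
  {Xi : measurableType d'}.
Variable P : probability T R.
Local Open Scope ereal_scope.

(** Freezing of the past: the law of the pair formed by [w], seen through the sigma-algebra of [G],
    and [Y w] is a product measure, because the two agree on rectangles. *)
Lemma indep_tonelli (G : set (set T)) (Y xi : {RV P >-> Xi})
    (Phi : g_sigma_algebraType G * Xi -> \bar R) :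
  G `<=` measurable ->
  (forall A B, <<s G >> A -> measurable B ->
     P (A `&` Y @^-1` B) = P A * distribution P xi B) ->
  measurable_fun setT Phi -> (forall z, 0 <= Phi z) ->
  \int[P]_w Phi (w, Y w) = \int[P]_w \int[P]_w' Phi (w, xi w').
Proof.
move=> Gm ind mPhi Phi0.
pose T' := g_sigma_algebraType G.
have sGm A : <<s G >> A -> measurable A.
  exact: smallest_sub (@sigma_algebra_measurable _ T) Gm _.
(* The identity into [T] with the smaller sigma-algebra is a random variable whose law is the
   restriction of [P]. *)
have mid : measurable_fun setT (id : T -> T').
  by move=> _ A mA; rewrite setTI; exact: sGm.
pose idT : {mfun T >-> T'} := HB.pack (id : T -> T') (@isMeasurableFun.Build _ _ _ _ _ mid).
have mZ : measurable_fun setT (fun w : T => (w, Y w) : T' * Xi).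
  by apply/measurable_fun_pairP; split => //=; exact: measurable_funPT.
pose Z : {mfun T >-> (T' * Xi)%type} := HB.pack (fun w : T => (w, Y w) : T' * Xi)
  (@isMeasurableFun.Build _ _ _ _ _ mZ).
have -> : \int[P]_w Phi (w, Y w) = \int[distribution P Z]_z Phi z.
  by rewrite ge0_integral_distribution.
have E : forall X, measurable X ->
    (distribution P idT \x distribution P xi) X = distribution P Z X.
  apply: product_measure_unique => A B mA mB.
  by rewrite /distribution /pushforward /= -ind//; congr (P _).
rewrite -(eq_measure_integral _ (fun A mA _ => E A mA)).
rewrite fubini_tonelli1//.
rewrite (@ge0_integral_distribution _ _ _ _ _ P idT); last 2 first.
- exact: measurable_fun_fubini_tonelli_F.
- by move=> y; exact: integral_ge0.
apply: eq_integral => w _ /=; rewrite /fubini_F ge0_integral_distribution//.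
exact: measurableT_comp mPhi (measurable_pair1 _).
Qed.

Lemma bigsetU_ordP (A : Type) t (F : 'I_t -> set A) x :
  (\big[setU/set0]_(i < t) F i) x <-> exists i, F i x.
Proof.
rewrite -bigcup_seq; split => [[i _ Fi]|[i Fi]]; exists i => //.
by rewrite /= mem_index_enum.
Qed.

(** As functions of [A], both sides are finite measures, and they agree on the cylinders over the
    indices [1] to [t]. These form a pi-system that generates the history. *)
Lemma samples_indep (xi : {RV P >-> Xi}) (xis : nat -> {RV P >-> Xi}) t A B :
  iid_samples xi xis -> g_sigma_preimage (fun k : 'I_t => xis k.+1 : T -> Xi) A ->
  measurable B -> P (A `&` xis t.+1 @^-1` B) = P A * distribution P xi B.
Proof.
move=> [same ind] FA mB.
have mpre k C : measurable C -> measurable (xis k @^-1` C).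
  by move=> mC; rewrite -[X in measurable X]setTI; exact: measurable_funPT.
have mC := mpre t.+1 B mB; set C := xis t.+1 @^-1` B in mC *.
have PC : distribution P xi B = P C by rewrite -(same t.+1).
have PCfin : P C \is a fin_num by exact: fin_num_measure.
pose r : {nonneg R} := NngNum (fine_ge0 (measure_ge0 P C)).
have rE : r%:num%:E = P C by rewrite /r/= fineK.
pose pi : set (set T) := [set A | exists2 D : nat -> set Xi, (forall k, measurable (D k)) &
   A = \bigcap_(k in [set` iota 1 t]) (xis k @^-1` D k)].
have pim : pi `<=` measurable.
  move=> _ [D mD ->]; apply: fin_bigcap_measurable => // k _; exact: mpre.
have piT : pi setT.
  exists (fun=> setT) => //; apply/esym; rewrite -subTset => w _ k _ //.
have PA k (D : nat -> set Xi) : (forall k, measurable (D k)) -> uniq k -> all (leq 1) k ->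
   P (\bigcap_(j in [set` k]) (xis j @^-1` D j)) = \prod_(j <- k) P (xis j @^-1` D j).
  by move=> mD uk ak; exact: ind.
have key : mrestr P mC A = mscale r P A.
  apply: (@g_sigma_algebra_measure_unique _ R T pi pim (fun=> setT)) => //.
  - by rewrite bigcup_const//; exists 0%N.
  - move=> _ _ [D mD ->] [D' mD' ->]; exists (fun k => D k `&` D' k).
      by move=> k; exact: measurableI.
    rewrite -bigcapI; apply: eq_bigcapr => k _; exact: preimage_setI.
  - move=> _ [D mD ->]; rewrite /mrestr /mscale /=.
    (* Putting [B] at index [t + 1] makes the intersection with [C] a cylinder over [1] to [t + 1],
       to which independence of the samples applies. *)
    pose D' k := if (k == t.+1)%N then B else D k.
    have mD' k : measurable (D' k) by rewrite /D'; case: ifP.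
    have st : forall k, k \in iota 1 t -> k != t.+1.
      by move=> k; rewrite mem_iota => /andP[_]; rewrite add1n ltn_neqAle => /andP[].
    have := @PA (rcons (iota 1 t) t.+1) D' mD'.
    rewrite rcons_uniq iota_uniq mem_iota add1n ltnn andbF /= all_rcons /=.
    have a1 : all (leq 1) (iota 1 t) by apply/allP => k; rewrite mem_iota => /andP[].
    rewrite a1 => /(_ isT isT); rewrite -cats1 big_cat big_seq1 /=.
    have -> : D' t.+1 = B by rewrite /D' eqxx.
    rewrite -/C (eq_big_seq (fun j => P (xis j @^-1` D j))) => [|k /st kt]; last first.
      by rewrite /D' (negbTE kt).
    rewrite -(PA _ D mD (iota_uniq _ _) a1).
    rewrite (_ : \bigcap_(j in [set` iota 1 t ++ [:: t.+1]]) (xis j @^-1` D' j) = \bigcap_(k in [set` iota 1 t]) (xis k @^-1` D k) `&` C).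
      by rewrite -/C => E; apply: etrans E _; rewrite muleC -rE.
    apply/seteqP; split => w.
      move=> H; split => [k /= kt|].
        have := H k; rewrite /= mem_cat kt => /(_ isT).
        by rewrite /D' (negbTE (st k kt)).
      by have := H t.+1; rewrite /= mem_cat mem_seq1 eqxx orbT /D' eqxx => /(_ isT).
    move=> [H HC] k /=; rewrite mem_cat mem_seq1 => /orP[kt|/eqP ->].
      by rewrite /D' (negbTE (st k kt)); exact: H.
    by rewrite /D' eqxx.
  - by move=> _; rewrite /= /mrestr setTI -ge0_fin_numE.
  - move: A FA; apply: smallest_sub; first exact: smallest_sigma_algebra.
    move=> A /bigsetU_ordP[k [D mD <-]]; apply: sub_sigma_algebra.
    exists (fun j => if (j == k.+1)%N then D else setT) => [j|]; first by case: ifP.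
    rewrite setTI; apply/seteqP; split => w.
      by move=> H j _ /=; case: eqP => // ->.
    by move=> H; have := H k.+1; rewrite /= eqxx; apply; rewrite mem_iota add1n /= ltnS.
by move: key; rewrite /mrestr /mscale rE PC muleC.
Qed.

End Independence.

(** * One step of the algorithm *)

Section Step.
Context {R : realType} {n I J : nat}.
Local Notation V := 'rV[R]_n.
Variables (u : V -> \bar R) (h : 'I_I -> V -> R) (g : 'I_J -> V -> R).
Variables (L G chi rho mu BU : R).
Hypotheses (L0 : 0 < L) (G0 : 0 <= G) (rho0 : 0 < rho) (mu0 : 0 <= mu).
Hypothesis chi_rho : rho / L * (G + rho / 2) <= chi.
Hypothesis cu : econvex u.
Local Notation X := (Xset h g).
Hypothesis Xdom : forall x, X x -> (u x < +oo)%E.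
Hypothesis ch : forall i, cvx_on setT (h i).
Hypothesis sh : forall i, smooth_on setT L (h i) /\ lip_on setT G (h i).
Hypothesis sg : forall j, smooth_on setT L (g j) /\ lip_on setT G (g j).
Hypothesis mfcq : MFCQ h g chi rho.

Variables (y : V) (gt : 'I_J -> V -> R) (phi : V -> R) (xh : V).
Hypothesis Xy : X y.
Local Notation S := (Kset h `&` [set x | forall j, gt j x <= 0]).
Hypothesis cS : cvx_set S.
Hypothesis SX : S `<=` X.
Hypothesis cgt : forall j, cvx_on X (gt j).
Hypothesis sgt : forall j, smooth_on X L (gt j).
Hypothesis lgt : forall j, lip_on X G (gt j).
Hypothesis ggt : forall j, grad (gt j) y = grad (g j) y.
Hypothesis vgt : forall j, gt j y = g j y.
Hypothesis scphi : strongly_convex mu phi.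
Hypothesis dphi : forall x, differentiable phi x.
Hypothesis lphi : forall x x', enorm (grad phi x - grad phi x') <= L * enorm (x - x').
Hypothesis Sxh : S xh.
Hypothesis opt : forall x, S x -> ((phi xh)%:E + u xh <= (phi x)%:E + u x)%E.
Hypothesis BUP : forall x, X x ->
  phi x + fine (u x) - (phi xh + fine (u xh)) <= BU.

Let Sy : S y.
Proof. by split; [exact: Xy.1|move=> j /=; rewrite vgt; exact: Xy.2]. Qed.

Let seg x x' : S x -> S x' -> forall s : R, 0 <= s <= 1 -> S (x + s *: (x' - x)).
Proof.
move=> Sx Sx' s s01; have := cS s01 Sx' Sx.
by rewrite scalerBr scalerBl scale1r addrCA.
Qed.

(** Strong convexity is used twice, each time for [mu / 2]: at the minimizer, where the objective
    grows quadratically towards [y], and at [y], where [phi] lies above its tangent. *)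
Lemma argmin_descent :
  fine (u xh) - fine (u y) + dotv (grad phi y) (xh - y) <= - (mu * enorm (xh - y) ^+ 2).
Proof.
have uy := Xdom Xy; have uxh := Xdom (SX Sxh).
have H1 := strongly_convex_grad xh scphi (dphi y).
suff H2 : phi xh + fine (u xh) + mu / 2 * enorm (xh - y) ^+ 2 <= phi y + fine (u y).
  by move: H1 H2; lra.
set q := mu / 2 * _; have q0 : 0 <= q by rewrite mulr_ge0 ?sqr_ge0// divr_ge0.
apply: (@ler_addgt0_scale _ _ _ q) => e e0.
pose s := Num.min e 1.
have s0 : 0 < s by rewrite lt_min e0 ltr01.
have s1 : s <= 1 by rewrite ge_min lexx orbT.
have se : s <= e by rewrite ge_min lexx.
have s01 : 0 <= s <= 1 by rewrite (ltW s0).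
have := opt (cS s01 Sy Sxh).
rewrite (econvex_fine cu uxh) -EFinD.
move=> /le_trans /(_ (leeD (lexx _) (econvex_combo cu s01 uy uxh))).
rewrite -EFinD lee_fin => H3.
have := scphi y xh s01; rewrite (enormC y xh) => H4.
have E : mu / 2 * (s * (1 - s)) * enorm (xh - y) ^+ 2 = s * (1 - s) * q by rewrite /q; ring.
rewrite E in H4.
have : s * (phi xh + fine (u xh) + (1 - s) * q) <= s * (phi y + fine (u y)) by lra.
rewrite ler_pM2l//; have := ler_wpM2r q0 se; lra.
Qed.

Let M := 2 * L * BU / rho ^+ 2.

(** The exact multipliers of the subproblem are read against the true constraints, with the gradient
    of [phi] taken at [y] instead of [xh]. The change of point for [phi] costs [L], and the change
    of constraint gradients [2 L M]. The [h i] enter the subproblem unchanged, so their slackness is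
    exact. *)
Lemma approximate_kkt : exists lam : 'I_J -> R, exists nu : 'I_I -> R, exists v : V,
  [/\ (forall j, 0 <= lam j <= M) /\ (forall i, 0 <= nu i <= M), subdiff u xh v,
    enorm (grad phi y + \sum_j lam j *: grad (g j) xh + \sum_i nu i *: grad (h i) xh + v)
      <= (L + 2 * L * M) * enorm (xh - y),
    - (L * M * enorm (xh - y) ^+ 2) <= \sum_j lam j * g j xh &
    0 <= \sum_i nu i * h i xh].
Proof.
have Xxh := SX Sxh.
have [dir [dir1 actg acth]] := mfcq Xy.
pose k := rho ^+ 2 / (2 * L).
have k0 : 0 < k by rewrite divr_gt0 ?exprn_gt0// mulr_gt0.
(* All fractions [t] are treated because the whole segment must lie in [X], where the surrogates are
   known to be smooth and Lipschitz, before the surrogates can be bounded at its end. *)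
have slh i (t : R) : 0 <= t <= 1 -> h i (y + (t * (rho / L)) *: dir) <= - (t * k).
  move=> t01; have [sm li] := sh i.
  exact: (slater_point L0 rho0 G0 dir1 chi_rho (acth i) (Xy.1 i) sm li erefl erefl t01).
have slg j (t : R) : 0 <= t <= 1 -> g j (y + (t * (rho / L)) *: dir) <= - (t * k).
  move=> t01; have [sm li] := sg j.
  exact: (slater_point L0 rho0 G0 dir1 chi_rho (actg j) (Xy.2 j) sm li erefl erefl t01).
have segX (s : R) : 0 <= s <= 1 -> X (y + s *: ((rho / L) *: dir)).
  move=> s01; have sk : - (s * k) <= 0.
    by case/andP: s01 => s0 _; rewrite oppr_le0 mulr_ge0// ltW.
  rewrite scalerA; split => [i|j] /=; apply: le_trans sk; [exact: slh|exact: slg].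
pose xs := y + (rho / L) *: dir.
have o1 : 0 <= (1 : R) <= 1 by rewrite ler01 lexx.
have slgt j : gt j xs <= - k.
  have := slater_point L0 rho0 G0 dir1 chi_rho (actg j) (Xy.2 j) (sgt j) (lgt j)
    (vgt j) (ggt j) o1.
  by rewrite !mul1r; apply => s s01; exact: segX.
have slh1 i : h i xs <= - k by have := slh i 1 o1; rewrite !mul1r.
have Sxs : S xs.
  by split => [i|j] /=; [apply: le_trans (slh1 i) _|apply: le_trans (slgt j) _]; rewrite oppr_le0 ltW.
have Xxs := SX Sxs.
have [|||||lam [nu [[lam0 nu0] [cslam csnu] sumM sub]]] := kkt_multipliers (q1 := gt) (q2 := h)
    (phi := phi) k0 cu (Xdom Xxh) (Xdom Xxs) (dphi xh)
    (fun j => (sgt j).1 _ Xxh) (fun i => (sh i).1.1 _ Logic.I).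
- by move=> j; have := Sxh.2 j.
- by move=> i; have := Sxh.1 i.
- by move=> j; apply: le_trans (slgt j); apply: (cvx_gradient_le (cgt j)) => //; exact: (sgt j).1.
- by move=> i; apply: le_trans (slh1 i); apply: (cvx_gradient_le (ch i)) => //; exact: (sh i).1.1.
- by move=> x gx hx; apply: opt; split.
have LM : \sum_j lam j + \sum_i nu i <= M.
  have H : (\sum_j lam j + \sum_i nu i) * k <= BU.
    apply: le_trans sumM _; apply: le_trans (BUP Xxs).
    have := strongly_convex_grad xs scphi (dphi xh).
    have : 0 <= mu / 2 * enorm (xs - xh) ^+ 2 by rewrite mulr_ge0 ?sqr_ge0// divr_ge0.
    lra.
  rewrite -(ler_pM2r k0); apply: le_trans H _.
  rewrite /M /k le_eqVlt; apply/orP; left; apply/eqP; field.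
  by rewrite !gt_eqF.
have Sl0 : 0 <= \sum_j lam j by apply: sumr_ge0.
have Sn0 : 0 <= \sum_i nu i by apply: sumr_ge0.
have lamM : \sum_j lam j <= M by lra.
have one m (F : 'I_m -> R) i : (forall i, 0 <= F i) -> F i <= \sum_i F i.
  by move=> F0; rewrite (bigD1 i)//= lerDl sumr_ge0.
exists lam, nu; eexists; split; [|exact: sub| | |].
- split=> [j|i].
    by rewrite lam0 /=; apply: le_trans (one _ _ j lam0) _.
  by rewrite nu0 /=; apply: le_trans (one _ _ i nu0) _; lra.
- have -> : grad phi y + \sum_j lam j *: grad (g j) xh + \sum_i nu i *: grad (h i) xh
     - (grad phi xh + \sum_j lam j *: grad (gt j) xh + \sum_i nu i *: grad (h i) xh)
     = (grad phi y - grad phi xh) + \sum_j lam j *: (grad (g j) xh - grad (gt j) xh).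
    under [X in _ = _ + X]eq_bigr do rewrite scalerBr.
    rewrite sumrB; set a := \sum_j _; set b := \sum_i _; set c := \sum_j _.
    by apply/rowP => k'; rewrite !mxE; ring.
  apply: le_trans (enormD _ _) _; rewrite mulrDl; apply: lerD.
    by rewrite (enormC xh) lphi.
  apply: le_trans (enorm_sum _) _.
  apply: (@le_trans _ _ (\sum_j lam j * (2 * L * enorm (xh - y)))).
    (* The gradients of [g j] and of its surrogate agree at [y], and each moves by at most
       [L |xh - y|]. *)
    apply: ler_sum => j _; rewrite enormZ ger0_norm// ler_wpM2l//.
    have H1 := (sg j).1.2 xh y Logic.I Logic.I.
    have H2 := (sgt j).2 y xh Xy Xxh; rewrite (enormC y xh) ggt in H2.
    have := enormD (grad (g j) xh - grad (g j) y) (grad (g j) y - grad (gt j) xh).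
    rewrite addrA subrK => /le_trans; apply; move: (lerD H1 H2) => /le_trans; apply.
    by rewrite -mulrA mulr_natl mulr2n.
  rewrite -mulr_suml.
  have : 0 <= 2 * L * enorm (xh - y) by rewrite !mulr_ge0 ?enorm_ge0 ?(ltW L0).
  move=> q0; apply: le_trans (ler_wpM2r q0 lamM) _.
  by rewrite le_eqVlt; apply/orP; left; apply/eqP; ring.
(* [g j] and its surrogate have the same first-order expansion at [y], each with error
   [L / 2 |xh - y|^2], and the surrogate has exact complementary slackness. *)
- have H j : - (lam j * (L * enorm (xh - y) ^+ 2)) <= lam j * g j xh.
    have := smooth_quadratic_bound (x := y) (v := xh - y) (ltW L0) (sg j).1 (fun _ _ => Logic.I).
    have := smooth_quadratic_bound (x := y) (v := xh - y) (ltW L0) (sgt j).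
    rewrite ggt vgt !(addrC y) !subrK => /(_ _)/[!ler_norml] H1 /andP[H2 _].
    have /andP[_ {}H1] := H1 (fun s s01 => SX (seg Sy Sxh s01)).
    have : gt j xh - L * enorm (xh - y) ^+ 2 <= g j xh by lra.
    by move/(ler_wpM2l (lam0 j)); rewrite mulrBr cslam sub0r.
  apply: le_trans (ler_sum _ (fun j _ => H j)); rewrite sumrN lerN2 -mulr_suml.
  rewrite [L * M]mulrC -mulrA ler_wpM2r// mulr_ge0 ?sqr_ge0// ltW//.
- by rewrite big1// => i _; exact: csnu.
Qed.

End Step.

(** * Measurable multipliers *)

Section Topology.
Context {R : realType}.

Lemma continuous_rV (Z : topologicalType) m (X : Z -> 'rV[R]_m) z :
  (forall i, {for z, continuous (fun z => X z 0 i)}) -> {for z, continuous X}.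
Proof.
move=> cX; apply/cvgrPdist_le => e e0.
have H : \forall t \near z, forall i, `|X z 0 i - X t 0 i| <= e.
  apply: (@filter_forall _ _ (fun i t => `|X z 0 i - X t 0 i| <= e) (nbhs z) _) => i.
  by have /cvgrPdist_le := cX i; apply.
apply: filterS H => t Ht; apply: rV_norm_le => [|i]; first exact: ltW.
by rewrite !mxE.
Qed.

Lemma continuous_lsubmx m1 m2 : continuous (fun y : 'rV[R]_(m1 + m2) => lsubmx y).
Proof.
move=> y; apply: continuous_rV => i.
rewrite (_ : (fun _ => _) = (fun y : 'rV[R]_(m1 + m2) => y 0 (lshift m2 i))).
  exact: coord_continuous.
by apply/funext => z; rewrite mxE.
Qed.

Lemma continuous_rsubmx m1 m2 : continuous (fun y : 'rV[R]_(m1 + m2) => rsubmx y).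
Proof.
move=> y; apply: continuous_rV => i.
rewrite (_ : (fun _ => _) = (fun y : 'rV[R]_(m1 + m2) => y 0 (rshift m1 i))).
  exact: coord_continuous.
by apply/funext => z; rewrite mxE.
Qed.

Lemma continuous_at_comp (Z1 Z2 Z3 : topologicalType) (f : Z2 -> Z3) (X : Z1 -> Z2) z :
  continuous f -> {for z, continuous X} -> {for z, continuous (fun z => f (X z))}.
Proof. by move=> cf cX; exact: (continuous_comp cX (cf (X z))). Qed.

Lemma continuous_at_coord (Z : topologicalType) m (X : Z -> 'rV[R]_m) z i :
  {for z, continuous X} -> {for z, continuous (fun z => X z 0 i)}.
Proof. exact: continuous_at_comp (@coord_continuous R 1 m 0 i). Qed.

Lemma continuous_comb (Z : topologicalType) m k (a : 'I_k -> Z -> R)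
    (D : 'I_k -> Z -> 'rV[R]_m) z :
  (forall j, {for z, continuous (a j)}) -> (forall j, {for z, continuous (D j)}) ->
  {for z, continuous (fun z => \sum_j a j z *: D j z)}.
Proof.
move=> ca cD; apply: continuous_rV => i.
rewrite (_ : (fun _ => _) = (fun z => \sum_j a j z * D j z 0 i)).
  apply: continuous_sum => j; apply: cvgM; first exact: ca.
  exact: (continuous_at_coord (cD j)).
by apply/funext => t; rewrite summxE; apply: eq_bigr => j _; rewrite mxE.
Qed.

Lemma near_gt0 (Z1 Z2 : topologicalType) (F : Z1 * Z2 -> R) z1 z2 :
  {for (z1, z2), continuous F} -> 0 < F (z1, z2) ->
  \forall y \near z1 & x \near z2, 0 < F (y, x).
Proof.
move=> cF F0; have /= := cvgr_gt _ cF 0 F0.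
by move=> [[A B] /= [nA nB] H]; exists (A, B) => // -[a b] [/= Aa Bb]; exact: (H (a, b)).
Qed.

End Topology.

(** A small residual controls the subgradient [v] by the remaining terms. The bound has the shape of
    the common radius that makes the set of admissible triples compact. *)
Lemma residual_bound (R : realType) n (a b c v : 'rV[R]_n) r r' eb ec M : 
  enorm (a + b + c + v) <= r -> r <= r' -> enorm b <= eb -> enorm c <= ec -> 0 <= M ->
  enorm v <= M + r' + enorm a + eb + ec.
Proof.
move=> H rr' Hb Hc M0.
have -> : v = (a + b + c + v) + - (a + b + c) by rewrite addrAC subrr add0r.
apply: le_trans (enormD _ _) _; rewrite enormN.
have := enormD (a + b) c; have := enormD a b; lra.
Qed.

Section MultiplierSelection.
Context {R : realType} {d : measure_display} {T : measurableType d} {n I J : nat}.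
Local Notation V := 'rV[R]_n.
Variables (u : V -> \bar R) (gU : V -> V).
Variables (g : 'I_J -> V -> R) (dg : 'I_J -> V -> V).
Variables (h : 'I_I -> V -> R) (dh : 'I_I -> V -> V).
Variables (xh : T -> V) (r q : T -> R) (M : R).
Hypothesis uNy : forall x, u x != -oo%E.
Hypotheses (cgU : continuous gU) (cg : forall j, continuous (g j))
  (cdg : forall j, continuous (dg j)) (ch : forall i, continuous (h i))
  (cdh : forall i, continuous (dh i)).
Hypotheses (mxh : random_vector xh) (mr : measurable_fun setT r)
  (mq : measurable_fun setT q).

(** The parameters (point, residual bound, slackness bound) and the unknowns (two multipliers,
    subgradient) are packed into single row vectors, the setting of the selection lemma. *)
Local Notation PT := 'rV[R]_(n + 1 + 1).
Local Notation YT := 'rV[R]_(J + I + n).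

Let px (z : YT * PT) : V := lsubmx (lsubmx z.2).
Let pr (z : YT * PT) : R := (rsubmx (lsubmx z.2)) 0 0.
Let pq (z : YT * PT) : R := (rsubmx z.2) 0 0.
Let pl (z : YT * PT) : 'rV[R]_J := lsubmx (lsubmx z.1).
Let pn (z : YT * PT) : 'rV[R]_I := rsubmx (lsubmx z.1).
Let pv (z : YT * PT) : V := rsubmx z.1.

Let c1 (z : YT * PT) : {for z, continuous fst}. Proof. exact: cvg_fst. Qed.
Let c2 (z : YT * PT) : {for z, continuous snd}. Proof. exact: cvg_snd. Qed.

Let cpx : continuous px.
Proof. by move=> z; exact: (continuous_at_comp (@continuous_lsubmx R n 1) (continuous_at_comp (@continuous_lsubmx R (n + 1) 1) (@c2 z))). Qed.

Let cpr : continuous pr.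
Proof. by move=> z; exact: (continuous_at_coord (i := 0) (continuous_at_comp (@continuous_rsubmx R n 1) (continuous_at_comp (@continuous_lsubmx R (n + 1) 1) (@c2 z)))). Qed.

Let cpq : continuous pq.
Proof. by move=> z; exact: (continuous_at_coord (i := 0) (continuous_at_comp (@continuous_rsubmx R (n + 1) 1) (@c2 z))). Qed.

Let cpl : continuous pl.
Proof. by move=> z; exact: (continuous_at_comp (@continuous_lsubmx R J I) (continuous_at_comp (@continuous_lsubmx R (J + I) n) (@c1 z))). Qed.

Let cpn : continuous pn.
Proof. by move=> z; exact: (continuous_at_comp (@continuous_rsubmx R J I) (continuous_at_comp (@continuous_lsubmx R (J + I) n) (@c1 z))). Qed.

Let cpv : continuous pv.
Proof. by move=> z; exact: (continuous_at_comp (@continuous_rsubmx R (J + I) n) (@c1 z)). Qed.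

Let res (z : YT * PT) : V := gU (px z) + \sum_j pl z 0 j *: dg j (px z)
  + \sum_i pn z 0 i *: dh i (px z) + pv z.

Let cres : continuous res.
Proof.
move=> z; apply: cvgD; last exact: cpv.
apply: cvgD; first apply: cvgD.
- exact: (continuous_at_comp cgU (@cpx z)).
- apply: continuous_comb => j; last exact: (continuous_at_comp (@cdg j) (@cpx z)).
  exact: (continuous_at_coord (@cpl z)).
- apply: continuous_comb => j; last exact: (continuous_at_comp (@cdh j) (@cpx z)).
  exact: (continuous_at_coord (@cpn z)).
Qed.

Let ineqs (z : YT * PT) : Prop :=
  [/\ (forall j, 0 <= pl z 0 j) /\ (forall j, pl z 0 j <= M),
      (forall i, 0 <= pn z 0 i) /\ (forall i, pn z 0 i <= M),
      enorm (res z) <= pr z, - pq z <= \sum_j pl z 0 j * g j (px z) &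
      0 <= \sum_i pn z 0 i * h i (px z)].

Let near_lt (a b : YT * PT -> R) y x : {for (y, x), continuous a} ->
  {for (y, x), continuous b} -> ~ (a (y, x) <= b (y, x)) ->
  \forall y' \near y & x' \near x, ~ (a (y', x') <= b (y', x')).
Proof.
move=> ca cb /negP; rewrite -ltNge => ab.
have := @near_gt0 R _ _ (fun z => a z - b z) y x (cvgB ca cb).
by rewrite subr_gt0 => /(_ _ ab); apply: filterS => z; rewrite subr_gt0 ltNge => /negP.
Qed.

Let near_ineqs y x : ~ ineqs (y, x) -> \forall y' \near y & x' \near x, ~ ineqs (y', x').
Proof.
have c0 : {for (y, x), continuous (fun _ : YT * PT => 0 : R)} by exact: cvg_cst.
have cM : {for (y, x), continuous (fun _ : YT * PT => M)} by exact: cvg_cst.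
have cl j : {for (y, x), continuous (fun z : YT * PT => pl z 0 j)}.
  exact: (continuous_at_coord (@cpl (y, x))).
have cn j : {for (y, x), continuous (fun z : YT * PT => pn z 0 j)}.
  exact: (continuous_at_coord (@cpn (y, x))).
have cN : {for (y, x), continuous (fun z => enorm (res z))}.
  exact: (continuous_enorm (@cres (y, x))).
have cG : {for (y, x), continuous (fun z => \sum_j pl z 0 j * g j (px z))}.
  apply: continuous_sum => j; apply: cvgM; first exact: cl.
  exact: (continuous_at_comp (@cg j) (@cpx _)).
have cH : {for (y, x), continuous (fun z => \sum_i pn z 0 i * h i (px z))}.
  apply: continuous_sum => j; apply: cvgM; first exact: cn.
  exact: (continuous_at_comp (@ch j) (@cpx _)).
have cNq : {for (y, x), continuous (fun z => - pq z)} by apply: cvgN; exact: cpq.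
(* If one inequality fails, its failure persists nearby and settles the claim; otherwise the next
   inequality is examined. *)
have go (Q : Prop) (W : YT * PT -> Prop) :
    (forall z, ineqs z -> W z) -> (~ W (y, x) -> \forall y' \near y & x' \near x, ~ W (y', x')) ->
    (W (y, x) -> \forall y' \near y & x' \near x, ~ ineqs (y', x')) ->
    \forall y' \near y & x' \near x, ~ ineqs (y', x').
  move=> iW nW k; have [Wz|Wz] := pselect (W (y, x)); first exact: k.
  by apply: filterS (nW Wz) => z nWz /iW.
have fin m (a b : 'I_m -> YT * PT -> R) : (forall j, {for (y, x), continuous (a j)}) ->
    (forall j, {for (y, x), continuous (b j)}) -> ~ (forall j, a j (y, x) <= b j (y, x)) ->
    \forall y' \near y & x' \near x, ~ (forall j, a j (y', x') <= b j (y', x')).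
  move=> ca cb /existsNP[j]; move/(near_lt (ca j) (cb j)).
  by apply: filterS => z nz /(_ j).
move=> nI.
apply: (go True (fun z => forall j, 0 <= pl z 0 j)) => [z [[]]//|H|H1].
  exact: (fin _ (fun _ _ => 0) (fun j z => pl z 0 j)).
apply: (go True (fun z => forall j, pl z 0 j <= M)) => [z [[]]//|H|H2].
  exact: (fin _ (fun j z => pl z 0 j) (fun _ _ => M)).
apply: (go True (fun z => forall j, 0 <= pn z 0 j)) => [z [_ []]//|H|H3].
  exact: (fin _ (fun _ _ => 0) (fun j z => pn z 0 j)).
apply: (go True (fun z => forall j, pn z 0 j <= M)) => [z [_ []]//|H|H4].
  exact: (fin _ (fun j z => pn z 0 j) (fun _ _ => M)).
apply: (go True (fun z => enorm (res z) <= pr z)) => [z []//|H|H5].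
  exact: (near_lt cN (@cpr (y, x)) H).
apply: (go True (fun z => - pq z <= \sum_j pl z 0 j * g j (px z))) => [z []//|H|H6].
  exact: (near_lt cNq cG H).
apply: (go True (fun z => 0 <= \sum_i pn z 0 i * h i (px z))) => [z []//|H|H7].
  exact: (near_lt c0 cH H).
by case: nI.
Qed.

Let theta w : PT := row_mx (row_mx (xh w) (const_mx (r w))) (const_mx (q w)).

Let theta_x y w : px (y, theta w) = xh w.
Proof. by rewrite /px /theta !row_mxKl. Qed.
Let theta_r y w : pr (y, theta w) = r w.
Proof. by rewrite /pr /theta row_mxKl row_mxKr mxE. Qed.
Let theta_q y w : pq (y, theta w) = q w.
Proof. by rewrite /pq /theta row_mxKr mxE. Qed.

Let mtheta : random_vector theta.
Proof.
move=> k; rewrite -(fintype.splitK k); case: (fintype.split k) => [k1|k1] /=.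
  rewrite -(fintype.splitK k1); case: (fintype.split k1) => [k2|k2] /=.
    by apply: (eq_measurable_fun (fun w => xh w 0 k2)) => // w _; rewrite !row_mxEl.
  by apply: (eq_measurable_fun r) => // w _; rewrite row_mxEl row_mxEr mxE.
by apply: (eq_measurable_fun q) => // w _; rewrite row_mxEr mxE.
Qed.

Hypothesis ex : forall w, exists lam : 'I_J -> R, exists nu : 'I_I -> R, exists v : V,
  [/\ (forall j, 0 <= lam j <= M) /\ (forall i, 0 <= nu i <= M), subdiff u (xh w) v,
    enorm (gU (xh w) + \sum_j lam j *: dg j (xh w) + \sum_i nu i *: dh i (xh w) + v) <= r w,
    - q w <= \sum_j lam j * g j (xh w) & 0 <= \sum_i nu i * h i (xh w)].

Let S w : set YT := [set y | subdiff u (xh w) (pv (y, theta w)) /\ ineqs (y, theta w)].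

(** The delicate condition is membership in the subdifferential, since [u] is not assumed lower
    semicontinuous. But every value of [xh] carries a subgradient: one of them at [xh w] minorizes
    [u] at all other values of [xh], which is the semicontinuity needed. *)
Let S_near w y : ~ S w y -> \forall y' \near y & x' \near theta w,
  forall w', theta w' = x' -> ~ S w' y'.
Proof.
move=> nS; have [I1|nI] := pselect (ineqs (y, theta w)); last first.
  by apply: filterS (near_ineqs nI) => -[y' x'] /= nI' w' tw' [_]; rewrite tw'.
have nsub : ~ subdiff u (xh w) (pv (y, theta w)) by move=> H; apply: nS; split.
have [_ [_ [v0 [_ sv0 _ _ _]]]] := ex w.
have [ufin uv0] := sv0.
have [y0 /negP] : exists y0, ~ (u (xh w) + (dotv (pv (y, theta w)) (y0 - xh w))%:E <= u y0)%E.
  by apply/existsNP => H; apply: nsub.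
rewrite -ltNge => lt0.
have uy0 : u y0 = (fine (u y0))%:E.
  by rewrite fineK// fin_real// ltNye uNy (lt_trans lt0)// -(fineK ufin) -EFinD ltry.
rewrite uy0 -(fineK ufin) -EFinD lte_fin in lt0.
(* [F] adds the minorant of [u] given by [v0] to the linear term of the violated inequality at [y0].
   It is continuous and positive, so the violation persists for nearby parameters. *)
pose F (z : YT * PT) := fine (u (xh w)) + dotv v0 (px z - xh w) + dotv (pv z) (y0 - px z) - fine (u y0).
have cF : {for (y, theta w), continuous F}.
  have cst1 (x : V) : {for (y, theta w), continuous (fun _ : YT * PT => x)} by exact: cvg_cst.
  have d1 := continuous_dotv (cst1 v0) (cvgB (@cpx (y, theta w)) (cst1 (xh w))).
  have d2 := continuous_dotv (@cpv (y, theta w)) (cvgB (cst1 y0) (@cpx (y, theta w))).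
  apply: cvgB; last exact: cvg_cst.
  by apply: cvgD; [apply: cvgD; [exact: cvg_cst|exact: d1]|exact: d2].
have F0 : 0 < F (y, theta w).
  by rewrite /F theta_x subrr dotv0r addr0 subr_gt0.
apply: filterS (near_gt0 cF F0) => -[y' x'] /= Fz w' tw' [[uf' sub'] _].
have := sub' y0; rewrite uy0 -(fineK uf') -EFinD lee_fin => H1.
have := uv0 (xh w'); rewrite -(fineK ufin) -(fineK uf') -EFinD lee_fin => H2.
move: Fz; rewrite /F -tw' theta_x /pv /= in H1 *; lra.
Qed.

(* The surrogates are not assumed measurable in their parameters, so the
   multipliers of the subproblem cannot be selected measurably.  The selected
   ones only satisfy the bounds, which depend on [xh], [r] and [q] alone. *)
Lemma multiplier_selection : exists lam : T -> 'rV[R]_J, exists nu : T -> 'rV[R]_I,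
  exists v : T -> V,
  [/\ random_vector lam, random_vector nu, random_vector v,
      forall w, subdiff u (xh w) (v w) &
  forall w,
  [/\ (forall j, 0 <= lam w 0 j <= M) /\ (forall i, 0 <= nu w 0 i <= M),
    enorm (gU (xh w) + \sum_j lam w 0 j *: dg j (xh w) + \sum_i nu w 0 i *: dh i (xh w) + v w) <= r w,
    - q w <= \sum_j lam w 0 j * g j (xh w) & 0 <= \sum_i nu w 0 i * h i (xh w)]].
Proof.
have cS : compact_multifun S.
  move=> w; split.
    have clS : closed (S w).
      rewrite -[S w]setCK; apply: open_closedC; rewrite openE => y /S_near.
      move=> [[A B] /= [nA nB] H]; rewrite /interior /=; apply: filterS nA => y' Ay'.
      by apply: (H (y', theta w)) => //; split => //=; exact: nbhs_singleton.
    have [N SN] : exists N : R, S w `<=` [set y : YT | forall k, `[- N, N]%classic (y 0 k)].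
      pose N := `|M| + `|r w| + enorm (gU (xh w)) + \sum_j `|M| * enorm (dg j (xh w))
        + \sum_i `|M| * enorm (dh i (xh w)).
      have Sg0 : 0 <= \sum_j `|M| * enorm (dg j (xh w)).
        by apply: sumr_ge0 => j _; rewrite mulr_ge0 ?enorm_ge0.
      have Sh0 : 0 <= \sum_i `|M| * enorm (dh i (xh w)).
        by apply: sumr_ge0 => j _; rewrite mulr_ge0 ?enorm_ge0.
      have gU0 := enorm_ge0 (gU (xh w)).
      have MN : `|M| <= N by rewrite /N -!addrA lerDl !addr_ge0.
      exists N => y [_ [[l1 l2] [n1 n2] H1 _ _]].
      have lM j : `|pl (y, theta w) 0 j| <= `|M|.
        by rewrite ger0_norm// (le_trans (l2 j))// ler_norm.
      have nM j : `|pn (y, theta w) 0 j| <= `|M|.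
        by rewrite ger0_norm// (le_trans (n2 j))// ler_norm.
      suff yN k : `|y 0 k| <= N by move=> k; rewrite /= in_itv /= -ler_norml yN.
      rewrite -(fintype.splitK k); case: (fintype.split k) => [k1|k1] /=.
        rewrite -(fintype.splitK k1); case: (fintype.split k1) => [k2|k2] /=.
          by have := lM k2; rewrite /pl /= !mxE => /le_trans; apply.
        by have := nM k2; rewrite /pn /= !mxE => /le_trans; apply.
      have -> : y 0 (rshift (J + I) k1) = (pv (y, theta w)) 0 k1 by rewrite /pv /= mxE.
      apply: le_trans (coord_le_enorm _ _) _.
      move: H1; rewrite /res theta_x theta_r.
      set sl := \sum_j _ *: _; set sn := \sum_i _ *: _ => H1.
      have e1 : enorm sl <= \sum_j `|M| * enorm (dg j (xh w)).
        apply: le_trans (enorm_sum _) _; apply: ler_sum => j _.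
        by rewrite enormZ ler_wpM2r ?enorm_ge0.
      have e2 : enorm sn <= \sum_i `|M| * enorm (dh i (xh w)).
        apply: le_trans (enorm_sum _) _; apply: ler_sum => j _.
        by rewrite enormZ ler_wpM2r ?enorm_ge0.
      have r1 := ler_norm (r w).
      exact: (residual_bound H1 r1 e1 e2 (normr_ge0 M)).
    have -> : S w = [set y : YT | forall k, `[- N, N]%classic (y 0 k)] `&` S w.
      by apply/esym/setIidPr.
    apply: compact_closedI => //.
    by apply: (@rV_compact R _ (fun=> `[- N, N]%classic)) => k; exact: segment_compact.
  have [lam [nu [v [[bl bn] sv H1 H2 H3]]]] := ex w.
  pose y : YT := row_mx (row_mx (\row_j lam j) (\row_i nu i)) v.
  exists y.
  have yl j : pl (y, theta w) 0 j = lam j by rewrite /pl /y /= !row_mxKl mxE.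
  have yn i : pn (y, theta w) 0 i = nu i by rewrite /pn /y /= row_mxKl row_mxKr mxE.
  have yv : pv (y, theta w) = v by rewrite /pv /y /= row_mxKr.
  split; first by rewrite yv.
  split.
  - by split=> j; rewrite yl; have /andP[] := bl j.
  - by split=> j; rewrite yn; have /andP[] := bn j.
  - rewrite /res theta_x theta_r yv.
    under eq_bigr do rewrite yl.
    by under [X in enorm (_ + X + _)]eq_bigr do rewrite yn.
  - by rewrite theta_x theta_q; under eq_bigr do rewrite yl.
  - by rewrite theta_x; under eq_bigr do rewrite yn.
have [s ms sS] := measurable_selection cS (closed_graph_measurable mtheta S_near).
exists (fun w => pl (s w, theta w)), (fun w => pn (s w, theta w)), (fun w => pv (s w, theta w)).
split.
- by move=> j; apply: (eq_measurable_fun (fun w => s w 0 (lshift n (lshift I j)))) => // w _; rewrite !mxE.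
- by move=> j; apply: (eq_measurable_fun (fun w => s w 0 (lshift n (rshift J j)))) => // w _; rewrite !mxE.
- by move=> j; apply: (eq_measurable_fun (fun w => s w 0 (rshift (J + I) j))) => // w _; rewrite !mxE.
- by move=> w; have [] := sS w.
move=> w; have [_ [[l1 l2] [n1 n2] H1 H2 H3]] := sS w; split.
- by split => k; rewrite ?l1 ?l2 ?n1 ?n2.
- by move: H1; rewrite /res theta_x theta_r.
- by move: H2; rewrite theta_x theta_q.
- by move: H3; rewrite theta_x.
Qed.

End MultiplierSelection.

(** * The objective *)

(** With the convention that [+oo - +oo] is [-oo], a finite integral forces the positive and the
    negative part to have finite integrals. *)
Lemma integrable_of_fin_num d (T : measurableType d) (R : realType)
    (mu : {measure set T -> \bar R}) (f : T -> \bar R) : measurable_fun setT f ->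
  (\int[mu]_x f x)%E \is a fin_num -> mu.-integrable setT f.
Proof.
move=> mf; rewrite integralE => ffin.
have p0 : (0 <= \int[mu]_x f^\+ x)%E by apply: integral_ge0 => x _; exact: funepos_ge0.
have n0 : (0 <= \int[mu]_x f^\- x)%E by apply: integral_ge0 => x _; exact: funeneg_ge0.
have : (\int[mu]_x f^\+ x + \int[mu]_x f^\- x < +oo)%E.
  move: ffin p0 n0.
  by case: (\int[mu]_x f^\+ x)%E => [a| |] //; case: (\int[mu]_x f^\- x)%E => [b| |] // *; rewrite -EFinD ltry.
rewrite -ge0_integralD//; [|exact: measurable_funepos|exact: measurable_funeneg].
move=> H; apply/integrableP; split => //; apply: le_lt_trans H.
by rewrite le_eqVlt; apply/orP; left; apply/eqP; apply: eq_integral => x _; rewrite -[RHS]/((f^\+ \+ f^\-)%E x) -fune_abse.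
Qed.

Lemma squeeze_continuous (R : realType) (Z : topologicalType) (F N : Z -> R) z :
  {for z, continuous N} -> N z = 0 -> (forall y, `|F y - F z| <= N y) ->
  {for z, continuous F}.
Proof.
move=> cN Nz bnd; apply/cvgrPdist_le => e e0.
have /cvgrPdist_le/(_ _ e0) := cN.
apply: filterS => y; rewrite Nz sub0r normrN => Hy.
by rewrite distrC; apply: le_trans (bnd y) _; apply: le_trans (ler_norm _) Hy.
Qed.

Lemma lip_continuous (R : realType) n m (L : R) (f : 'rV[R]_n -> 'rV[R]_m) :
  (forall x y, enorm (f x - f y) <= L * enorm (x - y)) -> continuous f.
Proof.
move=> lip x; apply: continuous_rV => i.
apply: (@squeeze_continuous R _ (fun y => f y 0 i) (fun y => L * enorm (y - x)) x).
- apply: (@continuous_at_comp _ R R (fun a : R => L * a) (fun y : 'rV[R]_n => enorm (y - x))).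
    exact: mulrl_continuous.
  apply: continuous_enorm.
  by apply: (@continuousB R _ _ idfun (fun _ => x) x); [by move=> ?|exact: cst_continuous].
- by rewrite subrr enorm0 mulr0.
- move=> y; have := coord_le_enorm (f y - f x) i.
  by rewrite !mxE => /le_trans; apply; exact: lip.
Qed.

Lemma sqr_enorm_comb (R : realType) n (a b : R) (p q : 'rV[R]_n) :
  enorm (a *: p + b *: q) ^+ 2 <= 2 * a ^+ 2 * enorm p ^+ 2 + 2 * b ^+ 2 * enorm q ^+ 2.
Proof.
apply: le_trans (sqr_enormD_le _ _) _.
by rewrite !enormZ !exprMn !real_normK ?num_real// !mulrA.
Qed.

Section Problem.
Context {R : realType} {n I J : nat} {d d' : measure_display}
  {T : measurableType d} {Xi : measurableType d'}.
Local Notation V := 'rV[R]_n.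
Variables (L sigma : R) (P : probability T R) (xi : {RV P >-> Xi}).
Variables (f : V -> Xi -> R) (u : V -> \bar R).
Variables (h : 'I_I -> V -> R) (g : 'I_J -> V -> R) (x1 : V).
Local Notation X := (Xset h g).
Hypothesis L0 : 0 <= L.
Hypothesis mf : forall y, measurable_fun setT (f y).
Hypothesis df : forall s y, differentiable (f ^~ s) y.
Hypothesis cu : econvex u.
Hypothesis XD : X `<=` Dset xi f u h g.
Hypothesis Fstar_fin : (-oo < Fstar xi f u h g)%E.
Hypothesis Xx1 : X x1.
Hypothesis lipgrad : forall y y', ('E_P[fun om => (enorm (grad (f ^~ (xi om)) y
   - grad (f ^~ (xi om)) y') ^+ 2)%R] <= (L ^+ 2 * enorm (y - y') ^+ 2)%:E)%E.
Hypothesis lipf1 : forall y y', exists c, ('E_P[fun om => `|f y (xi om) - f y' (xi om)|%R] <= c%:E)%E.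
Hypothesis var : forall y, X y ->
  ('E_P[fun om => (enorm (grad (f ^~ (xi om)) y - gradU xi f y) ^+ 2)%R] <= (sigma ^+ 2)%:E)%E.

Let F (y : V) (w : T) := f y (xi w).

Let mF y : measurable_fun setT (F y).
Proof. by apply: measurableT_comp; [exact: mf|exact: measurable_funPT]. Qed.

Let dF w y : differentiable (F ^~ w) y. Proof. exact: df. Qed.

Lemma Fobj_fin_num y : X y -> Fobj xi f u y \is a fin_num.
Proof.
move=> Xy; have [[Fy _] _] := XD Xy.
rewrite fin_real// Fy andbT; apply: lt_le_trans Fstar_fin _.
by apply: ereal_inf_lbound; exists y.
Qed.

Lemma dom_u y : X y -> (u y < +oo)%E.
Proof.
move=> Xy; have [[Fy _] _] := XD Xy; have := Fobj_fin_num Xy.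
by rewrite /Fobj fin_numD => /andP[_]; rewrite fin_numE => /andP[_]; rewrite ltey.
Qed.

(** At [x1] integrability is contained in the finiteness of the objective; the [L^1] Lipschitz bound
    carries it to every other point. *)
Lemma Lone_f y : Lone P (F y).
Proof.
have i1 : Lone P (F x1).
  apply: integrable_of_fin_num; first exact/measurable_EFinP.
  have := Fobj_fin_num Xx1; rewrite /Fobj fin_numD => /andP[+ _].
  by rewrite /Uobj unlock.
have [c Hc] := lipf1 y x1.
have [||iD _] := Lone_expectation _ _ Hc.
- by apply: measurableT_comp => //; apply: measurable_funB; exact: mF.
- by [].
have iN : Lone P (fun w => `|F x1 w|) by exact: integrable_norm.
apply: (Lone_le (mF y) (LoneD iD iN)) => w.
by rewrite -{1}(subrK (F x1 w) (F y w)) ler_normD.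
Qed.

Definition Ureal (y : V) : R := Ex P (F y).

Lemma UobjE y : Uobj xi f y = (Ureal y)%:E.
Proof. by rewrite /Uobj expectationE//; exact: Lone_f. Qed.

Let gU := gradU xi f.

Let gFx y := fun w => grad (f ^~ (xi w)) y.

Let mgF y : random_vector (gFx y).
Proof. exact: (random_vector_gradF (F := F) mF dF). Qed.

(** The variance bound at [x1] is used with [gU x1] as a mere constant vector, since its
    identification with the mean in [gradUE] depends on this lemma. Mean-squared smoothness then
    reaches the other points. *)
Lemma Ltwo_grad y : Ltwo P (gFx y).
Proof.
have L1 : Ltwo P (gFx x1).
  have mZ : random_vector (fun w => gFx x1 w - gU x1).
    by apply: random_vectorB; [exact: mgF|exact: random_vector_cst].
  apply: (Ltwo_cstB (v := gU x1)) => //.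
  have [||iZ _] := Lone_expectation _ _ (var Xx1).
  - by apply: measurable_funX; exact: measurable_enorm.
  - by move=> w; rewrite sqr_ge0.
  by [].
have [LD _] := expectation_grad_diff mF dF lipgrad y x1.
rewrite (_ : gFx y = (fun w => (gFx y w - gFx x1 w) + gFx x1 w)); first exact: LtwoD.
by apply/funext => w; rewrite subrK.
Qed.

Lemma gradUE y : gU y = mean P (gFx y).
Proof.
rewrite /gU /gradU (_ : (fun y => fine (Uobj xi f y)) = Ureal).
  exact: (grad_expectation mF dF L0 lipgrad Lone_f Ltwo_grad y).
by apply/funext => x; rewrite UobjE.
Qed.

Lemma gradU_lip x y : enorm (gU x - gU y) <= L * enorm (x - y).
Proof. rewrite !gradUE; exact: (mean_grad_lip mF dF L0 lipgrad Ltwo_grad x y). Qed.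

Lemma gradU_continuous : continuous gU.
Proof. exact: lip_continuous gradU_lip. Qed.

Lemma Ureal_descent x v : Ureal (x + v) <= Ureal x + dotv (gU x) v + L / 2 * enorm v ^+ 2.
Proof.
have := expectation_taylor mF dF L0 lipgrad Lone_f Ltwo_grad x v.
by rewrite -gradUE -/(Ureal _) -/(Ureal _) ler_norml => /andP[_]; lra.
Qed.

(** The vector is [(1 - b) a] plus the centred version of [b (gFx x - gU x) + (1 - b) (gFx x - gFx
    y)]. The first summand carries the sampling noise with the small weight [b], the second is
    controlled by the distance of [x] and [y]. *)
Lemma variance_step (a x y : V) (b : R) : X x ->
  Lone P (fun w => enorm ((1 - b) *: a + (gFx x w - gU x) - (1 - b) *: (gFx y w - gU y)) ^+ 2) /\
  Ex P (fun w => enorm ((1 - b) *: a + (gFx x w - gU x) - (1 - b) *: (gFx y w - gU y)) ^+ 2)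
   <= (1 - b) ^+ 2 * enorm a ^+ 2 + 2 * b ^+ 2 * sigma ^+ 2
      + 2 * (1 - b) ^+ 2 * L ^+ 2 * enorm (x - y) ^+ 2.
Proof.
move=> Xx.
have Lx := Ltwo_grad x; have Ly := Ltwo_grad y.
have Lc : Ltwo P (fun w => gFx x w - gU x) := LtwoB Lx (Ltwo_cst P (gU x)).
have [LD leD] := expectation_grad_diff mF dF lipgrad x y.
pose Z w := b *: (gFx x w - gU x) + (1 - b) *: (gFx x w - gFx y w).
have L1 : Ltwo P (fun w => b *: (gFx x w - gU x)) by exact: (LtwoZ b Lc).
have L2 : Ltwo P (fun w => (1 - b) *: (gFx x w - gFx y w)) by exact: (LtwoZ (1 - b) LD).
have LZ : Ltwo P Z by exact: (LtwoD L1 L2).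
have mZ : mean P Z = (1 - b) *: (gU x - gU y).
  rewrite /Z (meanD L1 L2) (meanZ b Lc) (meanZ (1 - b) LD) (meanB Lx (Ltwo_cst P (gU x))).
  by rewrite (meanB Lx Ly) mean_cst -(gradUE x) -(gradUE y) subrr scaler0 add0r.
have E w : (1 - b) *: a + (gFx x w - gU x) - (1 - b) *: (gFx y w - gU y)
    = (1 - b) *: a + (Z w - mean P Z).
  by rewrite mZ /Z; apply/rowP => i; rewrite !mxE; ring.
rewrite (_ : (fun w => _) = (fun w => enorm ((1 - b) *: a + (Z w - mean P Z)) ^+ 2)); last first.
  by apply/funext => w; rewrite E.
split.
  exact: (LtwoD (Ltwo_cst P ((1 - b) *: a)) (LtwoB LZ (Ltwo_cst P (mean P Z)))).2.
apply: le_trans (Ex_sqr_centered _ LZ) _.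
rewrite enormZ exprMn real_normK ?num_real// -addrA lerD2l.
have iV := Lone_expectation _ _ (var Xx).
have [||i1 le1] := iV.
- by apply: measurable_funX; apply: measurable_enorm; exact: Lc.1.
- by move=> w; rewrite sqr_ge0.
apply: (@le_trans _ _ (Ex P (fun w => 2 * b ^+ 2 * enorm (gFx x w - gU x) ^+ 2
    + 2 * (1 - b) ^+ 2 * enorm (gFx x w - gFx y w) ^+ 2))).
  apply: (Ex_le LZ.2 (LoneD (LoneZ (2 * b ^+ 2) i1) (LoneZ (2 * (1 - b) ^+ 2) LD.2))).
  by move=> w; exact: sqr_enorm_comb.
have E2 := etrans (ExD (LoneZ (2 * b ^+ 2) i1) (LoneZ (2 * (1 - b) ^+ 2) LD.2))
  (congr2 +%R (ExZ (2 * b ^+ 2) i1) (ExZ (2 * (1 - b) ^+ 2) LD.2)).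
rewrite {}E2.
have b0 (c : R) : 0 <= 2 * c ^+ 2 by rewrite mulr_ge0// sqr_ge0.
by apply: (lerD (ler_wpM2l (b0 b) le1)); rewrite -[leRHS]mulrA; exact: (ler_wpM2l (b0 (1 - b)) leD).
Qed.

End Problem.

(** * The history of the samples and one step of the estimator *)

Section Filtration.
Context {R : realType} {d d' : measure_display} {T : measurableType d}
  {Xi : measurableType d'}.
Variable P : probability T R.
Variables (xi : {RV P >-> Xi}) (xis : nat -> {RV P >-> Xi}).

(** Spelled as the generator inside [g_sigma_preimage], so that the measurability clause of [costa]
    is adaptedness of [xh t] by conversion. The index shift matches samples that start at 1. *)
Definition history t : set (set T) :=
  \big[setU/set0]_(i < t) preimage_set_system setT (xis i.+1 : T -> Xi) measurable.

Definition adapted t m (Y : T -> 'rV[R]_m) :=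
  @random_vector R _ (g_sigma_algebraType (history t)) m Y.

Lemma history_measurable t : history t `<=` measurable.
Proof.
move=> A /bigsetU_ordP[k [D mD <-]]; rewrite setTI.
by rewrite -[X in measurable X]setTI; exact: measurable_funPT.
Qed.

Lemma history_le s t : (s <= t)%N -> <<s history s >> `<=` <<s history t >>.
Proof.
move=> st; apply: sub_sigma_algebra2 => A /bigsetU_ordP[k Ak].
by apply/bigsetU_ordP; exists (widen_ord st k).
Qed.

Lemma adapted_le s t m (Y : T -> 'rV[R]_m) : (s <= t)%N -> adapted s Y -> adapted t Y.
Proof. by move=> st mY i _ B mB; apply: (history_le st); exact: (mY i measurableT B mB). Qed.

Lemma adapted_measurable t m (Y : T -> 'rV[R]_m) : adapted t Y -> random_vector Y.
Proof.
move=> mY i _ B mB; apply: (smallest_sub _ (@history_measurable t)); last exact: (mY i measurableT B mB).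
exact: sigma_algebra_measurable.
Qed.

Lemma sample_measurable t :
  measurable_fun setT (xis t.+1 : g_sigma_algebraType (history t.+1) -> Xi).
Proof.
move=> _ B mB; rewrite setTI; apply: sub_sigma_algebra; apply/bigsetU_ordP.
by exists ord_max; exists B => //; rewrite setTI.
Qed.

Context {n : nat}.
Local Notation V := 'rV[R]_n.
Variables (f : V -> Xi -> R) (gU : V -> V) (X : set V) (L sigma : R).
Hypothesis mf : forall y, measurable_fun setT (f y).
Hypothesis df : forall s y, differentiable (f ^~ s) y.
Hypothesis cgU : continuous gU.
Hypothesis iid : iid_samples xi xis.
Hypothesis var : forall (a x y : V) (b : R), X x ->
  Lone P (fun w => enorm ((1 - b) *: a + (grad (f ^~ (xi w)) x - gU x)
                           - (1 - b) *: (grad (f ^~ (xi w)) y - gU y)) ^+ 2) /\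
  Ex P (fun w => enorm ((1 - b) *: a + (grad (f ^~ (xi w)) x - gU x)
                           - (1 - b) *: (grad (f ^~ (xi w)) y - gU y)) ^+ 2)
   <= (1 - b) ^+ 2 * enorm a ^+ 2 + 2 * b ^+ 2 * sigma ^+ 2
      + 2 * (1 - b) ^+ 2 * L ^+ 2 * enorm (x - y) ^+ 2.

Lemma random_vector_continuous d0 (T0 : measurableType d0) (F : V -> V) (Y : T0 -> V) :
  continuous F -> random_vector Y -> random_vector (fun w => F (Y w)).
Proof.
move=> cF mY i; apply: (measurable_continuous_rV (F := fun y => F y 0 i)) => // y.
exact: (continuous_comp (cF y) (@coord_continuous R 1 n 0 i (F y))).
Qed.

Lemma adapted_grad t (Y : T -> V) : adapted t Y ->
  adapted t.+1 (fun w => grad (f ^~ (xis t.+1 w)) (Y w)).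
Proof.
move=> mY; apply: (@random_vector_grad R _ (g_sigma_algebraType (history t.+1)) n
  (fun y w => f y (xis t.+1 w)) Y) => //.
  by move=> y; apply: (measurableT_comp (mf y)); exact: sample_measurable.
exact: (adapted_le (leqnSn t) mY).
Qed.

(* Conditionally on the first [t] samples, [A], [Y0] and [Y1] are constants, and
   the one-sample bound [var] applies. *)
Lemma estimator_step t (A Y0 Y1 : T -> V) b : adapted t A -> adapted t Y0 -> adapted t Y1 ->
  (forall w, X (Y1 w)) -> Lone P (fun w => enorm (A w) ^+ 2) ->
  Lone P (fun w => enorm (Y1 w - Y0 w) ^+ 2) ->
  let N w := (1 - b) *: A w + (grad (f ^~ (xis t.+1 w)) (Y1 w) - gU (Y1 w))
               - (1 - b) *: (grad (f ^~ (xis t.+1 w)) (Y0 w) - gU (Y0 w)) in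
  Lone P (fun w => enorm (N w) ^+ 2) /\
  Ex P (fun w => enorm (N w) ^+ 2) <=
    (1 - b) ^+ 2 * Ex P (fun w => enorm (A w) ^+ 2) + 2 * b ^+ 2 * sigma ^+ 2
      + 2 * (1 - b) ^+ 2 * L ^+ 2 * Ex P (fun w => enorm (Y1 w - Y0 w) ^+ 2).
Proof.
move=> mA mY0 mY1 XY iA iY N.
pose T' := g_sigma_algebraType (history t).
pose Phi (z : T' * Xi) : V := (1 - b) *: A z.1 + (grad (f ^~ z.2) (Y1 z.1) - gU (Y1 z.1))
               - (1 - b) *: (grad (f ^~ z.2) (Y0 z.1) - gU (Y0 z.1)).
have fst_rv (Y : T -> V) : adapted t Y -> random_vector (fun z : T' * Xi => Y z.1).
  by move=> mY i; apply: (measurableT_comp (mY i)); exact: measurable_fst.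
have grad_rv (Y : T -> V) : adapted t Y ->
    random_vector (fun z : T' * Xi => grad (f ^~ z.2) (Y z.1) - gU (Y z.1)).
  move=> mY; apply: random_vectorB.
    apply: (@random_vector_grad R _ (T' * Xi)%type n (fun y z => f y z.2) (fun z => Y z.1)) => //.
      by move=> y; apply: (measurableT_comp (mf y)); exact: measurable_snd.
    exact: fst_rv.
  exact: (random_vector_continuous cgU (fst_rv _ mY)).
have mPhi : random_vector Phi.
  apply: random_vectorB; last exact: (random_vectorZ _ (grad_rv _ mY0)).
  exact: (random_vectorD (random_vectorZ _ (fst_rv _ mA)) (grad_rv _ mY1)).
have mPhi2 : measurable_fun setT (fun z => (enorm (Phi z) ^+ 2)%:E).
  by apply/measurable_EFinP; apply: measurable_funX; exact: measurable_enorm.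
have Phi0 z : (0 <= (enorm (Phi z) ^+ 2)%:E)%E by rewrite lee_fin sqr_ge0.
have mN : measurable_fun setT (fun w => enorm (N w) ^+ 2).
  apply: measurable_funX; apply: measurable_enorm; apply: (@adapted_measurable t.+1).
  have gr (Y : T -> V) : adapted t Y -> adapted t.+1 (fun w => grad (f ^~ (xis t.+1 w)) (Y w) - gU (Y w)).
    move=> mY; apply: random_vectorB; first exact: adapted_grad.
    exact: (random_vector_continuous cgU (adapted_le (leqnSn t) mY)).
  apply: random_vectorB; last exact: (random_vectorZ _ (gr _ mY0)).
  exact: (random_vectorD (random_vectorZ _ (adapted_le (leqnSn t) mA)) (gr _ mY1)).
set bound := (_ + _ in X in _ /\ X).
apply: Lone_expectation => //; first by move=> w; rewrite sqr_ge0.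
rewrite unlock.
(* The sample [xis t.+1] is replaced by [xi] on an independent copy of the probability space, the
   past being frozen. *)
have -> : (\int[P]_w (enorm (N w) ^+ 2)%:E = \int[P]_w \int[P]_w' (enorm (Phi (w, xi w')) ^+ 2)%:E)%E.
  apply: (indep_tonelli (Phi := fun z => (enorm (Phi z) ^+ 2)%:E) (Y := xis t.+1) (xi := xi)
    (@history_measurable t)) => // B C FB mC.
  exact: (samples_indep iid FB mC).
have iB1 := LoneZ ((1 - b) ^+ 2) iA.
have iB2 : Lone P (fun _ => 2 * b ^+ 2 * sigma ^+ 2) := Lone_cst P _.
have iB3 := LoneZ (2 * (1 - b) ^+ 2 * L ^+ 2) iY.
pose B w := (1 - b) ^+ 2 * enorm (A w) ^+ 2 + 2 * b ^+ 2 * sigma ^+ 2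
      + 2 * (1 - b) ^+ 2 * L ^+ 2 * enorm (Y1 w - Y0 w) ^+ 2.
have iB : Lone P B := LoneD (LoneD iB1 iB2) iB3.
have EB : Ex P B = bound.
  have := ExD (LoneD iB1 iB2) iB3; rewrite (ExD iB1 iB2) Ex_cst (ExZ _ iA) (ExZ _ iY).
  by [].
rewrite -EB -expectationE// unlock.
apply: ge0_le_integral => //.
- by move=> w _; exact: integral_ge0.
- have mz : measurable_fun setT (fun z : T' * T => (z.1, xi z.2) : T' * Xi).
    apply: measurable_fun_pair; first exact: measurable_fst.
    by apply: measurableT_comp; [exact: measurable_funPT|exact: measurable_snd].
  have mF := @measurable_fun_fubini_tonelli_F _ _ T' T R P _ (measurableT_comp mPhi2 mz) (fun z => Phi0 _).
  have mid : measurable_fun setT (id : T -> T').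
    move=> _ C mC; rewrite setTI.
    by apply: (smallest_sub _ (@history_measurable t)) mC; exact: sigma_algebra_measurable.
  exact: (measurableT_comp mF mid).
- by apply/measurable_EFinP; exact: (Lone_measurable iB).
move=> w _; have [i1 le1] := var (A w) (Y0 w) b (XY w).
have := expectationE i1; rewrite unlock => E1.
by rewrite [leLHS]E1 lee_fin.
Qed.

End Filtration.

(** * The deterministic rate *)

Section Rate.
Context {R : realType}.
Implicit Types (kbar w c L sigma : R).

Definition croot (x : R) : R := x `^ 3^-1.

Lemma croot_ge0 x : 0 <= croot x. Proof. exact: powR_ge0. Qed.

Lemma croot_gt0 x : 0 < x -> 0 < croot x. Proof. exact: powR_gt0. Qed.

Lemma crootK x : 0 <= x -> croot x ^+ 3 = x.
Proof. by move=> x0; rewrite -powR_mulrn ?croot_ge0// -powRrM mulVf// powRr1. Qed.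

Lemma croot_le x y : 0 <= x -> x <= y -> croot x <= croot y.
Proof.
move=> x0 xy; rewrite -(@ler_pXn2r _ 3)// ?nnegrE ?croot_ge0//.
by rewrite !crootK// (le_trans x0).
Qed.

Lemma croot_sqr x : 0 <= x -> x `^ (2 / 3) = croot x ^+ 2.
Proof. by move=> x0; rewrite -powR_mulrn ?croot_ge0// -powRrM mulrC. Qed.

Lemma etaE kbar w t : eta kbar w t = kbar / croot (w + t%:R).
Proof. by []. Qed.

(** * The energy recursion for abstract sequences [E] and [D], standing for the second moments of
    [e_t] and [d_t] *)

Section Recursion.
Variables (kbar w c L sigma B : R) (E D : nat -> R).
Hypotheses (w0 : 0 < w) (c0 : 0 < c) (k0 : 0 < kbar) (kw : kbar <= croot w) (L0 : 0 < L).
Hypothesis c_ub : c <= croot w ^+ 2 / (4 * kbar ^+ 2).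
Hypothesis c_lb : 8 * L ^+ 2 + 1 / (3 * kbar ^+ 3) < c.
Local Notation et := (eta kbar w).
Local Notation bt := (beta kbar w c).

Let wt0 t : 0 < w + t%:R.
Proof. by rewrite ltr_wpDr. Qed.

Lemma eta_gt0 t : 0 < et t.
Proof. by rewrite divr_gt0// croot_gt0. Qed.

Lemma eta_le1 t : et t <= 1.
Proof.
rewrite etaE ler_pdivrMr ?croot_gt0// mul1r (le_trans kw)//.
by apply: croot_le; [exact: ltW|rewrite lerDl].
Qed.

Lemma eta_le_eta s t : (s <= t)%N -> et t <= et s.
Proof.
move=> st; rewrite !etaE ler_pM2l// lef_pV2 ?posrE ?croot_gt0//.
by apply: croot_le; [exact: ltW|rewrite lerD2l ler_nat].
Qed.

Lemma eta_cube t : et t ^+ 3 = kbar ^+ 3 / (w + t%:R).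
Proof. by rewrite etaE expr_div_n crootK// ltW. Qed.

(** Since [eta] is at most [kbar / croot w], the upper bound on [c] even keeps [beta] below
    [1 / 4]. *)
Lemma beta_itv t : 0 <= bt t <= 1.
Proof.
have e0 := eta_gt0 t.-1; rewrite /beta mulr_ge0 ?sqr_ge0 ?(ltW c0)//=.
have w1 := croot_gt0 w0.
have : et t.-1 ^+ 2 <= (kbar / croot w) ^+ 2.
  rewrite ler_pXn2r ?nnegrE ?(ltW e0)// ?divr_ge0 ?croot_ge0 ?(ltW k0)//.
  rewrite etaE ler_pM2l// lef_pV2 ?posrE ?croot_gt0//.
  by apply: croot_le; [exact: ltW|rewrite lerDl].
move=> H; apply: le_trans (ler_pM (ltW c0) (sqr_ge0 _) c_ub H) _.
rewrite (_ : _ * _ = 1 / 4); first by lra.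
by field; rewrite !gt_eqF.
Qed.

(* [1 / eta_t - 1 / eta_(t-1) <= eta_(t-1)^2 / (3 kbar^3) <= eta_t / (3 kbar^3)];
   the last step fails at [t = 1]. *)
Lemma inv_eta_diff t : (2 <= t)%N -> (et t)^-1 - (et t.-1)^-1 <= et t / (3 * kbar ^+ 3).
Proof.
move=> t2; have t1 : t.-1%:R = t%:R - 1 :> R by rewrite -subn1 natrB// (leq_trans _ t2).
have T2 : 2 <= t%:R :> R by rewrite (ler_nat _ 2).
set q := croot (w + t%:R); set p := croot (w + t.-1%:R).
have q0 : 0 < q by exact: croot_gt0.
have p0 : 0 < p by exact: croot_gt0.
have q3 : q ^+ 3 = w + t%:R by rewrite crootK// ltW.
have p3 : p ^+ 3 = w + t%:R - 1 by rewrite crootK; [rewrite t1; ring|exact: ltW].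
have pq : p <= q by apply: croot_le; [exact: ltW|rewrite lerD2l ler_nat leq_pred].
have r0 := croot_gt0 w0; have kr := kw; set r := croot w in kr r0.
have r3 : r ^+ 3 = w by rewrite crootK// ltW.
(* After cubing this reads [w (w + t) <= (w + t - 1)^2]; the difference is [w (t - 2) + (t - 1)^2],
   whence the restriction [2 <= t]. *)
have rq : r * q <= p ^+ 2.
  rewrite -(@ler_pXn2r _ 3)// ?nnegrE ?sqr_ge0 ?mulr_ge0 ?(ltW r0) ?(ltW q0)//.
  rewrite exprMn r3 q3 exprAC p3.
  have : 0 <= w * (t%:R - 2) by rewrite mulr_ge0 ?(ltW w0)// subr_ge0.
  have : 0 <= (t%:R - 1) ^+ 2 :> R by exact: sqr_ge0.
  nra.
have kq : kbar * q <= p ^+ 2 by apply: le_trans rq; rewrite ler_pM2r.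
have d3 : 3 * p ^+ 2 * (q - p) <= 1.
  rewrite [leRHS](_ : _ = (q ^+ 2 + q * p + p ^+ 2) * (q - p)); last first.
    have : q ^+ 3 - p ^+ 3 = 1 by rewrite q3 p3; ring.
    by move=> <-; ring.
  rewrite ler_wpM2r ?subr_ge0//.
  have : p * p <= q * q by rewrite ler_pM// ltW.
  have : p * p <= q * p by rewrite ler_pM2r.
  rewrite !expr2; lra.
rewrite !etaE -/q -/p !invf_div -mulrBl ler_pdivrMr//.
rewrite (_ : kbar / q / (3 * kbar ^+ 3) * kbar = (3 * (kbar * q))^-1); last first.
  by field; rewrite !gt_eqF.
rewrite -[leRHS]div1r ler_pdivlMr ?mulr_gt0// mulrC.
apply: le_trans d3; rewrite ler_wpM2r ?subr_ge0//.
by rewrite ler_pM2l.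
Qed.

(** [eta_t^3 = kbar^3 / (w + t)] is a harmonic term, and [1 / (a + 1) <= ln (a + 1) - ln a]
    telescopes. The absolute values make the bound nonnegative for every [w] and [T]. *)
Lemma sum_eta_cube T : \sum_(2 <= t < T.+1) et t ^+ 3 <= kbar ^+ 3 * `|ln (w + T%:R)| + kbar ^+ 3 * `|ln (w + 1)|.
Proof.
have k3 : 0 < kbar ^+ 3 by rewrite exprn_gt0.
have key : (1 <= T)%N ->
    \sum_(2 <= t < T.+1) et t ^+ 3 <= kbar ^+ 3 * (ln (w + T%:R) - ln (w + 1)).
  elim: T => // -[_ _|T IH _]; first by rewrite big_geq// subrr mulr0.
  rewrite big_nat_recr//=; have := IH isT.
  set a := w + T.+1%:R; have a0 : 0 < a by exact: wt0.
  have -> : w + T.+2%:R = a + 1 by rewrite /a -[in LHS]natr1 addrA.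
  have b0 : 0 < a + 1 by rewrite addr_gt0.
  rewrite eta_cube (_ : w + T.+2%:R = a + 1); last by rewrite /a -[in LHS]natr1 addrA.
  have H : (a + 1)^-1 <= ln (a + 1) - ln a.
    have := @le_ln1Dx R (- (a + 1)^-1).
    rewrite (_ : 1 + - (a + 1)^-1 = a / (a + 1)); last by field; rewrite gt_eqF.
    rewrite ln_div ?posrE// ltrNl opprK invf_lt1// => /(_ _) H.
    have /H : 1 < a + 1 by rewrite ltrDr.
    lra.
  have := ler_wpM2l (ltW k3) H; lra.
case: T key => [_|T key]; last first.
  apply: le_trans (key isT) _; rewrite -mulrDr ler_pM2l//; have := ler_norm (ln (w + T.+1%:R)).
  have := ler_norm (- ln (w + 1)); rewrite normrN; lra.
by rewrite big_geq// addr_ge0// mulr_ge0// ltW.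
Qed.

Hypotheses (E0 : forall t, (1 <= t)%N -> 0 <= E t) (D0 : forall t, (1 <= t)%N -> 0 <= D t).
Hypothesis B0 : 0 <= B.
Hypothesis E1 : E 1%N <= 2 * sigma ^+ 2.
Hypothesis Erec : forall t, (1 <= t)%N ->
  E t.+1 <= (1 - bt t.+1) ^+ 2 * E t + 2 * bt t.+1 ^+ 2 * sigma ^+ 2
            + 2 * (1 - bt t.+1) ^+ 2 * L ^+ 2 * (et t ^+ 2 * D t).
Hypothesis descent : forall T, (1 <= T)%N ->
  \sum_(1 <= t < T.+1) et t / 2 * D t <= B + \sum_(1 <= t < T.+1) et t * E t.

Let aL : 0 < L ^+ 2. Proof. by rewrite exprn_gt0. Qed.

(* The energy [E_t / eta_(t-1)] decreases at rate [8 L^2 eta_t E_t], which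
   beats the [4 L^2 eta_t E_t] fed back through [D] by the descent inequality. *)
Lemma estimator_sum T : (1 <= T)%N ->
  8 * L ^+ 2 * \sum_(2 <= t < T.+1) et t * E t + E T.+1 / et T <=
  E 2%N / et 1%N + 2 * c ^+ 2 * sigma ^+ 2 * \sum_(2 <= t < T.+1) et t ^+ 3
    + 2 * L ^+ 2 * \sum_(2 <= t < T.+1) et t * D t.
Proof.
elim: T => // -[_ _|T IH _]; first by rewrite !big_geq// !mulr0 add0r !addr0.
rewrite !(@big_nat_recr _ _ _ T.+2 2)//=; have {IH} := IH isT.
set SE := \sum_(2 <= t < T.+2) _; set S3 := \sum_(2 <= t < T.+2) et t ^+ 3.
set SD := \sum_(2 <= t < T.+2) _ * D t.
have := Erec (isT : (1 <= T.+2)%N); have := inv_eta_diff (isT : (2 <= T.+2)%N) => /=.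
have := beta_itv T.+3; rewrite {1}/beta.
set b := bt T.+3; have bE : b = c * et T.+2 ^+ 2 by [].
have e0 := eta_gt0 T.+2; set e := et T.+2 in bE e0 *.
set e' := et T.+1; have EE := E0 (isT : (1 <= T.+2)%N); have DD := D0 (isT : (1 <= T.+2)%N).
set X := E T.+2 in EE *; set Y := D T.+2 in DD *; set Z := E T.+3.
rewrite -/b => /andP[b0 b1] Hd Hr IH.
have sb : (1 - b) ^+ 2 <= 1 - b.
  by rewrite expr2 -[leRHS]mulr1 ler_wpM2l ?subr_ge0// gerDl oppr_le0.
have sb1 : (1 - b) ^+ 2 <= 1 by apply: le_trans sb _; rewrite gerDl oppr_le0.
have H1 : Z <= (1 - b) * X + 2 * b ^+ 2 * sigma ^+ 2 + 2 * L ^+ 2 * (e ^+ 2 * Y).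
  apply: le_trans Hr _; apply: lerD; first by rewrite lerD2r ler_wpM2r.
  have eY : 0 <= e ^+ 2 * Y := mulr_ge0 (sqr_ge0 _) DD.
  by rewrite (ler_wpM2r eY)// (ler_wpM2r (ltW aL))// ler_piMr.
have H2 : Z / e <= X / e - c * e * X + 2 * c ^+ 2 * e ^+ 3 * sigma ^+ 2 + 2 * L ^+ 2 * (e * Y).
  rewrite ler_pdivrMr//; apply: le_trans H1 _; rewrite bE le_eqVlt; apply/orP; left; apply/eqP.
  by field; rewrite gt_eqF.
have H3 : X / e - X / e' <= e / (3 * kbar ^+ 3) * X by rewrite -mulrBr mulrC ler_wpM2r.
(* The part [1 / (3 kbar^3)] of [c] pays for the change of denominator from [e'] to [e] in the
   energy; [8 L^2] is left as the rate of decrease. *)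
have H4 : (8 * L ^+ 2 + 1 / (3 * kbar ^+ 3)) * (e * X) <= c * (e * X).
  by rewrite ler_wpM2r ?(ltW c_lb)// mulr_ge0// ltW.
have E5 : e / (3 * kbar ^+ 3) * X = 1 / (3 * kbar ^+ 3) * (e * X) by rewrite div1r; ring.
rewrite E5 in H3; rewrite mulrDl in H4.
set k := 1 / (3 * kbar ^+ 3) * (e * X) in H3 H4.
rewrite !mulrDr.
move: H2 H3 H4 IH; set A1 := X / e; set A2 := X / e'; set A3 := Z / e; set A4 := E 2%N / _.
lra.
Qed.

Let K1 := 2 * sigma ^+ 2.
Let K' := 2 * B + 2 * et 1%N * K1.
Let KE2 := (K1 + 2 * sigma ^+ 2 + 2 * L ^+ 2 * K') / et 1%N.

(** Write [SE] and [SD] for the two weighted sums. Descent gives [SD <= K' + 2 SE]; inserted in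
    [estimator_sum], it uses up [4 L^2 SE] of the [8 L^2 SE], which bounds [SE], and
    [SE + SD <= K' + 3 SE]. The constants [K1], [K'] and [KE2] bound the quantities of the first
    step. *)
Lemma E_D_sum T : (1 <= T)%N ->
  \sum_(2 <= t < T.+1) et t * (E t + D t) <=
  K' + 3 * (KE2 + 2 * c ^+ 2 * sigma ^+ 2 * \sum_(2 <= t < T.+1) et t ^+ 3 + 2 * L ^+ 2 * K')
    / (4 * L ^+ 2).
Proof.
move=> T1; have e1 := eta_gt0 1; have e1' := eta_le1 1.
have E1K : E 1%N <= K1 by [].
have S1 : et 1%N * D 1%N <= K'.
  have := descent (isT : (1 <= 1)%N); rewrite !big_nat1 /K'.
  have := ler_wpM2l (ltW e1) E1K; lra.
have SDD : \sum_(2 <= t < T.+1) et t * D t <= K' + 2 * \sum_(2 <= t < T.+1) et t * E t.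
  have := descent T1; rewrite !(@big_ltn _ _ _ 1)//.
  have -> : \sum_(2 <= t < T.+1) et t / 2 * D t = (\sum_(2 <= t < T.+1) et t * D t) / 2.
    by rewrite mulr_suml; apply: eq_bigr => t _; ring.
  have := mulr_ge0 (ltW e1) (D0 (isT : (1 <= 1)%N)).
  have := ler_wpM2l (ltW e1) E1K; rewrite /K'; lra.
have E2 : E 2%N / et 1%N <= KE2.
  rewrite ler_pM2r ?invr_gt0//; apply: le_trans (Erec (isT : (1 <= 1)%N)) _.
  have /andP[b0 b1] := beta_itv 2; set b := bt 2 in b0 b1 *.
  have sb1 : (1 - b) ^+ 2 <= 1 by rewrite expr_le1 ?subr_ge0// gerDl oppr_le0.
  have sb : b ^+ 2 <= 1 by rewrite expr_le1.
  apply: lerD; first apply: lerD.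
  - by apply: le_trans E1K; rewrite ler_piMl// E0.
  - by rewrite ler_wpM2r ?sqr_ge0// ler_piMr.
  - apply: ler_pM.
    + by apply: mulr_ge0; [apply: mulr_ge0; [by []|exact: sqr_ge0]|exact: sqr_ge0].
    + exact: mulr_ge0 (sqr_ge0 _) (D0 (isT : (1 <= 1)%N)).
    + by rewrite (ler_wpM2r (ltW aL))// ler_piMr.
    + apply: le_trans S1; rewrite expr2 -mulrA ler_piMl//.
      exact: mulr_ge0 (ltW e1) (D0 (isT : (1 <= 1)%N)).
have SE := estimator_sum T1.
have ET : 0 <= E T.+1 / et T by rewrite divr_ge0 ?E0// ltW// eta_gt0.
rewrite (eq_bigr (fun t => et t * E t + et t * D t)) => [|t _]; last by rewrite mulrDr.
rewrite big_split /=; move: SE SDD.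
set a := \sum_(2 <= t < T.+1) et t * E t; set b := \sum_(2 <= t < T.+1) et t * D t.
set s3 := \sum_(2 <= t < T.+1) _ ^+ 3; set q := 2 * c ^+ 2 * sigma ^+ 2 * s3 => SE SDD.
have SDL := ler_wpM2l (ltW aL) SDD.
have : 4 * L ^+ 2 * a <= KE2 + q + 2 * L ^+ 2 * K' by move: SE SDL; lra.
rewrite mulrC -ler_pdivlMr ?mulr_gt0// => Ha.
rewrite -mulrA; lra.
Qed.

End Recursion.

(** The factor of [v] is of order [T^(2/3)]. For [T] of order [(K s)^3] with [s = eps^(-1/2) l] and
    [l = ln (e / eps)], it is a multiple of [K^2 l^2 / eps], while the right-hand side is
    logarithmic in [T] and at most [Q K l^2]. So [v] is a multiple of [eps / K], and the cube of [s]
    produces the third power of the logarithm. *)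
Lemma rate_choice kbar w Q0 Q1 kappa : 0 < w -> 0 < kbar -> 0 <= Q0 -> 0 <= Q1 -> 0 < kappa ->
  exists2 C : R, 0 < C & forall eps : R, 0 < eps < 1 -> exists T : nat,
  [/\ (2 <= T)%N, T%:R <= C * eps `^ (- (3 / 2)) * (ln (expR 1 / eps)) `^ 3 &
    forall v, v * (kbar / croot (w + T%:R) * (T%:R - 1)) <= Q0 + Q1 * `|ln (w + T%:R)| ->
      v <= kappa * eps].
Proof.
move=> w0 k0 Q00 Q10 kap0.
pose W := w + 3; pose Q := Q0 + 3 * Q1 * (W + 3).
have W3 : 3 <= W by rewrite /W lerDr ltW.
(* [K] is what the final comparison requires: it brings [Q W eps / (kbar K)] below [kappa eps]. *)
pose K := Num.max 1 (Q * W / (kbar * kappa)).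
have K1 : 1 <= K by rewrite le_max lexx.
have KQ : Q * W / (kbar * kappa) <= K by rewrite le_max lexx orbT.
exists (3 * K ^+ 3) => [|eps /andP[e0 e1]]; first by rewrite mulr_gt0// exprn_gt0//; lra.
pose l := ln (expR 1 / eps).
have lE : l = 1 - ln eps by rewrite /l ln_div ?posrE ?expR_gt0// expRK.
have le0 : ln eps <= 0 by apply: ln_le0; exact: ltW.
have l1 : 1 <= l by rewrite lE; lra.
pose r := eps `^ (- (1 / 2)).
have r0 : 0 < r by exact: powR_gt0.
have r2 : r ^+ 2 = eps^-1.
  by rewrite -powR_mulrn ?(ltW r0)// -powRrM (_ : - (1 / 2) * 2%:R = -1) ?powR_inv1 ?ltW//; field.
have r3 : r ^+ 3 = eps `^ (- (3 / 2)).
  by rewrite -powR_mulrn ?(ltW r0)// -powRrM (_ : - (1 / 2) * 3%:R = - (3 / 2)) //; field.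
have W0 : 0 < W by lra.
have K0 : 0 < K by exact: lt_le_trans ltr01 K1.
have l0 : 0 < l by exact: lt_le_trans ltr01 l1.
have r1 : 1 <= r.
  rewrite -(@ler_pXn2r _ 2)// ?nnegrE ?(ltW r0)// expr1n r2.
  by rewrite invf_ge1// ltW.
pose s := r * l.
have s1 : 1 <= s by rewrite /s -[leLHS]mulr1 ler_pM.
have s0 : 0 < s by exact: lt_le_trans ltr01 s1.
have Ks0 : 0 < K * s by exact: mulr_gt0.
pose N := (K * s) ^+ 3.
have Ks1 : 1 <= K * s by rewrite -[leLHS]mulr1 ler_pM.
have N1 : 1 <= N by rewrite exprn_ege1.
(* Two more than the integer part of [N], so that both [2 <= T] and [N <= T - 1] hold. *)
pose T := (Num.truncn N).+2.
have /andP[TN NT] := truncn_itv (le_trans ler01 N1).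
have TE : T%:R = (Num.truncn N)%:R + 2 :> R by rewrite /T -addn2 natrD.
have TN1 : N <= T%:R - 1 by rewrite TE; move: NT; rewrite -natr1; lra.
have TN3 : T%:R <= 3 * N by rewrite TE; lra.
exists T; split => //.
  apply: le_trans TN3 _; rewrite -/l powR_mulrn; last by lra.
  by rewrite -r3 /N /s !exprMn !mulrA.
move=> v Hv.
have wT : w + T%:R <= (W * (K * s)) ^+ 3.
  rewrite exprMn -/N; apply: (@le_trans _ _ (W * N)).
    rewrite /W mulrDl; have : w * 1 <= w * N by rewrite ler_wpM2l// ltW.
    lra.
  rewrite ler_wpM2r//; first by lra.
  rewrite -[leLHS]expr1; apply: ler_weXn2l => //; lra.
have wT1 : 1 <= w + T%:R by rewrite TE; have : 0 <= (Num.truncn N)%:R :> R by []; lra.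
have WKs : 0 < W * (K * s) by rewrite mulr_gt0.
have crT : croot (w + T%:R) <= W * (K * s).
  rewrite -(@ler_pXn2r _ 3)// ?nnegrE ?croot_ge0 ?(ltW WKs)//.
  by rewrite crootK//; lra.
have cr0 : 0 < croot (w + T%:R) by apply: croot_gt0; lra.
have lnT : `|ln (w + T%:R)| <= 3 * (W + K + 2 * l).
  rewrite ger0_norm; last by apply: ln_ge0.
  apply: (@le_trans _ _ (ln ((W * (K * s)) ^+ 3))).
    by rewrite ler_ln ?posrE// ?exprn_gt0//; lra.
  rewrite lnXn// -[leLHS]mulr_natl ler_pM2l//.
  rewrite lnM ?posrE// lnM ?posrE// /s lnM ?posrE//.
  rewrite /r ln_powR.
  have := ln_sublinear (lt_le_trans ltr01 l1).
  have : ln W < W by apply: ln_sublinear; lra.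
  have : ln K < K by apply: ln_sublinear; lra.
  lra.
have e2 : eps * (r ^+ 2) = 1 by rewrite r2 divff// gt_eqF.
have [v0|v0] := leP v 0; first by apply: le_trans v0 _; rewrite mulr_ge0// ltW.
have H1 : v * (kbar / (W * (K * s)) * N) <= Q0 + Q1 * (3 * (W + K + 2 * l)).
  apply: le_trans (_ : _ <= v * (kbar / croot (w + T%:R) * (T%:R - 1))) _; last first.
    by apply: le_trans Hv _; rewrite lerD2l ler_wpM2l.
  rewrite ler_pM2l//; apply: ler_pM => //.
  - by rewrite divr_ge0 ?ltW.
  - by lra.
  - by rewrite ler_pM2l// lef_pV2 ?posrE.
have H2 : Q0 + Q1 * (3 * (W + K + 2 * l)) <= Q * K * l ^+ 2.
  have l2 : l <= l ^+ 2 by rewrite expr2 ler_peMl// ltW.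
  have Kl : 1 <= K * l ^+ 2 by rewrite -[leLHS]mulr1 ler_pM// exprn_ege1.
  have b1 : Q0 * 1 <= Q0 * (K * l ^+ 2) by rewrite ler_wpM2l.
  have b2 : W * 1 <= W * (K * l ^+ 2) by rewrite ler_wpM2l// ltW.
  have b3 : K * 1 <= K * l ^+ 2 by rewrite ler_wpM2l ?(ltW K0)// exprn_ege1.
  have b4 : l <= K * l ^+ 2.
    by apply: le_trans l2 _; rewrite ler_peMl// sqr_ge0.
  have : Q1 * (3 * (W + K + 2 * l)) <= Q1 * (3 * ((W + 3) * (K * l ^+ 2))).
    by rewrite ler_wpM2l// ler_pM2l//; lra.
  rewrite /Q; lra.
have H3 : v * (kbar / (W * (K * s)) * N) = v * kbar * K ^+ 2 * l ^+ 2 / (W * eps).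
  have -> : eps = (r ^+ 2)^-1 by rewrite r2 invrK.
  rewrite /N /s; field.
  by rewrite !gt_eqF.
have {H1 H2} H4 : v * kbar * K ^+ 2 * l ^+ 2 / (W * eps) <= Q * K * l ^+ 2.
  by rewrite -H3; exact: le_trans H1 H2.
have Kl0 : 0 < K * l ^+ 2 by rewrite mulr_gt0// exprn_gt0.
have We0 : 0 < W * eps by rewrite mulr_gt0.
rewrite ler_pdivrMr// in H4.
have H5 : v * (kbar * K) <= Q * (W * eps).
  rewrite -(ler_pM2r Kl0).
  have -> : v * (kbar * K) * (K * l ^+ 2) = v * kbar * K ^+ 2 * l ^+ 2 by ring.
  by apply: le_trans H4 _; rewrite le_eqVlt; apply/orP; left; apply/eqP; ring.
have kK : 0 < kbar * K by rewrite mulr_gt0.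
rewrite -(ler_pM2r kK); apply: le_trans H5 _.
have kk : 0 < kbar * kappa by rewrite mulr_gt0.
rewrite (ler_pdivrMr _ _ kk) in KQ.
have := ler_wpM2r (ltW e0) KQ.
have -> : K * (kbar * kappa) * eps = kappa * eps * (kbar * K) by ring.
by rewrite [Q * (W * eps)]mulrA.
Qed.

(** The constant is chosen before [E] and [D], so it depends on the parameters of the problem only.
    The index is found by averaging: the weighted sum over [2] to [T] is logarithmic in [T], and the
    weights are at least [eta_T]. *)
Lemma kkt_rate kbar w c L sigma B kappa : 0 < w -> 0 < c -> 0 < kbar -> kbar <= croot w ->
  0 < L -> c <= croot w ^+ 2 / (4 * kbar ^+ 2) ->
  8 * L ^+ 2 + 1 / (3 * kbar ^+ 3) < c -> 0 <= B -> 0 < kappa ->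
  exists2 C : R, 0 < C & forall E D : nat -> R,
  (forall t, (1 <= t)%N -> 0 <= E t) -> (forall t, (1 <= t)%N -> 0 <= D t) ->
  E 1%N <= 2 * sigma ^+ 2 ->
  (forall t, (1 <= t)%N ->
    E t.+1 <= (1 - beta kbar w c t.+1) ^+ 2 * E t + 2 * beta kbar w c t.+1 ^+ 2 * sigma ^+ 2
            + 2 * (1 - beta kbar w c t.+1) ^+ 2 * L ^+ 2 * (eta kbar w t ^+ 2 * D t)) ->
  (forall T, (1 <= T)%N ->
    \sum_(1 <= t < T.+1) eta kbar w t / 2 * D t <= B + \sum_(1 <= t < T.+1) eta kbar w t * E t) ->
  forall eps : R, 0 < eps < 1 -> exists t : nat,
  [/\ (1 <= t)%N, t%:R <= C * eps `^ (- (3 / 2)) * (ln (expR 1 / eps)) `^ 3 &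
      E t + D t <= kappa * eps].
Proof.
move=> w0 c0 k0 kw L0 c_ub c_lb B0 kap0.
have aL : 0 < L ^+ 2 by rewrite exprn_gt0.
have e10 : 0 < eta kbar w 1 by exact: eta_gt0.
pose K1 := 2 * sigma ^+ 2.
have K10 : 0 <= K1 by rewrite mulr_ge0// sqr_ge0.
pose K' := 2 * B + 2 * eta kbar w 1 * K1.
have K'0 : 0 <= K'.
  by apply: addr_ge0; apply: mulr_ge0 => //; apply: mulr_ge0 => //; exact: ltW.
pose KE2 := (K1 + 2 * sigma ^+ 2 + 2 * L ^+ 2 * K') / eta kbar w 1.
have KE20 : 0 <= KE2.
  apply: divr_ge0; last exact: ltW.
  apply: addr_ge0; first by apply: addr_ge0.
  by apply: mulr_ge0 => //; apply: mulr_ge0 => //; exact: ltW.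
pose k3 := kbar ^+ 3.
have k30 : 0 < k3 by rewrite exprn_gt0.
pose q := 2 * c ^+ 2 * sigma ^+ 2.
have q0 : 0 <= q.
  by apply: mulr_ge0; [apply: mulr_ge0 => //|]; exact: sqr_ge0.
pose Q1 := 3 * (q * k3) / (4 * L ^+ 2).
pose Q0 := K' + 3 * (KE2 + q * (k3 * `|ln (w + 1)|) + 2 * L ^+ 2 * K') / (4 * L ^+ 2).
have Q10 : 0 <= Q1.
  by apply: divr_ge0; [apply: mulr_ge0 => //; apply: mulr_ge0 => //; exact: ltW|rewrite mulr_ge0// ltW].
have Q00 : 0 <= Q0.
  apply: addr_ge0 => //; apply: divr_ge0; last by apply: mulr_ge0 => //; exact: ltW.
  apply: mulr_ge0 => //; apply: addr_ge0.
    apply: addr_ge0 => //; apply: mulr_ge0 => //; apply: mulr_ge0 => //; exact: ltW.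
  by apply: mulr_ge0 => //; apply: mulr_ge0 => //; exact: ltW.
(* Half of [kappa] leaves room for the contradiction: if every index failed, [kappa * eps] itself
   would satisfy the averaged bound and so be at most half of itself. *)
have kap2 : 0 < kappa / 2 by rewrite divr_gt0.
have [C C0 HC] := rate_choice w0 k0 Q00 Q10 kap2.
exists C => // E D E0 D0 E1 Erec desc eps eps01.
have [T [T2 TC HT]] := HC eps eps01.
have T1 : (1 <= T)%N by exact: ltnW.
have := E_D_sum w0 c0 k0 kw L0 c_ub c_lb E0 D0 E1 Erec desc T1.
rewrite -/K1 -/K' -/KE2 -/q => HS.
have S3 := sum_eta_cube w0 k0 T; rewrite -/k3 in S3.
have {}HS : \sum_(2 <= t < T.+1) eta kbar w t * (E t + D t) <= Q0 + Q1 * `|ln (w + T%:R)|.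
  apply: le_trans HS _; rewrite /Q0 /Q1.
  set a := `|ln (w + T%:R)| in S3 *; set b := `|ln (w + 1)| in S3 *.
  have -> : K' + 3 * (KE2 + q * (k3 * b) + 2 * L ^+ 2 * K') / (4 * L ^+ 2)
      + 3 * (q * k3) / (4 * L ^+ 2) * a =
    K' + 3 * (KE2 + q * (k3 * a + k3 * b) + 2 * L ^+ 2 * K') / (4 * L ^+ 2) by ring.
  have i0 : 0 <= (4 * L ^+ 2)^-1 by rewrite invr_ge0 ltW// mulr_gt0.
  rewrite lerD2l; apply: (ler_wpM2r i0); apply: ler_wpM2l => //.
  by rewrite lerD2r lerD2l ler_wpM2l.
have [[t [t2 tT Ht]]|none] := pselect (exists t, [/\ (2 <= t)%N, (t <= T)%N & E t + D t <= kappa * eps]).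
  exists t; split => //; first exact: ltnW.
  by apply: le_trans TC; rewrite ler_nat.
exfalso; have : kappa * eps <= kappa / 2 * eps; last first.
  by case/andP: eps01 => e0 _; rewrite ler_pM2r//; lra.
apply: HT; apply: le_trans HS.
rewrite [leLHS](_ : _ = \sum_(2 <= t < T.+1) eta kbar w T * (kappa * eps)).
  apply: ler_sum_nat => t /andP[t2 tT].
  have lt1 : kappa * eps <= E t + D t.
    by rewrite leNgt; apply/negP => H; apply: none; exists t; split => //; exact: ltW.
  apply: ler_pM => //; first exact: ltW (eta_gt0 _ _ _).
    by case/andP: eps01 => e0 _; rewrite mulr_ge0// ltW.
  exact: eta_le_eta.
by rewrite sumr_const_nat -[RHS]mulr_natr subSS natrB// etaE; ring.
Qed.

End Rate.

(** * Convergence of CoSTA *)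

Lemma Lone_sum_nat (R : realType) d (T : measurableType d) (P : probability T R)
    (F : nat -> T -> R) S : (forall t, (1 <= t <= S)%N -> Lone P (F t)) ->
  Lone P (fun w => \sum_(1 <= t < S.+1) F t w) /\
  Ex P (fun w => \sum_(1 <= t < S.+1) F t w) = \sum_(1 <= t < S.+1) Ex P (F t).
Proof.
elim: S => [|S IH] iF.
  rewrite (_ : (fun _ => _) = fun=> 0); last by apply/funext => w; rewrite big_geq.
  by rewrite Ex_cst big_geq//; split => //; exact: Lone_cst.
have [t /andP[t1 tS]|iS ES] := IH; first by apply: iF; rewrite t1 ltnW.
have iS1 : Lone P (F S.+1) by apply: iF; rewrite leqnn.
rewrite (_ : (fun _ => _) = fun w => \sum_(1 <= t < S.+1) F t w + F S.+1 w); last first.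
  by apply/funext => w; rewrite (big_nat_recr S.+1 1).
by rewrite (big_nat_recr S.+1 1)//= -ES -ExD//; split => //; exact: LoneD.
Qed.

Lemma random_vector_comb (R : realType) d (T : measurableType d) k m
    (a : T -> 'rV[R]_k) (Y : 'I_k -> T -> 'rV[R]_m) : random_vector a ->
  (forall j, random_vector (Y j)) -> random_vector (fun w => \sum_j a w 0 j *: Y j w).
Proof.
move=> ma mY i.
rewrite (_ : (fun w => _) = fun w => \sum_j a w 0 j * Y j w 0 i); last first.
  by apply/funext => w; rewrite summxE; apply: eq_bigr => j _; rewrite mxE.
by apply: measurable_sum => j; apply: measurable_funM; [exact: ma|exact: mY].
Qed.

(** Inverse of the total loss in [kkt_iterate]: [2 + 2 K^2] from the squared stationarity residual
    and [L M] from complementary slackness. The absolute value covers any sign of [BU]. *)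
Definition kkt_level (R : realType) (L rho BU : R) : R :=
  (2 + 2 * (2 * L + 2 * L * (2 * L * `|BU| / rho ^+ 2)) ^+ 2
     + L * (2 * L * `|BU| / rho ^+ 2))^-1.

Section Convergence.
Context {R : realType} {n I J : nat} {d d' : measure_display}
  {T : measurableType d} {Xi : measurableType d'}.
Local Notation V := 'rV[R]_n.
Variables (L G sigma B1 BU chi rho mu kbar w c : R).
Variables (P : probability T R) (xi : {RV P >-> Xi}) (xis : nat -> {RV P >-> Xi}).
Variables (f : V -> Xi -> R) (u : V -> \bar R).
Variables (h : 'I_I -> V -> R) (g : 'I_J -> V -> R).
Variables (fhat : V -> V -> Xi -> R) (gtil : 'I_J -> V -> V -> R).
Variables (x1 : V) (x z xh : nat -> T -> V).
Local Notation X := (Xset h g).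
Local Notation gU := (gradU xi f).
Local Notation et := (eta kbar w).
Local Notation bt := (beta kbar w c).

Hypotheses (L0 : 0 < L) (G0 : 0 <= G) (rho0 : 0 < rho) (mu34 : 3 / 4 < mu).
Hypotheses (w0 : 0 < w) (k0 : 0 < kbar) (kw : kbar <= croot w).
Hypothesis chi_rho : rho / L * (G + rho / 2) <= chi.
Hypothesis step_small : forall t, L * et t <= 2 * mu - 3 / 2.
Hypothesis mf : forall y, measurable_fun setT (f y).
Hypothesis df : forall s y, differentiable (f ^~ s) y.
Hypothesis cu : econvex u.
Hypothesis ch : forall i, convex_function setT (h i).
Hypothesis Xsur_convex : forall y, X y ->
  convex_set (Xsur h gtil y) /\ Xsur h gtil y `<=` X.
Hypothesis iid : iid_samples xi xis.
Hypothesis alg : costa f u h xis fhat gtil kbar w c x1 x z xh.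
Hypothesis XD : X `<=` Dset xi f u h g.
Hypothesis Fstar_fin : (-oo < Fstar xi f u h g)%E.
Hypothesis Xx1 : X x1.
Hypothesis FB1 : (Fobj xi f u x1 - Fstar xi f u h g <= B1%:E)%E.
Hypothesis lipgrad : forall y y', ('E_P[fun om => (enorm (grad (f ^~ (xi om)) y
   - grad (f ^~ (xi om)) y') ^+ 2)%R] <= (L ^+ 2 * enorm (y - y') ^+ 2)%:E)%E.
Hypothesis lipf : forall y y', ('E_P[fun om => `|f y (xi om) - f y' (xi om)|%R]
   <= (G * enorm (y - y'))%:E)%E.
Hypothesis sh : forall i, smooth_on setT L (h i) /\ lip_on setT G (h i).
Hypothesis sg : forall j, smooth_on setT L (g j) /\ lip_on setT G (g j).
Hypothesis var : forall y, X y ->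
  ('E_P[fun om => (enorm (grad (f ^~ (xi om)) y - gradU xi f y) ^+ 2)%R] <= (sigma ^+ 2)%:E)%E.
Hypothesis mfcq : MFCQ h g chi rho.
Hypothesis sfhat : forall y s, X y ->
  strongly_convex mu (fun y' => fhat y' y s) /\ smooth_on setT L (fun y' => fhat y' y s).
Hypothesis gfhat : forall y s, X y -> grad (fun y' => fhat y' y s) y = grad (f ^~ s) y.
Hypothesis sgtil : forall y j, X y ->
  [/\ convex_function X (fun y' => gtil j y' y), smooth_on X L (fun y' => gtil j y' y),
      lip_on X G (fun y' => gtil j y' y), grad (fun y' => gtil j y' y) y = grad (g j) y &
      (forall y', X y' -> g j y' <= gtil j y' y) /\ gtil j y y = g j y].
Hypothesis gapBU : forall t om y, (1 <= t)%N -> X y ->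
  let phi := subobj f u fhat (bt t) (x t om) (x t.-1 om) (z t om) (xis t om) in
  (phi y - minval (Xsur h gtil (x t om)) phi <= BU%:E)%E.

Let e t om := z t.+1 om - gU (x t om).
Let dl t om := xh t om - x t om.

Let eta01 t : 0 <= et t <= 1.
Proof. by rewrite eta_le1// ltW// eta_gt0. Qed.

Let lipf1 y y' : exists b, ('E_P[fun om => `|f y (xi om) - f y' (xi om)|%R] <= b%:E)%E.
Proof. by eexists; exact: lipf. Qed.

Let Xdom y : X y -> (u y < +oo)%E.
Proof. exact: (dom_u XD Fstar_fin). Qed.

Let Sy y : X y -> Xsur h gtil y y.
Proof.
move=> Xy; split; first exact: Xy.1.
by move=> j /=; have [_ _ _ _ [_ ->]] := sgtil j Xy; exact: Xy.2.
Qed.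

Lemma iterate_feasible t om : X (x t om).
Proof.
have [x01 _ step _] := alg.
have [x0E x1E] := x01 om; case: t => [|t]; first by rewrite x0E.
elim: t => [|t IH]; first by rewrite x1E.
have [_ [Sxh _] ->] := step t.+1 om isT.
have [cS SX] := Xsur_convex IH; apply: SX.
have := convex_setE cS (eta01 t.+1) Sxh (Sy IH).
by rewrite addrC.
Qed.

Let phi t om y' := fhat y' (x t om) (xis t om) + (1 - bt t) *
   dotv (y' - x t om) (z t om - grad (f ^~ (xis t om)) (x t.-1 om)).

Let phiE t om y' : subobj f u fhat (bt t) (x t om) (x t.-1 om) (z t om) (xis t om) y'
  = ((phi t om y')%:E + u y')%E.
Proof. by []. Qed.

Let lin_grad (a b : V) (k : R) (q : V -> R) y' : differentiable q y' ->
  differentiable (fun y => q y + k * dotv (y - a) b) y' /\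
  grad (fun y => q y + k * dotv (y - a) b) y' = grad q y' + k *: b.
Proof.
move=> dq.
have dc i : differentiable (fun y : V => (y - a) 0 i * b 0 i) y'.
  apply: differentiableM => //.
  rewrite (_ : (fun y : V => _) = (fun y : V => y 0 i - a 0 i)); last by apply/funext => y; rewrite !mxE.
  by apply: differentiableB => //; exact: differentiable_coord.
have dd : differentiable (fun y : V => dotv (y - a) b) y'.
  rewrite (_ : (fun y : V => _) = \sum_i (fun y : V => (y - a) 0 i * b 0 i)); last first.
    by apply/funext => y; rewrite fct_sumE.
  exact: differentiable_sum.
have dk : differentiable (fun y : V => k * dotv (y - a) b) y' by exact: differentiableM.
split; first exact: differentiableD.
have gl : grad (fun y : V => k * dotv (y - a) b) y' = k *: b.
  (* An affine function has zero remainder, so the constant [0] serves. *)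
  apply: (@grad_of_taylor _ _ _ _ _ 0) => v; rewrite mul0r.
  by rewrite !dotvBl dotvDl dotvZl (dotvC b); rewrite (_ : _ - _ = 0) ?normr0//; ring.
apply/rowP => i; rewrite -gl !mxE.
by rewrite deriveD//; exact: diff_derivable.
Qed.

Let phi_props t om : [/\ strongly_convex mu (phi t om),
  forall y, differentiable (phi t om) y,
  forall y y', enorm (grad (phi t om) y - grad (phi t om) y') <= L * enorm (y - y') &
  grad (phi t om) (x t om) = grad (f ^~ (xis t om)) (x t om)
     + (1 - bt t) *: (z t om - grad (f ^~ (xis t om)) (x t.-1 om))].
Proof.
have [sc [dq lq]] := sfhat (xis t om) (iterate_feasible t om).
have lg y := lin_grad (x t om) (z t om - grad (f ^~ (xis t om)) (x t.-1 om)) (1 - bt t) (dq y Logic.I).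
split.
- move=> y y' s s01; have := sc y y' s s01; rewrite /phi.
  have -> : dotv (s *: y + (1 - s) *: y' - x t om) (z t om - grad (f ^~ (xis t om)) (x t.-1 om))
    = s * dotv (y - x t om) (z t om - grad (f ^~ (xis t om)) (x t.-1 om))
      + (1 - s) * dotv (y' - x t om) (z t om - grad (f ^~ (xis t om)) (x t.-1 om)).
    by rewrite !dotvBl dotvDl !dotvZl; ring.
  set a := dotv _ _; set b := dotv _ _; lra.
- by move=> y; have [] := lg y.
- move=> y y'; rewrite (lg y).2 (lg y').2 opprD addrACA subrr addr0; exact: lq.
- by rewrite (lg (x t om)).2 gfhat//; exact: iterate_feasible.
Qed.

(** This is the purpose of the linear term in the subproblem: its smooth part has at [x_t] the new
    estimate [z_(t+1)] as gradient, so [argmin_descent] and [approximate_kkt] speak about the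
    estimator. *)
Let grad_phi t om : (1 <= t)%N -> grad (phi t om) (x t om) = z t.+1 om.
Proof.
move=> t1; have [_ _ _ ->] := phi_props t om; have [_ _ step _] := alg.
by have [-> _ _] := step t om t1.
Qed.

Let opt t om : (1 <= t)%N -> Xsur h gtil (x t om) (xh t om) /\
  forall y, Xsur h gtil (x t om) y ->
    ((phi t om (xh t om))%:E + u (xh t om) <= (phi t om y)%:E + u y)%E.
Proof. by move=> t1; have [_ _ step _] := alg; have [_ [Sx oy] _] := step t om t1; split. Qed.

Lemma xh_feasible t om : (1 <= t)%N -> X (xh t om).
Proof.
move=> t1; have [_ SX] := Xsur_convex (iterate_feasible t om).
by apply: SX; have [] := opt om t1.
Qed.

Let BUP t om y : (1 <= t)%N -> X y ->
  phi t om y + fine (u y) - (phi t om (xh t om) + fine (u (xh t om))) <= `|BU|.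
Proof.
move=> t1 Xy; have H := gapBU om t1 Xy; move: H; cbv zeta.
have [Sxh oy] := opt om t1.
have -> : minval (Xsur h gtil (x t om)) (subobj f u fhat (bt t) (x t om) (x t.-1 om) (z t om) (xis t om))
   = ((phi t om (xh t om))%:E + u (xh t om))%E.
  apply/eqP; rewrite eq_le; apply/andP; split.
    by apply: ereal_inf_lbound; exists (xh t om).
  by apply/ereal_infP => _ [y' Sy' <-]; exact: oy.
rewrite phiE => H; rewrite (econvex_fine cu (Xdom Xy)) (econvex_fine cu (Xdom (xh_feasible om t1))) in H.
by move: H; rewrite -!EFinD lee_fin => /le_trans; apply; exact: ler_norm.
Qed.

Let Fv y := Ureal xi f y + fine (u y).

(** Young's inequality in the form [|e| |d| <= |e|^2 + |d|^2 / 4] leaves the coefficient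
    [- mu + L eta_t / 2 + 1 / 4] of [|d|^2], and [step_small] makes it at most [- 1 / 2]. *)
Lemma one_step_descent t om : (1 <= t)%N ->
  et t / 2 * enorm (dl t om) ^+ 2 + Fv (x t.+1 om) <= Fv (x t om) + et t * enorm (e t om) ^+ 2.
Proof.
move=> t1; have Xt := iterate_feasible t om; have Xh := xh_feasible om t1.
have [sc dphi lphi _] := phi_props t om; have [Sxh oy] := opt om t1.
have [cS SX] := Xsur_convex Xt.
have mu0 : 0 <= mu by apply: le_trans (ltW mu34); rewrite divr_ge0.
have := argmin_descent mu0 cu Xdom Xt (gt := fun j y => gtil j y (x t om)) (convex_setE cS) SX
  (fun j => let: And5 _ _ _ _ (conj _ q) := sgtil j Xt in q) sc dphi Sxh oy.
rewrite grad_phi// -/(dl t om) => H1.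
have [_ _ step _] := alg; have [_ _ xE] := step t om t1.
have xE' : x t.+1 om = x t om + et t *: dl t om.
  by rewrite xE /dl scalerBr scalerBl scale1r -addrA [- _ + _]addrC.
have H2 := Ureal_descent (ltW L0) mf df XD Fstar_fin Xx1 lipgrad lipf1 var (x t om) (et t *: dl t om).
rewrite -xE' dotvZr enormZ ger0_norm in H2; last by case/andP: (eta01 t).
have H3 : fine (u (x t.+1 om)) <= et t * fine (u (xh t om)) + (1 - et t) * fine (u (x t om)).
  have := econvex_on cu (eta01 t) (Xdom Xh) (Xdom Xt).
  by rewrite /= addrC -xE.
have H4 : dotv (gU (x t om)) (dl t om) - dotv (z t.+1 om) (dl t om) <= enorm (e t om) * enorm (dl t om).
  rewrite -dotvBl; apply: le_trans (dotv_le _ _) _.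
  by rewrite enormC.
have H5 : enorm (e t om) * enorm (dl t om) <= enorm (e t om) ^+ 2 + enorm (dl t om) ^+ 2 / 4.
  by have := sqr_ge0 (enorm (e t om) - enorm (dl t om) / 2); rewrite sqrrB; lra.
have H6 : L * et t * enorm (dl t om) ^+ 2 <= (2 * mu - 3 / 2) * enorm (dl t om) ^+ 2.
  by rewrite ler_wpM2r ?sqr_ge0.
rewrite /Fv; move: H1 H2 H3 H4 H5 H6.
set uh := fine (u (xh t om)); set ux := fine (u (x t om)); set u' := fine _.
set zd := dotv (z _ _) _; set gd := dotv (gU _) _; set D := enorm (dl t om).
set E := enorm (e t om); set U' := Ureal _ _ (x t.+1 om); set U := Ureal _ _ (x t om).
move=> H1 H2 H3 H4 H5 H6.
have e0 := eta_gt0 w0 k0 t.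
have H7 : et t * (uh - ux + gd + L / 2 * et t * D ^+ 2) <= et t * (E ^+ 2 - D ^+ 2 / 2).
  rewrite ler_pM2l//; lra.
rewrite exprMn in H2; lra.
Qed.

(* Summed before taking expectations, because [u (x_t)] need not be a random
   variable. *)
Lemma pathwise_descent S om : 
  \sum_(1 <= t < S.+1) et t / 2 * enorm (dl t om) ^+ 2 <=
    `|B1| + \sum_(1 <= t < S.+1) et t * enorm (e t om) ^+ 2.
Proof.
have FE y : X y -> Fobj xi f u y = (Fv y)%:E.
  move=> Xy; rewrite /Fobj (UobjE mf XD Fstar_fin Xx1 lipf1) (econvex_fine cu (Xdom Xy)) -EFinD//.
have Fs : Fstar xi f u h g \is a fin_num.
  rewrite fin_real// Fstar_fin /=; apply: le_lt_trans (ltry (Fv x1)).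
  by rewrite -FE//; apply: ereal_inf_lbound; exists x1.
have Flb y : X y -> fine (Fstar xi f u h g) <= Fv y.
  by move=> Xy; rewrite -lee_fin fineK// -FE//; apply: ereal_inf_lbound; exists y.
have FB : Fv x1 - fine (Fstar xi f u h g) <= `|B1|.
  by move: FB1; rewrite FE// -{1}(fineK Fs) -EFinB lee_fin => /le_trans; apply; exact: ler_norm.
suff H : \sum_(1 <= t < S.+1) et t / 2 * enorm (dl t om) ^+ 2 + Fv (x S.+1 om) <=
    Fv x1 + \sum_(1 <= t < S.+1) et t * enorm (e t om) ^+ 2.
  have := Flb _ (iterate_feasible S.+1 om); lra.
have [x01 _ _ _] := alg.
elim: S => [|S IH]; first by rewrite !big_geq// add0r addr0 (x01 om).2.
rewrite !(big_nat_recr S.+1 1)//=; have := one_step_descent om (isT : (1 <= S.+1)%N); lra.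
Qed.

Let gUL := gradU_lip (ltW L0) mf df XD Fstar_fin Xx1 lipgrad lipf1 var.
Let cgU := gradU_continuous (ltW L0) mf df XD Fstar_fin Xx1 lipgrad lipf1 var.

Let xE t om : (1 <= t)%N -> x t.+1 om = (1 - et t) *: x t om + et t *: xh t om.
Proof. by move=> t1; have [_ _ /(_ t om t1)[_ _ ->]] := alg. Qed.

Let zE t om : z t.+2 om = grad (f ^~ (xis t.+1 om)) (x t.+1 om)
  + (1 - bt t.+1) *: (z t.+1 om - grad (f ^~ (xis t.+1 om)) (x t om)).
Proof. by have [_ _ /(_ t.+1 om isT)[-> _ _]] := alg. Qed.

Lemma xh_adapted t : (1 <= t)%N -> adapted xis t (xh t).
Proof.
move=> t1 i _ B mB; rewrite setTI; have [_ _ _ meas] := alg; exact: (meas t i t1 B mB).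
Qed.

Lemma x_adapted t : adapted xis t (x t) /\ adapted xis t (x t.+1).
Proof.
have [x01 _ _ _] := alg.
elim: t => [|t [_ IH]].
  have [-> ->] : x 0%N = cst x1 /\ x 1%N = cst x1.
    by split; apply/funext => om; have [] := x01 om.
  by split; exact: random_vector_cst.
have IH1 := adapted_le (leqnSn t) IH; split => //.
rewrite (_ : x t.+2 = fun om => (1 - et t.+1) *: x t.+1 om + et t.+1 *: xh t.+1 om).
  have xhA := @xh_adapted t.+1 isT.
  exact: (random_vectorD (random_vectorZ _ IH1) (random_vectorZ _ xhA)).
by apply/funext => om; exact: xE.
Qed.

(** [z_(k+1)] uses the sample [xi_k], except that [z_1] already uses [xi_1]. Hence the induction
    starts with [z_1] and [z_2] adapted to the same single sample. *)
Lemma z_adapted t : adapted xis t.+1 (z t.+2).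
Proof.
have step k : adapted xis k.+1 (z k.+1) -> adapted xis k.+1 (z k.+2).
  move=> zk; have [xk0 xk1] := x_adapted k.
  rewrite (_ : z k.+2 = fun om => grad (f ^~ (xis k.+1 om)) (x k.+1 om)
    + (1 - bt k.+1) *: (z k.+1 om - grad (f ^~ (xis k.+1 om)) (x k om))).
    apply: random_vectorD; first exact: (adapted_grad mf df xk1).
    exact: (random_vectorZ _ (random_vectorB zk (adapted_grad mf df xk0))).
  by apply/funext => om; exact: zE.
elim: t => [|t IH]; apply: step; last exact: (adapted_le (leqnSn _) IH).
have [_ z1 _ _] := alg.
rewrite (_ : z 1%N = fun om => grad (f ^~ (xis 1%N om)) (x 0%N om)).
  exact: (adapted_grad mf df (x_adapted 0).1).
by apply/funext => om; exact: z1.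
Qed.

Let e_adapted t : (1 <= t)%N -> adapted xis t (e t).
Proof.
case: t => // t _; apply: random_vectorB; first exact: z_adapted.
exact: (random_vector_continuous cgU (x_adapted t.+1).1).
Qed.

Let dl_adapted t : (1 <= t)%N -> adapted xis t (dl t).
Proof. by move=> t1; exact: (random_vectorB (xh_adapted t1) (x_adapted t).1). Qed.

Let vstep := variance_step (ltW L0) mf df XD Fstar_fin Xx1 lipgrad lipf1 var.

Let estep t A Y0 Y1 b := @estimator_step _ _ _ _ _ P xi xis _ f gU X L sigma mf df cgU iid
  (fun a x y b (Xx : X x) => vstep a y b Xx) t A Y0 Y1 b.

Let e_succ t om : e t.+1 om = (1 - bt t.+1) *: e t om
  + (grad (f ^~ (xis t.+1 om)) (x t.+1 om) - gU (x t.+1 om))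
  - (1 - bt t.+1) *: (grad (f ^~ (xis t.+1 om)) (x t om) - gU (x t om)).
Proof. by rewrite /e zE; apply/rowP => i; rewrite !mxE; ring. Qed.

(** [z_1] is the gradient at [x_0] for the sample that also enters [z_2], so the correction term in
    [z_2] vanishes and [e_1] is a sampling error. It is the estimator step from time 0 with [A = 0]
    and weight [b = 1], whose bound is [2 sigma^2]. *)
Lemma initial_variance : Lone P (fun om => enorm (e 1%N om) ^+ 2) /\
  Ex P (fun om => enorm (e 1%N om) ^+ 2) <= 2 * sigma ^+ 2.
Proof.
have [x01 z1 _ _] := alg.
have c0' : adapted xis 0 (cst (0 : V)) by exact: random_vector_cst.
have i0 : Lone P (fun om => enorm ((cst 0 : T -> V) om) ^+ 2).
  by rewrite /= enorm0 expr0n; exact: Lone_cst.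
have x10 om : x 1%N om - x 0%N om = 0 by have [-> ->] := x01 om; rewrite subrr.
have i1 : Lone P (fun om => enorm (x 1%N om - x 0%N om) ^+ 2).
  by under eq_fun do rewrite x10 enorm0 expr0n; exact: Lone_cst.
have [] := estep 1 c0' (x_adapted 0).1 (x_adapted 0).2 (iterate_feasible 1) i0 i1.
set N := (fun om : T => _) => iN leN.
have -> : (fun om => enorm (e 1%N om) ^+ 2) = N.
  apply/funext => om; rewrite /N e_succ; congr (enorm _ ^+ 2).
  by rewrite /e z1 /cst; apply/rowP => i; rewrite !mxE; ring.
split=> //; apply: le_trans leN _; rewrite subrr expr0n/= mul0r mulr0 !mul0r add0r addr0 expr1n mulr1.
by [].
Qed.

Lemma variance_recursion t : (1 <= t)%N -> Lone P (fun om => enorm (e t om) ^+ 2) ->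
  Lone P (fun om => enorm (dl t om) ^+ 2) -> Lone P (fun om => enorm (e t.+1 om) ^+ 2) /\
  Ex P (fun om => enorm (e t.+1 om) ^+ 2) <=
    (1 - bt t.+1) ^+ 2 * Ex P (fun om => enorm (e t om) ^+ 2) + 2 * bt t.+1 ^+ 2 * sigma ^+ 2
    + 2 * (1 - bt t.+1) ^+ 2 * L ^+ 2 * (et t ^+ 2 * Ex P (fun om => enorm (dl t om) ^+ 2)).
Proof.
move=> t1 ie idl.
have dE : (fun om => enorm (x t.+1 om - x t om) ^+ 2) = fun om => et t ^+ 2 * enorm (dl t om) ^+ 2.
  apply/funext => om; rewrite -[X in _ = X * _]real_normK ?num_real// -exprMn -enormZ xE// /dl.
  by congr (enorm _ ^+ 2); apply/rowP => i; rewrite !mxE; ring.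
have ix : Lone P (fun om => enorm (x t.+1 om - x t om) ^+ 2) by rewrite dE; exact: LoneZ.
have := estep (bt t.+1) (e_adapted t1) (x_adapted t).1 (x_adapted t).2 (iterate_feasible t.+1) ie ix.
rewrite dE (ExZ (et t ^+ 2) idl) /=.
have eS : e t.+1 = fun om => (1 - bt t.+1) *: e t om
    + (grad (f ^~ (xis t.+1 om)) (x t.+1 om) - gU (x t.+1 om))
    - (1 - bt t.+1) *: (grad (f ^~ (xis t.+1 om)) (x t om) - gU (x t om)).
  by apply/funext => om; rewrite e_succ.
by move=> [iN leN]; rewrite eS; split; [exact: iN|exact: leN].
Qed.

(** The summed descent inequality up to [t] dominates [|d_t|^2] by a constant and the errors [e_1]
    to [e_t], for every outcome. *)
Lemma step_integrable t : (1 <= t)%N ->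
  (forall s, (1 <= s <= t)%N -> Lone P (fun om => enorm (e s om) ^+ 2)) ->
  Lone P (fun om => enorm (dl t om) ^+ 2).
Proof.
move=> t1 ie.
have [iS _] := Lone_sum_nat (fun s st => LoneZ (et s) (ie s st)).
have e0 := eta_gt0 w0 k0 t.
apply: (Lone_le _ (LoneZ (2 / et t) (LoneD (Lone_cst P `|B1|) iS))).
  by apply: measurable_funX; apply: measurable_enorm; exact: (adapted_measurable (dl_adapted t1)).
move=> om; rewrite ger0_norm ?sqr_ge0//.
have -> : enorm (dl t om) ^+ 2 = 2 / et t * (et t / 2 * enorm (dl t om) ^+ 2).
  by field; rewrite gt_eqF.
rewrite ler_pM2l; last by apply: divr_gt0; last exact: e0.
apply: le_trans (pathwise_descent t om); case: t t1 {ie iS e0} => // t _.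
rewrite (big_nat_recr t.+1 1)//= lerDr; apply: sumr_ge0 => s _.
apply: mulr_ge0; last exact: sqr_ge0.
by apply: mulr_ge0; [exact: ltW (eta_gt0 w0 k0 s)|rewrite invr_ge0].
Qed.

Lemma moments_integrable t : (1 <= t)%N -> Lone P (fun om => enorm (e t om) ^+ 2) /\
  Lone P (fun om => enorm (dl t om) ^+ 2).
Proof.
have [m tm] := ubnP t; elim: m t tm => // m IH t tm t1.
have ie : Lone P (fun om => enorm (e t om) ^+ 2).
  case: t t1 tm => // -[_ _|t _ tm]; first exact: initial_variance.1.
  have [i1 i2] := IH t.+1 tm isT.
  exact: (@variance_recursion t.+1 isT i1 i2).1.
split; first exact: ie.
apply: (step_integrable t1) => s /andP[s1].
rewrite leq_eqVlt => /predU1P[->|st]; [exact: ie|apply: (IH s _ s1).1].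
by apply: leq_trans st _.
Qed.

Let Et t := Ex P (fun om => enorm (e t om) ^+ 2).
Let Dt t := Ex P (fun om => enorm (dl t om) ^+ 2).

Lemma expected_descent S : (1 <= S)%N ->
  \sum_(1 <= t < S.+1) et t / 2 * Dt t <= `|B1| + \sum_(1 <= t < S.+1) et t * Et t.
Proof.
move=> _.
have ie s : (1 <= s <= S)%N -> Lone P (fun om => et s * enorm (e s om) ^+ 2).
  by move=> /andP[s1 _]; exact: (LoneZ _ (moments_integrable s1).1).
have id s : (1 <= s <= S)%N -> Lone P (fun om => et s / 2 * enorm (dl s om) ^+ 2).
  by move=> /andP[s1 _]; exact: (LoneZ _ (moments_integrable s1).2).
have [iSe ESe] := Lone_sum_nat ie; have [iSd ESd] := Lone_sum_nat id.
have := Ex_le iSd (LoneD (Lone_cst P `|B1|) iSe) (pathwise_descent S).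
rewrite (ExD (Lone_cst P `|B1|) iSe) Ex_cst ESe ESd.
have -> : \sum_(1 <= t < S.+1) Ex P (fun om => et t / 2 * enorm (dl t om) ^+ 2)
    = \sum_(1 <= t < S.+1) et t / 2 * Dt t.
  by apply: eq_big_nat => s /andP[s1 _]; exact: (ExZ _ (moments_integrable s1).2).
have -> // : \sum_(1 <= t < S.+1) Ex P (fun om => et t * enorm (e t om) ^+ 2)
    = \sum_(1 <= t < S.+1) et t * Et t.
by apply: eq_big_nat => s /andP[s1 _]; exact: (ExZ _ (moments_integrable s1).1).
Qed.

Let M := 2 * L * `|BU| / rho ^+ 2.
Let K := 2 * L + 2 * L * M.
Let r t om := enorm (e t om) + K * enorm (dl t om).
Let q t om := L * M * enorm (dl t om) ^+ 2.

Let M0 : 0 <= M.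
Proof. by rewrite /M divr_ge0 ?sqr_ge0// mulr_ge0// mulr_ge0// ltW. Qed.

Let K0 : 0 <= K.
Proof. by rewrite /K addr_ge0// mulr_ge0// ?mulr_ge0// ltW. Qed.

Let cvx_h i : cvx_on setT (h i).
Proof. exact: convex_functionE. Qed.

(** Passing from [z_(t+1)] to the gradient of [U] at [xh_t] adds [|e_t|] and, by smoothness of [U],
    another [L |d_t|]; hence [2 L] in [K]. *)
Lemma pathwise_kkt t om : (1 <= t)%N ->
  exists lam : 'I_J -> R, exists nu : 'I_I -> R, exists v : V,
  [/\ (forall j, 0 <= lam j <= M) /\ (forall i, 0 <= nu i <= M), subdiff u (xh t om) v,
    enorm (gU (xh t om) + \sum_j lam j *: grad (g j) (xh t om)
      + \sum_i nu i *: grad (h i) (xh t om) + v) <= r t om,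
    - q t om <= \sum_j lam j * g j (xh t om) & 0 <= \sum_i nu i * h i (xh t om)].
Proof.
move=> t1; have Xt := iterate_feasible t om.
have [sc dphi lphi _] := phi_props t om; have [Sxh oy] := opt om t1.
have [cS SX] := Xsur_convex Xt.
have mu0 : 0 <= mu by apply: le_trans (ltW mu34); rewrite divr_ge0.
have [lam [nu [v [b1 b2 b3 b4 b5]]]] := approximate_kkt (gt := fun j y => gtil j y (x t om))
  L0 G0 rho0 mu0 chi_rho cu Xdom cvx_h sh sg mfcq Xt (convex_setE cS) SX
  (fun j => let: And5 q _ _ _ _ := sgtil j Xt in convex_functionE q)
  (fun j => let: And5 _ q _ _ _ := sgtil j Xt in q)
  (fun j => let: And5 _ _ q _ _ := sgtil j Xt in q)
  (fun j => let: And5 _ _ _ q _ := sgtil j Xt in q)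
  (fun j => let: And5 _ _ _ _ (conj _ q) := sgtil j Xt in q)
  sc dphi lphi Sxh oy (fun y Xy => BUP om t1 Xy).
exists lam, nu, v; split=> //.
rewrite grad_phi// in b3.
set a := \sum_j _; set b := \sum_i _.
have -> : gU (xh t om) + a + b + v =
  (gU (xh t om) - gU (x t om)) - e t om + (z t.+1 om + a + b + v).
  by rewrite /e; apply/rowP => k; rewrite !mxE; ring.
apply: le_trans (enormD _ _) _; apply: le_trans (lerD (enormD _ _) b3) _.
rewrite enormN.
have := gUL (xh t om) (x t om); rewrite /r /K -/M -/(dl t om).
set A := enorm (_ - _); set B := enorm (e t om); set D := enorm (dl t om); lra.
Qed.

(** The squared residual is at most [2 |e_t|^2 + 2 K^2 |d_t|^2]; its mean is bounded by [eps], and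
    Jensen's inequality turns this into [sqrt eps] for the residual itself. Feasibility of [xh_t]
    makes the slackness sums nonpositive, so the one for [h] vanishes identically. *)
Lemma kkt_iterate eps t : 0 < eps -> (1 <= t)%N -> Et t + Dt t <= kkt_level L rho BU * eps ->
  exists (lam : T -> 'rV[R]_J) (nu : T -> 'rV[R]_I), eps_KKT xi f u h g eps (xh t) lam nu.
Proof.
move=> eps0 t1 small.
have mxh : random_vector (xh t) := adapted_measurable (xh_adapted t1).
have me : measurable_fun setT (fun om => enorm (e t om)).
  by apply: measurable_enorm; exact: (adapted_measurable (e_adapted t1)).
have md : measurable_fun setT (fun om => enorm (dl t om)).
  by apply: measurable_enorm; exact: (adapted_measurable (dl_adapted t1)).
have mr : measurable_fun setT (r t) by apply: measurable_funD => //; exact: measurable_funM.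
have mq : measurable_fun setT (q t) by apply: measurable_funM => //; exact: measurable_funX.
have cg j : continuous (g j) by move=> y; exact: differentiable_continuous ((sg j).1.1 y Logic.I).
have ch' i : continuous (h i) by move=> y; exact: differentiable_continuous ((sh i).1.1 y Logic.I).
have cdg j : continuous (grad (g j)).
  by apply: lip_continuous => y y'; exact: ((sg j).1.2 y y' Logic.I Logic.I).
have cdh i : continuous (grad (h i)).
  by apply: lip_continuous => y y'; exact: ((sh i).1.2 y y' Logic.I Logic.I).
have [lam [nu [v [ml mn mv sv H]]]] := multiplier_selection cu.1 cgU cg cdg ch' cdh mxh mr mq
  (fun om => pathwise_kkt om t1).
exists lam, nu.
have [ie id] := moments_integrable t1.
have Et0 : 0 <= Et t by apply: Ex_ge0 => om; exact: sqr_ge0.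
have Dt0 : 0 <= Dt t by apply: Ex_ge0 => om; exact: sqr_ge0.
have LM0 : 0 <= L * M by rewrite mulr_ge0// ltW.
have K20 : 0 <= 2 * K ^+ 2 by rewrite mulr_ge0// sqr_ge0.
have small' : (2 + 2 * K ^+ 2 + L * M) * (Et t + Dt t) <= eps.
  by rewrite -ler_pdivlMl// ltr_wpDr// ltr_wpDr.
split; first by split.
- split=> [om|om j|om i]; first exact: xh_feasible.
    by have [[/(_ j)/andP[]]] := H om.
  by have [[_ /(_ i)/andP[]]] := H om.
- exists v; split=> //.
  set N := (fun om => enorm (gU (xh t om) + _ + _ + _)).
  have mN : measurable_fun setT N.
    apply: measurable_enorm; apply: random_vectorD => //; apply: random_vectorD; first apply: random_vectorD.
    - exact: (random_vector_continuous cgU mxh).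
    - apply: random_vector_comb => // j; exact: (random_vector_continuous (cdg j) mxh).
    - apply: random_vector_comb => // i; exact: (random_vector_continuous (cdh i) mxh).
  have N0 om : 0 <= N om by exact: enorm_ge0.
  pose b1 := LoneZ 2 ie; pose b2 := LoneZ (2 * K ^+ 2) id.
  have N2 om : N om ^+ 2 <= 2 * enorm (e t om) ^+ 2 + 2 * K ^+ 2 * enorm (dl t om) ^+ 2.
    have [_ Nr _ _] := H om.
    have : N om ^+ 2 <= r t om ^+ 2.
      by rewrite ler_pXn2r// nnegrE// addr_ge0 ?enorm_ge0// mulr_ge0 ?enorm_ge0.
    move=> /le_trans; apply; have := sqr_ge0 (enorm (e t om) - K * enorm (dl t om)).
    rewrite /r; set a := enorm _; set b := enorm _; rewrite sqrrB sqrrD exprMn; lra.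
  have iN2 : Lone P (fun om => N om ^+ 2).
    apply: (Lone_le _ (LoneD b1 b2)); first exact: measurable_funX.
    by move=> om; rewrite ger0_norm ?sqr_ge0.
  have [|iN EN] := Ex_jensen mN N0 (sqrtr_ge0 eps) iN2.
    rewrite sqr_sqrtr; last exact: ltW.
    apply: le_trans (Ex_le iN2 (LoneD b1 b2) N2) _.
    rewrite (ExD b1 b2) (ExZ 2 ie) (ExZ (2 * K ^+ 2) id) -/(Et t) -/(Dt t).
    apply: le_trans small'; rewrite !mulrDl !mulrDr.
    have h1 := mulr_ge0 K20 Et0.
    have h2 := mulr_ge0 LM0 Et0.
    have h3 := mulr_ge0 LM0 Dt0.
    lra.
  by rewrite (expectationE iN) lee_fin.
- set S := (fun om => \sum_j _).
  have mS : measurable_fun setT S.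
    apply: measurable_sum => j; apply: measurable_funM; first exact: ml.
    exact: (measurable_continuous_rV (F := g j)).
  have iq : Lone P (q t) := LoneZ (L * M) id.
  have qS om : - q t om <= S om by have [_ _] := H om.
  have S0 om : S om <= 0.
    apply: sumr_le0 => j _; have [[/(_ j)/andP[l0 _] _] _ _ _] := H om.
    by rewrite mulr_ge0_le0//; exact: ((xh_feasible om t1).2 j).
  have iS : Lone P S.
    by apply: (Lone_le mS iq) => om; rewrite ler0_norm// lerNl.
  rewrite (expectationE iS) lee_fin.
  have := Ex_le (LoneZ (-1) iq) iS (fun om => _); rewrite (ExZ (-1) iq) (ExZ (L * M) id) -/(Dt t).
  move=> H1; apply: le_trans (H1 _); last by move=> om; rewrite mulN1r.
  rewrite mulN1r lerN2; apply: le_trans small'.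
  have h1 := mulr_ge0 (addr_ge0 (ler0n R 2) K20) (addr_ge0 Et0 Dt0).
  have h2 := mulr_ge0 LM0 Et0.
  by rewrite [leRHS]mulrDl mulrDr; lra.
- rewrite (_ : (fun om => _) = cst 0); last first.
    apply/funext => om; apply/eqP; rewrite eq_le; have [_ _ _ ->] := H om; rewrite andbT.
    apply: sumr_le0 => i _; have [[_ /(_ i)/andP[l0 _]] _ _ _] := H om.
    by rewrite mulr_ge0_le0//; exact: ((xh_feasible om t1).1 i).
  by rewrite (expectationE (Lone_cst P 0)) Ex_cst lee_fin oppr_le0 ltW.
Qed.

Lemma costa_moments : exists E D : nat -> R,
  [/\ (forall t, (1 <= t)%N -> 0 <= E t) /\ (forall t, (1 <= t)%N -> 0 <= D t),
  E 1%N <= 2 * sigma ^+ 2,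
  (forall t, (1 <= t)%N -> E t.+1 <=
    (1 - beta kbar w c t.+1) ^+ 2 * E t + 2 * beta kbar w c t.+1 ^+ 2 * sigma ^+ 2
    + 2 * (1 - beta kbar w c t.+1) ^+ 2 * L ^+ 2 * (eta kbar w t ^+ 2 * D t)),
  (forall S, (1 <= S)%N -> \sum_(1 <= t < S.+1) eta kbar w t / 2 * D t <=
     `|B1| + \sum_(1 <= t < S.+1) eta kbar w t * E t) &
  forall eps t, 0 < eps -> (1 <= t)%N -> E t + D t <= kkt_level L rho BU * eps ->
    exists (lam : T -> 'rV[R]_J) (nu : T -> 'rV[R]_I), eps_KKT xi f u h g eps (xh t) lam nu].
Proof.
exists Et, Dt; split.
- by split=> t _; apply: Ex_ge0 => om; exact: sqr_ge0.
- exact: initial_variance.2.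
- by move=> t t1; have [i1 i2] := moments_integrable t1; exact: (variance_recursion t1 i1 i2).2.
- exact: expected_descent.
- exact: kkt_iterate.
Qed.

End Convergence.

Theorem corollary3 (R : realType) (n I J : nat)
    (L G sigma B1 BU chi rho mu kbar w c : R)
    (chi_ge0 : 0 <= chi) (rho_gt0 : 0 < rho)
    (chi_rho : rho / L * (G + rho / 2) <= chi)
    (w_gt0 : 0 < w) (c_gt0 : 0 < c)
    (kbar_bnd : 0 < kbar <= w `^ 3^-1)
    (c_ub : c <= w `^ (2 / 3) / (4 * kbar ^+ 2))
    (c_lb : 8 * L ^+ 2 + 1 / (3 * kbar ^+ 3) < c)
    (mu_lb : 3 / 4 < mu)
    (w_lb : Num.max ((2 * L * kbar / (4 * mu - 3)) ^+ 3) (2 * G ^+ 2) <= w) :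
  exists C p : R, [/\ 0 < C, 0 < p &
    forall (d d' : measure_display) (T : measurableType d)
      (Xi : measurableType d') (P : probability T R)
      (xi : {RV P >-> Xi}) (xis : nat -> {RV P >-> Xi})
      (f : 'rV[R]_n -> Xi -> R) (u : 'rV[R]_n -> \bar R)
      (h : 'I_I -> 'rV[R]_n -> R) (g : 'I_J -> 'rV[R]_n -> R)
      (fhat : 'rV[R]_n -> 'rV[R]_n -> Xi -> R)
      (gtil : 'I_J -> 'rV[R]_n -> 'rV[R]_n -> R)
      (x1 : 'rV[R]_n) (x z xh : nat -> T -> 'rV[R]_n),
    (* standing assumptions *)
    (forall y, measurable_fun setT (f y)) ->
    (forall s y, differentiable (f ^~ s) y) ->
    econvex u ->
    (forall i, convex_function setT (h i)) ->
    (forall y, Xset h g y ->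
       convex_set (Xsur h gtil y) /\ Xsur h gtil y `<=` Xset h g) ->
    iid_samples xi xis ->
    costa f u h xis fhat gtil kbar w c x1 x z xh ->
    (* (i) *)
    Xset h g `<=` Dset xi f u h g ->
    (* (ii) *)
    (-oo < Fstar xi f u h g)%E ->
    Xset h g x1 ->
    (Fobj xi f u x1 - Fstar xi f u h g <= B1%:E)%E ->
    (* (iii) *)
    (forall y y', ('E_P[fun om => (enorm (grad (f ^~ (xi om)) y
                                   - grad (f ^~ (xi om)) y') ^+ 2)%R]
                   <= (L ^+ 2 * enorm (y - y') ^+ 2)%:E)%E) ->
    (forall y y', ('E_P[fun om => `|f y (xi om) - f y' (xi om)|%R]
                   <= (G * enorm (y - y'))%:E)%E) ->
    (* (iv) *)
    (forall i, smooth_on setT L (h i) /\ lip_on setT G (h i)) ->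
    (forall j, smooth_on setT L (g j) /\ lip_on setT G (g j)) ->
    (* (v) *)
    (forall y, Xset h g y ->
       ('E_P[fun om => (enorm (grad (f ^~ (xi om)) y - gradU xi f y) ^+ 2)%R]
          <= (sigma ^+ 2)%:E)%E) ->
    (* (vi) *)
    MFCQ h g chi rho ->
    (* (vii) *)
    (forall y s, Xset h g y ->
       strongly_convex mu (fun y' => fhat y' y s) /\
       smooth_on setT L (fun y' => fhat y' y s)) ->
    (forall y s, Xset h g y ->
       grad (fun y' => fhat y' y s) y = grad (f ^~ s) y) ->
    (* (viii) *)
    (forall y j, Xset h g y ->
       [/\ convex_function (Xset h g) (fun y' => gtil j y' y),
           smooth_on (Xset h g) L (fun y' => gtil j y' y),
           lip_on (Xset h g) G (fun y' => gtil j y' y),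
           grad (fun y' => gtil j y' y) y = grad (g j) y &
           (forall y', Xset h g y' -> g j y' <= gtil j y' y) /\
           gtil j y y = g j y]) ->
    (* (ix) *)
    (forall t om y, (1 <= t)%N -> Xset h g y ->
       let phi := subobj f u fhat (beta kbar w c t) (x t om) (x t.-1 om)
                    (z t om) (xis t om) in
       (phi y - minval (Xsur h gtil (x t om)) phi <= BU%:E)%E) ->
    forall eps : R, 0 < eps < 1 ->
      exists t : nat, [/\ (1 <= t)%N,
        t%:R <= C * eps `^ (- (3 / 2)) * (ln (expR 1 / eps)) `^ p &
        exists (lam : T -> 'rV[R]_J) (nu : T -> 'rV[R]_I),
          eps_KKT xi f u h g eps (xh t) lam nu]].
Proof.
have /andP[k0 kw'] := kbar_bnd.
have mu0 : 0 < mu by apply: lt_trans mu_lb; rewrite divr_gt0.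
(* For [L <= 0] the assumptions are contradictory and any constants do: the unit vector supplied by
   MFCQ and the origin are distinct points, at which strong convexity and smoothness of the
   surrogate would give [mu <= L]. *)
have [Lneg|L0] := leP L 0.
  exists 1, 1; split=> // d d' T Xi P xi xis f u h g fhat gtil x1 x z xh _ _ _ _ _ _ _ _ _ Xx1 _ _ _ _ _ _
    mfcq sfhat _ _ _ eps _; exfalso.
  have [dir [dir1 _ _]] := mfcq x1 Xx1; have [sc sm] := sfhat x1 point Xx1.
  have /(_ _) := strongly_convex_smooth (x := dir) (y := 0) sc sm.
  by rewrite subr0 dir1 ltr01 => /(_ isT); rewrite leNgt (le_lt_trans Lneg mu0).
have lev0 : 0 < kkt_level L rho BU.
  rewrite invr_gt0; have M0 : 0 <= 2 * L * `|BU| / rho ^+ 2.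
    by rewrite divr_ge0 ?sqr_ge0// mulr_ge0// mulr_ge0// ltW.
  rewrite ltr_wpDr//; first by rewrite mulr_ge0// ltW.
  by rewrite ltr_wpDr// mulr_ge0// sqr_ge0.
have c_ub' : c <= croot w ^+ 2 / (4 * kbar ^+ 2) by rewrite -croot_sqr// ltW.
(* The cube root of the first lower bound on [w] is [2 L kbar <= (4 mu - 3) croot w]; divided by
   [2 croot (w + t)] it bounds [L eta_t]. *)
have step_small t : L * eta kbar w t <= 2 * mu - 3 / 2.
  have m0 : 0 < 4 * mu - 3 by move: mu_lb; rewrite ltr_pdivrMr//; lra.
  have s0 : 0 < 2 * L * kbar / (4 * mu - 3) by rewrite divr_gt0// mulr_gt0// mulr_gt0.
  have : 2 * L * kbar / (4 * mu - 3) <= croot w.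
    rewrite -(@ler_pXn2r _ 3) ?nnegrE ?croot_ge0 ?(ltW s0)// crootK ?(ltW w_gt0)//.
    by move: w_lb; rewrite ge_max => /andP[].
  rewrite ler_pdivrMr// => H.
  rewrite etaE mulrA ler_pdivrMr ?croot_gt0//; last by rewrite ltr_wpDr.
  have : croot w <= croot (w + t%:R) by apply: croot_le; [exact: ltW|rewrite lerDl].
  move=> /(ler_wpM2r (ltW m0)); lra.
have [C C0 rate] := kkt_rate sigma w_gt0 c_gt0 k0 kw' L0 c_ub' c_lb (normr_ge0 B1) lev0.
exists C, 3; split=> // d d' T Xi P xi xis f u h g fhat gtil x1 x z xh mf df cu ch Xsc iid alg XD Ffin
  Xx1 FB1 lipgrad lipf sh sg var mfcq sfhat gfhat sgtil gap eps eps01.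
(* The sign of [G] comes from the [L^1] Lipschitz bound between a unit vector and the origin, whose
   left-hand side is nonnegative. *)
have G0 : 0 <= G.
  have [dir [dir1 _ _]] := mfcq x1 Xx1.
  have := lipf dir 0; rewrite subr0 dir1 mulr1 -lee_fin; apply: le_trans.
  by apply: expectation_ge0 => om; exact: normr_ge0.
have [E [D [[E0 D0] E1 rec desc kkt]]] := costa_moments L0 G0 rho_gt0 mu_lb w_gt0 k0 kw' chi_rho
  step_small mf df cu ch Xsc iid alg XD Ffin Xx1 FB1 lipgrad lipf sh sg var mfcq sfhat gfhat sgtil gap.
have [t [t1 tC small]] := rate E D E0 D0 E1 rec desc eps eps01.
exists t; split=> //; apply: kkt => //; by case/andP: eps01.
Qed.
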